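(* Let $d\ge1$, $\delta>1$, $\beta>0$ and $0<\gamma<1$. Let $\rho:\mathbb{R}_+\to[0,1]$ be a non-increasing integrable function with $\int_{\mathbb{R}^d}\rho(|x|^d)\,dx=1$ that is regularly varying with index $-\delta$, i.e. $\lim_{r\to\infty}\rho(cr)/\rho(r)=c^{-\delta}$ for all $c\ge1$. Let $(\mathscr{G}_t)_{t\ge0}$ be the age-based (spatial) preferential attachment network with profile function $\rho$ and parameters $\beta,\gamma$. Then $(\mathscr{G}_t)_{t\ge 0}$ is robust if $\gamma>\frac{\delta}{\delta+1}$, and non-robust if $\gamma<\frac{\delta}{\delta+1}$.
   Context: Let $\mathbb{T}^d_1=(-1/2,1/2]^d$ be the torus of volume one, with the torus metric $d(x,y)=\min\{|x-y+u|:u\in\{-1,0,1\}^d\}$ (in the expression $d(x,y)^d$ below, the exponent $d$ is the dimension). Age-based preferential attachment network: a growing sequence of random graphs $(\mathscr{G}_t)_{t\ge0}$ on $\mathbb{T}^d_1$. The graph at time $t=0$ has no vertices and no edges. Vertices arrive successively after independent exponential waiting times with parameter one, and are placed independently and uniformly on $\mathbb{T}^d_1$; a vertex created at time $s$ and placed at $y$ is denoted $(y,s)$. Given the graph $\mathscr{G}_{t-}$, a vertex $(x,t)$ born at time $t$ is connected by an edge to each existing vertex $(y,s)$ (so $s<t$) independently with conditional probability $$\rho\left(\frac1\beta\,\frac{t\,d(x,y)^d}{(t/s)^{\gamma}}\right).$$ Percolated network: for $p\in(0,1]$, $(\mathscr{G}^p_t)_{t\ge0}$ is obtained by keeping each edge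 of the network independently with probability $p$ and removing it otherwise. Giant component: a sequence of graphs $(\mathscr{G}_t)_{t\ge0}$ has a giant component if, with $|\mathscr{C}_t|$ denoting the size (number of vertices) of the largest connected component of $\mathscr{G}_t$, $$\lim_{\varepsilon\downarrow0}\limsup_{t\to\infty}\mathbb{P}\{|\mathscr{C}_t|/t<\varepsilon\}=0.$$ Robustness: $(\mathscr{G}_t)_{t\ge0}$ is robust if $(\mathscr{G}_t^p)_{t\ge0}$ has a giant component for every $p\in(0,1]$; otherwise it is non-robust. *)

(* Defs.v *)
From HB Require Import structures.
From mathcomp Require Import all_boot all_order all_algebra finmap.
From mathcomp Require Import all_classical all_reals all_analysis.
Set Implicit Arguments.
Unset Strict Implicit.
Unset Printing Implicit Defensive.
Import Order.TTheory GRing.Theory Num.Theory.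
Import numFieldNormedType.Exports.
Local Open Scope classical_set_scope.
Local Open Scope ring_scope.

(* Lebesgue measure on R^d, carried by [d.-tuple R]: the [d]-fold product of the
   one-dimensional Lebesgue measure, transported along [(x, v) |-> x :: v]. *)

Section lebesgue_tuple.
Context {R : realType}.
Local Open Scope ereal_scope.

Definition cons_pair n (xv : R * n.-tuple R) : n.+1.-tuple R :=
  [tuple of xv.1 :: xv.2].

Lemma measurable_cons_pair n :
  measurable_fun [set: R * n.-tuple R] (@cons_pair n).
Proof. exact: measurable_cons. Qed.

Section step.
Variables (n : nat) (mu : {sigma_finite_measure set (n.-tuple R) -> \bar R}).

Definition lebesgue_cons : set (n.+1.-tuple R) -> \bar R :=
  pushforward (@lebesgue_measure R \x mu) (@cons_pair n).

Let mpre (A : set (n.+1.-tuple R)) :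
  measurable A -> measurable (@cons_pair n @^-1` A).
Proof.
by move=> mA; rewrite -[X in measurable X]setTI; exact: measurable_cons_pair.
Qed.

Let lebesgue_cons0 : lebesgue_cons set0 = 0.
Proof. by rewrite /lebesgue_cons /pushforward preimage_set0 measure0. Qed.

Let lebesgue_cons_ge0 A : 0 <= lebesgue_cons A.
Proof. exact: (measure_ge0 (@lebesgue_measure R \x mu)). Qed.

Let lebesgue_cons_sigma_additive : semi_sigma_additive lebesgue_cons.
Proof.
move=> F mF tF mUF; rewrite /lebesgue_cons /pushforward preimage_bigcup.
apply: measure_semi_sigma_additive.
- by move=> k; exact: mpre.
- apply/trivIsetP => i j _ _ ij; rewrite -preimage_setI.
  by move/trivIsetP : tF => /(_ _ _ _ _ ij) ->//; rewrite preimage_set0.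
- by rewrite -preimage_bigcup; exact: mpre.
Qed.

HB.instance Definition _ := isMeasure.Build _ _ _ lebesgue_cons
  lebesgue_cons0 lebesgue_cons_ge0 lebesgue_cons_sigma_additive.

Lemma lebesgue_consX (A : set R) (B : set (n.-tuple R)) :
  measurable A -> measurable B ->
  lebesgue_cons [set v | A (thead v) /\ B [tuple of behead v]] =
  lebesgue_measure A * mu B.
Proof.
move=> mA mB; rewrite -product_measure1E//; congr ((_ \x _) _).
apply/seteqP; split => -[x v] /= [Ax Bv]; split => //.
- by move: Bv; congr B; exact/val_inj.
- by move: Bv; congr B; exact/val_inj.
Qed.

Let lebesgue_cons_sigma_finite : sigma_finite setT lebesgue_cons.
Proof.
have /sigma_finiteP[F [TF ndF Foo]] := sigma_finiteT (@lebesgue_measure R).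
have /sigma_finiteP[G [TG ndG Goo]] := sigma_finiteT mu.
exists (fun k => [set v | F k (thead v) /\ G k [tuple of behead v]]).
  apply/esym/seteqP; split => // v _.
  have [i _ Fi] : (\bigcup_i F i) (thead v) by rewrite -TF.
  have [j _ Gj] : (\bigcup_i G i) [tuple of behead v] by rewrite -TG.
  exists (maxn i j) => //=; split.
  - by move: Fi; exact/subsetPset/ndF/leq_maxl.
  - by move: Gj; exact/subsetPset/ndG/leq_maxr.
move=> k; have [mFk Fk] := Foo k; have [mGk Gk] := Goo k; split; last first.
  by rewrite lebesgue_consX// lte_mul_pinfty// ge0_fin_numE.
apply: measurableI.
- rewrite -[X in measurable X]setTI.
  exact: (@measurable_tnth _ R n.+1 ord0 measurableT (F k)).
- rewrite -[X in measurable X]setTI.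
  exact: (@measurable_behead _ R n measurableT (G k)).
Qed.

HB.instance Definition _ := Measure_isSigmaFinite.Build _ _ _ lebesgue_cons
  lebesgue_cons_sigma_finite.

End step.

Fixpoint lebesgue_tuple (d : nat) :
    {sigma_finite_measure set (d.-tuple R) -> \bar R} :=
  match d with
  | 0%N => dirac ([tuple] : 0.-tuple R)
  | n.+1 => lebesgue_cons (lebesgue_tuple n)
  end.

Lemma lebesgue_tuple_box (d : nat) (A : 'I_d -> set R) :
  (forall i, measurable (A i)) ->
  lebesgue_tuple d [set v | forall i, A i (tnth v i)] =
  \prod_(i < d) lebesgue_measure (A i).
Proof.
elim: d A => [|d IH] A mA; rewrite ?big_ord0 ?big_ord_recl /=.
  by rewrite diracE mem_set// => -[].
rewrite -IH// -lebesgue_consX//; last first.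
  rewrite (_ : mkset _ =
      \bigcap_(i in [set: 'I_d]) ((@tnth _ R)^~ i @^-1` A (lift ord0 i))).
    apply: fin_bigcap_measurable => [|i _]; first exact: finite_finset.
    rewrite -[X in measurable X]setTI.
    exact: (@measurable_tnth _ R d i measurableT).
  by apply/seteqP; split => v /= Av i; [move=> _; exact: Av|exact: Av].
congr lebesgue_cons; apply/seteqP; split => v /= Av.
- split; first exact: Av.
  move=> i; have := Av (lift ord0 i).
  by rewrite {1}(tuple_eta v) tnthS.
- case: Av => A0 AS i; case: (unliftP ord0 i) => [j|] ->//.
  by rewrite (tuple_eta v) tnthS.
Qed.

End lebesgue_tuple.

Section torus.
Context {R : realType} {d : nat}.

Definition enorm (x : 'I_d -> R) : R := Num.sqrt (\sum_i x i ^+ 2).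

Definition torus : set (d.-tuple R) :=
  [set x | forall i, - 2^-1 < tnth x i <= 2^-1].

(* [u] ranges over {-1, 0, 1}^d: the coordinate [k : 'I_3] of the index stands
   for [k - 1]. The default value of the minimum is the term for [u = 0]. *)
Definition torus_dist (x y : d.-tuple R) : R :=
  \big[Num.min/enorm (fun i => tnth x i - tnth y i)]_(u : {ffun 'I_d -> 'I_3})
    enorm (fun i => tnth x i - tnth y i + ((u i : nat)%:R - 1)).

End torus.

(* Only the values of [rho] on [0, +oo[ matter. *)
Record profile_function {R : realType} (d : nat) (delta : R) (rho : R -> R) :
    Prop := ProfileFunction {
  profile_bounds : forall r, 0 <= r -> 0 <= rho r <= 1 ;
  profile_nonincreasing : forall r s, 0 <= r -> r <= s -> rho s <= rho r ;
  profile_integrable :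
    lebesgue_measure.-integrable `[0, +oo[ (EFin \o rho) ;
  profile_normalized :
    (\int[lebesgue_tuple d]_x (rho (enorm (tnth x) ^+ d))%:E = 1)%E ;
  profile_regularly_varying : forall c, 1 <= c ->
    rho (c * r) / rho r @[r --> +oo] --> c `^ (- delta)
}.

Definition mutually_independent {R : realType} {disp : measure_display}
    {T : measurableType disp} (P : probability T R) {I : choiceType}
    (D : set I) (F : I -> set (set T)) : Prop :=
  forall (J : {fset I}) (A : I -> set T),
    [set` J] `<=` D -> (forall i, i \in J -> F i (A i)) ->
    P (\bigcap_(i in [set` J]) A i) = (\prod_(i <- J) P (A i))%E.

Record graph := Graph { vertex : pred nat ; adj : rel nat }.

Definition component (g : graph) (n : nat) : set nat :=
  [set m | [/\ vertex g n, vertex g m &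
                exists s : seq nat, path (adj g) n s /\ last n s = m]].

(* [component g n] is empty when [n] is not a vertex of [g]. *)
Definition largest_component {R : realType} (g : graph) : \bar R :=
  ereal_sup (range (fun n => counting (component g n))).

Section random_graphs.
Context {R : realType} {disp : measure_display} {T : measurableType disp}.
Variable P : probability T R.
Implicit Types G : R -> T -> graph.

Definition giant_component G : Prop :=
  limf_esup (fun t : R =>
      P [set w | (largest_component (G t w) * (t^-1)%:E < eps%:E)%E])
    (+oo%R : set_system R)
  @[eps --> 0^'+] --> 0%E.

(* The edge between [j < k] is kept when [K j k] holds; [adj] is read as a
   symmetric relation. *)
Definition percolate G (K : nat -> nat -> T -> bool) : R -> T -> graph :=
  fun t w => Graph (vertex (G t w))
    (fun j k => adj (G t w) j k && K (minn j k) (maxn j k) w).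

(* [K p] is the family of retention marks used for percolation with
   parameter [p]. *)
Definition robust G (K : R -> nat -> nat -> T -> bool) : Prop :=
  forall p, 0 < p <= 1 -> giant_component (percolate G (K p)).

End random_graphs.

(* Vertices are numbered from 0 in the order of arrival; vertex [n] is born at
   [birth_time n], after the waiting time [W n], at the position [X n].
   For [j < k], [E j k] tells whether vertex [k] has been connected to the
   older vertex [j]; the other values of [E] are not used. *)

Section network.
Context {R : realType} {disp : measure_display} {T : measurableType disp}.
Context {d : nat}.
Variables (W : nat -> {mfun T >-> R}) (X : nat -> {mfun T >-> d.-tuple R}).
Variable E : nat -> nat -> {mfun T >-> bool}.

Definition birth_time (n : nat) (w : T) : R := \sum_(k < n.+1) W k w.

Definition network (t : R) (w : T) : graph :=
  let born := fun n => birth_time n w <= t in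
  Graph born
    (fun j k => [&& born j, born k, j != k & E (minn j k) (maxn j k) w]).

(* Sigma-algebra of the waiting times and positions of the vertices [0..n-1] and
   of the edges between them, i.e. of the graph just before the birth of [n]. *)
Definition past (n : nat) : set (set T) :=
  <<s \bigcup_(k in `I_n)
        (g_sigma_algebra_preimage (W k) `|` g_sigma_algebra_preimage (X k) `|`
         \bigcup_(j in `I_k) g_sigma_algebra_preimage (E j k)) >>.

Definition past_and_birth (n : nat) : set (set T) :=
  <<s past n `|` g_sigma_algebra_preimage (W n)
             `|` g_sigma_algebra_preimage (X n) >>.

Definition connection_prob (rho : R -> R) (beta gamma : R) (j k : nat) (w : T)
    : R :=
  let s := birth_time j w in
  let t := birth_time k w in
  rho (beta^-1 * (t * torus_dist (X k w) (X j w) ^+ d / (t / s) `^ gamma)).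

Record age_based_network (P : probability T R) (rho : R -> R)
    (beta gamma : R) : Prop := AgeBasedNetwork {
  waiting_time_gt0 : forall n w, 0 < W n w ;
  waiting_time_exponential : forall n (A : set R), measurable A ->
    distribution P (W n) A = exponential_prob 1 A ;
  position_torus : forall n w, torus (X n w) ;
  position_uniform : forall n (A : set (d.-tuple R)), measurable A ->
    distribution P (X n) A = lebesgue_tuple d (A `&` torus) ;
  birth_independent : forall n,
    mutually_independent P [set: 'I_3]
      (tnth [tuple past n; g_sigma_algebra_preimage (W n);
                   g_sigma_algebra_preimage (X n)]) ;
  (* Given the past and the birth of [n], the events [E j n] for [j < n] are
     conditionally independent with probabilities [connection_prob]. *)
  edges_conditional : forall n (J : {set 'I_n}) (A : set T),
    past_and_birth n A ->
    P (A `&` [set w | forall j : 'I_n, j \in J -> E j n w]) =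
    (\int[P]_(w in A)
       \prod_(j in J) (connection_prob rho beta gamma j n w)%:E)%E
}.

(* The retention marks of distinct edges are independent Bernoulli variables
   with parameter [p], and independent of the network ([None]). *)
Record percolation_marks (P : probability T R) (p : R)
    (K : nat -> nat -> {mfun T >-> bool}) : Prop := PercolationMarks {
  mark_bernoulli : forall j k, (j < k)%N -> P (K j k @^-1` [set true]) = p%:E ;
  marks_independent :
    mutually_independent P
      [set e : option (nat * nat) | if e is Some (j, k) then (j < k)%N else true]
      (fun e => if e is Some (j, k) then g_sigma_algebra_preimage (K j k)
                else <<s \bigcup_n past n >>)
}.

End network.

(* Main.v *)
Require Import Defs.
From HB Require Import structures.
From mathcomp Require Import all_boot all_order all_algebra finmap.
From mathcomp Require Import all_classical all_reals all_analysis.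
From mathcomp Require Import measurable_realfun.
From mathcomp Require Import ring lra zify.
Set Implicit Arguments.
Unset Strict Implicit.
Unset Printing Implicit Defensive.
Import Order.TTheory GRing.Theory Num.Theory.
Import numFieldNormedType.Exports.
Local Open Scope classical_set_scope.
Local Open Scope ring_scope.

(** The number of vertices present at time [t] is of order [t], and the vertex
numbered [k] is born at a time of order [k]. Hence the vertices [j < k] at
distance [D] are connected with probability about
[rho (k^(1 - gamma) * j^gamma * D^d / beta)], and regular variation bounds [rho]
between powers with exponents as close to [- delta] as needed
([profile_upper_bound], [profile_lower_bound]). The two halves of the theorem
are proved independently.

Non-robustness. Let [gamma < delta / (delta + 1)] and choose [del < delta] with
[(1 - gamma) * (1 + del) > 1]. For a small retention probability, an edge which
is long compared to the scale [tau] of its ends is kept with probability at most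
[(tau / v)^del], where [v = k^(1 - gamma) * j^gamma * D^d]. Two connected
vertices are joined by a geodesic of the graph in which all short steps are
added for free ([geodesic]), and non-consecutive vertices of a geodesic are far
from each other. The expected number of such paths is computed by removing their
vertices from the youngest to the oldest: a young vertex [n] between [a] and [b]
only contributes a factor of order [tau * n^-s * max(a, b)^(s - 1)] with
[s = (1 - gamma) * (1 + del) > 1] ([interior_sum]), because one of its two steps
has to cover a fixed part of the long distance from [a] to [b]. Since [s > 1],
these factors are summable and the losses can be absorbed in the weights of the
remaining path ([insertion_sum], [sum_path_sum_le]). There are thus only
[O(N^(1 + gamma))], that is [o(N^2)], expected connected pairs among the first
[N] vertices ([connected_pairs_bound]), which excludes a giant component
([not_giant_component]). Positions are discretised in cells, so that
expectations over positions are finite averages.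

Robustness. Let [gamma > delta / (delta + 1)] and choose [del > delta] with
[del * (1 - gamma) < gamma]. Write [b = 2^d] and consider [b^F] vertices, of the
order of [t]. A dyadic box of side [2^(m - F)] is expected to contain [b^m] of
them, and its first vertex has age about [b^(F - m)]; the first vertex of the
parent box is of the same age. A young vertex, with index between [b^(F - 1)] and
[b^F], is joined to the first vertex of the box with a probability bounded from
below as soon as its distance to it is at most [2^(gamma m - F)], and then to the
first vertex of the parent with probability about [b^(- del (1 - gamma) m)]. The
expected number of such connectors is about [b^((gamma - del (1 - gamma)) m)],
and this exponent is positive: the link from a box to its parent fails with a
probability which decays geometrically in [m] ([dyadic_link_failure]). The links
lead from each box to the whole torus, whose first vertex is the vertex [0]
([first_in_component]). For [m0] large, most boxes of level [m0] have no failed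
link among their ancestors, and their first vertices are distinct members of the
component of [0], which has therefore of order [b^(F - m0)] vertices
([pr_small_component_le], [supercritical_giant_component]). Percolation only
multiplies the probability of a connector by [p^2], by independence of the marks
([pr_unlinked_le]). *)

(** * Power bounds for the profile function *)

(** The basis of all telescoping estimates below: [(x + 1)^-(s + 1)] is dominated by
a decrement of [x^-s]. *)
Lemma powR_decrement (R : realType) (s x : R) : 0 < s -> 0 < x ->
  s * (x + 1) `^ (- (s + 1)) <= x `^ (- s) - (x + 1) `^ (- s).
Proof.
move=> s0 x0; have x10 : 0 < x + 1 by lra.
have q0 : 0 < (x + 1) / x by rewrite divr_gt0.
have -> : x `^ (- s) = (x + 1) `^ (- s) * ((x + 1) / x) `^ s.
  rewrite powRM ?invr_ge0 ?(ltW x0) ?(ltW x10)// mulrA !powRN mulVf ?mul1r ?gt_eqF ?powR_gt0//.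
  by rewrite -[x^-1]powR_inv1 ?ltW// -powRrM mulN1r powRN.
have -> : (x + 1) `^ (- (s + 1)) = (x + 1) `^ (- s) * (x + 1)^-1.
  rewrite opprD powRD; last by rewrite (gt_eqF x10) implybT.
  by rewrite powR_inv1// ltW.
rewrite mulrCA -[X in _ - X]mulr1 -mulrBr ler_wpM2l ?powR_ge0//.
rewrite lerBrDl /powR gt_eqF//; apply: (le_trans _ (expR_ge1Dx _)).
rewrite lerD2l ler_wpM2l ?(ltW s0)//.
have xx : 0 < x / (x + 1) by rewrite divr_gt0.
have E : x / (x + 1) - 1 = - (x + 1)^-1 by field; rewrite gt_eqF.
have := @le_ln1Dx R (x / (x + 1) - 1).
have -> : 1 + (x / (x + 1) - 1) = x / (x + 1) by lra.
rewrite E ltrN2 => H.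
have i0 : 0 < x + 1 by [].
have {}H : ln (x / (x + 1)) <= - (x + 1)^-1.
  by apply: H; rewrite invf_lt1//; lra.
rewrite ln_div ?posrE//; move: H; rewrite ln_div ?posrE// => H.
by rewrite lerNr opprB in H.
Qed.

Section profile.
Context {R : realType} {d : nat} {delta : R} {rho : R -> R}.
Hypothesis rhoP : profile_function d delta rho.

Lemma profile_ge0 (r : R) : 0 <= r -> 0 <= rho r.
Proof. by move=> /(profile_bounds rhoP)/andP[]. Qed.

Lemma profile_le1 (r : R) : 0 <= r -> rho r <= 1.
Proof. by move=> /(profile_bounds rhoP)/andP[]. Qed.

(** A zero of [rho] at [r] would propagate beyond [r] by monotonicity, and the ratios
[rho s / rho s], which are then [0], could not tend to [1]. *)
Lemma profile_gt0 (r : R) : 0 <= r -> 0 < rho r.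
Proof.
move=> r0; rewrite lt_neqAle profile_ge0// andbT; apply/eqP => rr.
have rs0 s : r <= s -> rho s = 0.
  move=> rs; apply/eqP; rewrite eq_le profile_ge0 ?(le_trans r0)// andbT.
  by rewrite rr; exact: (profile_nonincreasing rhoP).
have /cvgr_dist_lt/(_ 1 ltr01) := profile_regularly_varying rhoP (lexx 1).
rewrite powR1 => -[M [_ HM]]; have := HM (Num.max M r + 1).
have Mr : r <= Num.max M r + 1.
  by rewrite (@le_trans _ _ (Num.max M r)) ?le_max ?lexx ?orbT// lerDl.
rewrite mul1r rs0// mul0r subr0 normr1 ltxx => H.
by have /H : M < Num.max M r + 1 by rewrite ltr_pwDr// le_max lexx.
Qed.

Lemma profile_double_near (e : R) : 0 < e ->
  exists2 M, 0 < M & forall r, M <= r ->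
    (2 `^ (- delta) - e) * rho r <= rho (2 * r) <= (2 `^ (- delta) + e) * rho r.
Proof.
move=> e0.
have /cvgr_dist_lt/(_ _ e0) := profile_regularly_varying rhoP (ler1n R 2).
move=> -[M [_ HM]]; exists (Num.max M 0 + 1).
  by rewrite ltr_wpDl// le_max lexx orbT.
move=> r Mr; have Mr' : M < r.
  by rewrite (lt_le_trans _ Mr)// ltr_pwDr// le_max lexx.
have r0 : 0 <= r by rewrite (le_trans _ Mr)// addr_ge0// le_max lexx orbT.
have pr := profile_gt0 r0.
have := HM r Mr'; rewrite distrC ltr_distl => /andP[H1 H2].
apply/andP; split; first by rewrite -ler_pdivlMr// ltW.
by rewrite -ler_pdivrMr// ltW.
Qed.

(** One half of Potter's bounds. Beyond some [M], doubling the argument multiplies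
[rho] by at most [2^-del], so [r^del * rho r] does not increase along doublings. *)
Lemma profile_upper_bound (del : R) : 0 < del < delta ->
  exists2 C, 0 < C & forall r, 0 < r -> rho r <= C * r `^ (- del).
Proof.
move=> /andP[d0 dd].
have e0 : 0 < 2 `^ (- del) - 2 `^ (- delta) :> R.
  by rewrite subr_gt0 /powR pnatr_eq0/= ltr_expR ltr_pM2r ?ln_gt0 ?ltr1n// ltrN2.
have [M M0 HM] := profile_double_near e0.
have M20 : 0 < 2 * M by rewrite mulr_gt0.
have p2 : 0 < 2 `^ del :> R by rewrite powR_gt0.
pose C := (2 * M) `^ del; have C0 : 0 < C by rewrite powR_gt0.
suff H : forall k r, 0 < r -> r <= 2 ^+ k * M -> r `^ del * rho r <= C.
  exists C => // r r0; rewrite powRN ler_pdivlMr ?powR_gt0// mulrC.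
  have [k Hk] : exists k, r / M <= k%:R.
    by exists (Num.truncn (r / M)).+1; rewrite ltW ?truncnS_gt.
  apply: (H k) => //; rewrite -ler_pdivrMr// (le_trans Hk)//.
  by rewrite -natrX ler_nat ltnW// ltn_expl.
elim=> [|k IH] r r0 rk.
  rewrite (@le_trans _ _ (r `^ del)) ?ler_piMr ?powR_ge0 ?profile_le1 ?(ltW r0)//.
  rewrite ge0_ler_powR ?nnegrE ?(ltW M20) ?(ltW r0) ?(ltW d0)//.
  by rewrite expr0 mul1r in rk; lra.
have [rM|Mr] := leP r (2 * M).
  rewrite (@le_trans _ _ (r `^ del)) ?ler_piMr ?powR_ge0 ?profile_le1 ?(ltW r0)//.
  by rewrite ge0_ler_powR ?nnegrE ?(ltW M20) ?(ltW r0) ?(ltW d0).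
have r2 : 0 < r / 2 by rewrite divr_gt0.
have := IH _ r2; rewrite ler_pdivrMr// -mulrA (mulrC M) mulrA -exprSr => /(_ rk).
apply: le_trans.
have /HM/andP[_] : M <= r / 2 by rewrite ler_pdivlMr// mulrC ltW.
rewrite (mulrC 2) divfK ?pnatr_eq0// (addrC (2 `^ (- delta))) subrK => Hr.
rewrite (le_trans (ler_wpM2l (powR_ge0 _ _) Hr))// mulrA ler_wpM2r ?profile_ge0 ?(ltW r2)//.
by rewrite powRM ?invr_ge0 ?(ltW r0)// -[2^-1]powR_inv1// -powRrM mulN1r lexx.
Qed.

(** The other half: with [del > delta], doubling the argument multiplies [rho] by at
least [2^-del] beyond some [M]. *)
Lemma profile_lower_bound (del : R) : 0 < delta < del ->
  exists2 C, 0 < C & forall r, 1 <= r -> C * r `^ (- del) <= rho r.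
Proof.
move=> /andP[d0 dd]; have del0 : 0 < del by exact: lt_trans dd.
have e0 : 0 < 2 `^ (- delta) - 2 `^ (- del) :> R.
  by rewrite subr_gt0 /powR pnatr_eq0/= ltr_expR ltr_pM2r ?ln_gt0 ?ltr1n// ltrN2.
have [M0 _ HM0] := profile_double_near e0.
pose M := Num.max M0 1; have M1 : 1 <= M by rewrite le_max lexx orbT.
have HM r : M <= r -> 2 `^ (- del) * rho r <= rho (2 * r).
  move=> Mr; have /HM0/andP[+ _] : M0 <= r by rewrite (le_trans _ Mr)// le_max lexx.
  by rewrite opprB addrCA subrr addr0.
have M0' : 0 < M by exact: lt_le_trans M1.
have M20 : 0 < 2 * M by rewrite mulr_gt0.
(* a lower bound of [rho] up to [2 * M], by monotonicity *)
pose C := rho (2 * M); have C0 : 0 < C by rewrite profile_gt0 ?ltW.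
suff H : forall k r, 1 <= r -> r <= 2 ^+ k * M -> C <= r `^ del * rho r.
  exists C => // r r1; have r0 : 0 < r by exact: lt_le_trans r1.
  rewrite powRN ler_pdivrMr ?powR_gt0// mulrC.
  have [k Hk] : exists k, r / M <= k%:R.
    by exists (Num.truncn (r / M)).+1; rewrite ltW ?truncnS_gt.
  apply: (H k) => //; rewrite -ler_pdivrMr// (le_trans Hk)//.
  by rewrite -natrX ler_nat ltnW// ltn_expl.
have small r : 1 <= r -> r <= 2 * M -> C <= r `^ del * rho r.
  move=> r1 rM; have r0 : 0 <= r by exact: le_trans r1.
  apply: (le_trans (profile_nonincreasing rhoP r0 rM)).
  rewrite ler_peMl ?profile_ge0//.
  by rewrite -[leLHS](powRr0 r) ler_powR// ltW.
elim=> [|k IH] r r1 rk; first by apply: small => //; rewrite expr0 in rk; lra.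
have [rM|Mr] := leP r (2 * M); first exact: small.
have r0 : 0 < r by exact: lt_le_trans r1.
have Mr2 : M <= r / 2 by rewrite ler_pdivlMr// mulrC ltW.
have := IH _ (le_trans M1 Mr2).
rewrite ler_pdivrMr// -mulrA (mulrC M) mulrA -exprSr => /(_ rk)/le_trans; apply.
have := HM _ Mr2; rewrite (mulrC 2) divfK ?pnatr_eq0// => Hr.
rewrite (le_trans _ (ler_wpM2l (powR_ge0 _ _) Hr))// mulrA ler_wpM2r//.
  by rewrite profile_ge0// divr_ge0// ltW.
by rewrite powRM ?invr_ge0 ?(ltW r0)// -[2^-1]powR_inv1// -powRrM mulN1r lexx.
Qed.
End profile.

(** * Sums over simple paths, by insertion of the youngest vertex *)

Section simple_seqs.

Definition ins (n l : nat) (w : seq nat) := take l w ++ n :: drop l w.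

(** The lists without repetition of indices below [n], built by insertion of the
largest index. Sums over these lists are treated by removing the largest index,
that is, the youngest vertex of a path. *)
Fixpoint simple_seqs n : seq (seq nat) :=
  if n is m.+1 then
    simple_seqs m ++
      flatten [seq [seq ins m l w | l <- index_iota 0 (size w).+1] | w <- simple_seqs m]
  else [:: [::]].

Lemma mem_simple_seqs n w : uniq w -> all (ltn^~ n) w -> w \in simple_seqs n.
Proof.
elim: n w => [|n IH] w uw aw /=; first by case: w aw {uw}.
rewrite mem_cat; have [nw|nw] := boolP (n \in w); apply/orP; [right|left]; last first.
  apply: IH => //; apply/allP => x xw; have := allP aw _ xw.
  by rewrite /= ltnS leq_eqVlt => /orP[/eqP xn|//]; rewrite -xn xw in nw.
have urw := rem_uniq n uw.
apply/flattenP; exists [seq ins n l (rem n w) | l <- index_iota 0 (size (rem n w)).+1].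
  apply/mapP; exists (rem n w) => //; apply: IH => //.
  apply/allP => x; rewrite (mem_rem_uniq _ uw) inE => /andP[xn xw].
  by have := allP aw _ xw; rewrite /= ltnS leq_eqVlt (negPf xn).
apply/mapP; exists (index n w).
  rewrite mem_index_iota leq0n/= ltnS size_rem// -ltnS prednK ?index_mem//.
  by rewrite (leq_ltn_trans (leq0n _) (_ : index n w < _)%N)// index_mem.
have iw : (index n w < size w)%N by rewrite index_mem.
have st : size (take (index n w) w) = index n w by rewrite size_takel// ltnW.
rewrite remE /ins take_size_cat// drop_size_cat//.
by rewrite -{1}(cat_take_drop (index n w) w) (drop_nth n iw) nth_index.
Qed.

Lemma simple_seqsP n w : w \in simple_seqs n -> uniq w /\ all (ltn^~ n) w.
Proof.
elim: n w => [|n IH] w; first by rewrite inE => /eqP ->.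
have lift v : all (ltn^~ n) v -> all (ltn^~ n.+1) v.
  by apply: sub_all => x /= /ltnW.
rewrite mem_cat => /orP[/IH[uw aw]|/flattenP[t]].
  by split => //; exact: lift.
case/mapP => v /IH[uv av] -> /mapP[l _ ->].
have p : perm_eq (ins n l v) (n :: v).
  by rewrite /ins -cat1s -[X in perm_eq _ (_ :: X)](cat_take_drop l) -cat1s perm_catCA.
rewrite (perm_uniq p) (perm_all _ p) /= uv ltnSn lift// andbT; split => //.
by apply/negP => /(allP av); rewrite /= ltnn.
Qed.

Lemma sum_simple_seqsS (R : nmodType) (F : seq nat -> R) n :
  \sum_(w <- simple_seqs n.+1) F w =
  \sum_(w <- simple_seqs n) (F w + \sum_(l < (size w).+1) F (ins n l w)).
Proof.
rewrite big_cat big_split; congr (_ + _).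
rewrite big_flatten [LHS]big_map; apply: eq_bigr => w _.
by rewrite big_map big_mkord.
Qed.

End simple_seqs.

Section insertion_sums.
Context {R : realFieldType}.
Variables (fin : nat -> nat -> nat -> R) (fend : nat -> nat -> R).
Variables (g : nat -> nat -> nat -> R) (s : nat -> nat -> R) (Phi : seq nat -> R).
Variable N : nat.

Hypotheses (fin0 : forall n a b, 0 <= fin n a b) (fend0 : forall n a, 0 <= fend n a).
Hypotheses (g0 : forall n a b, 0 <= g n a b) (s0 : forall n a, 0 <= s n a).
Hypothesis Phi0 : forall w, 0 <= Phi w.
Hypothesis send : forall n a, (a < n < N)%N ->
  s n.+1 a + fend n a * (g n.+1 a n * s n.+1 n) <= s n a.
Hypothesis sendl : forall n a, (a < n < N)%N ->
  s n.+1 a + fend n a * (s n.+1 n * g n.+1 n a) <= s n a.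
Hypothesis gin : forall n a b, (a < n < N)%N -> (b < n < N)%N ->
  g n.+1 a b + fin n a b * (g n.+1 a n * g n.+1 n b) <= g n a b.
Hypothesis Phi_end : forall n u a, (n < N)%N -> uniq (rcons u a) ->
  all (ltn^~ n) (rcons u a) ->
  Phi (rcons (rcons u a) n) <= fend n a * Phi (rcons u a).
Hypothesis Phi_beg : forall n u a, (n < N)%N -> uniq (a :: u) ->
  all (ltn^~ n) (a :: u) ->
  Phi (n :: a :: u) <= fend n a * Phi (a :: u).
Hypothesis Phi_in : forall n u v a b, (n < N)%N -> uniq (u ++ a :: b :: v) ->
  all (ltn^~ n) (u ++ a :: b :: v) ->
  Phi (u ++ a :: n :: b :: v) <= fin n a b * Phi (u ++ a :: b :: v).

Fixpoint tail_weight n a w :=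
  if w is b :: v then g n a b * tail_weight n b v else s n a.

(** The empty list pays in advance for the singletons that are yet to be created. *)
Definition seq_weight n w :=
  if w is a :: v then s n a * tail_weight n a v
  else \sum_(n <= m < N) s m.+1 m ^+ 2.

Fixpoint tail_factor n a w l :=
  if w is b :: v then if l is k.+1 then tail_factor n b v k else fin n a b
  else fend n a.

Lemma tail_weight_ge0 n a w : 0 <= tail_weight n a w.
Proof. by elim: w a => //= b w IH a; rewrite mulr_ge0. Qed.

Lemma tail_factor_ge0 n a w l : 0 <= tail_factor n a w l.
Proof. by elim: w a l => [//|b w IH] a [|l] /=. Qed.

(** The inserted index replaces one factor [g] (or the final factor [s]) by the two
factors around it, and the recursive inequalities absorb exactly this. *)
Lemma tail_weight_sum n a w : (n < N)%N -> (a < n)%N -> all (ltn^~ n) w ->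
  tail_weight n.+1 a w +
    \sum_(l < (size w).+1) tail_factor n a w l * tail_weight n.+1 a (ins n l w)
  <= tail_weight n a w.
Proof.
move=> nN; elim: w a => [|b w IH] a an /=.
  by rewrite big_ord_recl big_ord0 addr0 /= => _; apply: send; rewrite an.
move=> /andP[bn aw]; rewrite big_ord_recl /=.
have {IH} := IH _ bn aw.
set T := tail_weight _ b w; set S := \sum_(_ < _) _ => IH.
have -> : \sum_(i < (size w).+1) tail_factor n a (b :: w) (lift ord0 i) *
    tail_weight n.+1 a (ins n (lift ord0 i) (b :: w)) = g n.+1 a b * S.
  by rewrite mulr_sumr; apply: eq_bigr => i _ /=; rewrite mulrCA.
have T0 : 0 <= T by exact: tail_weight_ge0.
have S0 : 0 <= S.
  by apply: sumr_ge0 => i _; rewrite mulr_ge0 ?tail_factor_ge0 ?tail_weight_ge0.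
have G := @gin n a b; rewrite an bn nN in G; have {}G := G erefl erefl.
set G1 := g n.+1 a n * _ in G.
have -> : g n.+1 a n * (g n.+1 n b * T) = G1 * T by rewrite mulrA.
have G10 : 0 <= fin n a b * G1 by rewrite !mulr_ge0.
rewrite (@le_trans _ _ (g n a b * (T + S)))//; last exact: ler_wpM2l.
rewrite (@le_trans _ _ ((g n.+1 a b + fin n a b * G1) * (T + S)))//; last first.
  by rewrite ler_wpM2r// addr_ge0.
have := mulr_ge0 G10 S0; nra.
Qed.

Lemma Phi_tail n a u w l : (n < N)%N -> (l <= size w)%N -> uniq (u ++ a :: w) ->
  all (ltn^~ n) (u ++ a :: w) ->
  Phi (u ++ a :: ins n l w) <= tail_factor n a w l * Phi (u ++ a :: w).
Proof.
move=> nN; elim: w a u l => [|b w IH] a u l.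
  rewrite leqn0 => /eqP -> /=; rewrite -[u ++ [:: a; n]]/(u ++ ([:: a] ++ [:: n])).
  by rewrite catA !cats1 => ? ?; exact: Phi_end.
case: l => [_|l] /=; first by rewrite /ins/= => ? ?; exact: Phi_in.
by rewrite ltnS => lw; have := IH b (rcons u a) l lw; rewrite !cat_rcons.
Qed.

Lemma insertion_step n w : (n < N)%N -> Phi [:: n] <= Phi [::] ->
  uniq w -> all (ltn^~ n) w ->
  Phi w * seq_weight n.+1 w +
    \sum_(l < (size w).+1) Phi (ins n l w) * seq_weight n.+1 (ins n l w)
  <= Phi w * seq_weight n w.
Proof.
move=> nN P1; case: w => [|a w] uw aw /=.
  rewrite big_ord_recl big_ord0 addr0 /= [in leRHS]big_ltn//.
  by rewrite mulrDr addrC lerD2r -expr2 ler_wpM2r ?sqr_ge0.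
have [an0 aw'] := andP aw; have an : (a < n)%N by exact: an0.
have H := tail_weight_sum nN an aw'.
rewrite big_ord_recl /= /ins /=.
set T := tail_weight n.+1 a w in H *; set S := \sum_(_ < _) _ in H.
have T0 : 0 <= T by exact: tail_weight_ge0.
have S0 : 0 <= S.
  by apply: sumr_ge0 => i _; rewrite mulr_ge0 ?tail_factor_ge0 ?tail_weight_ge0.
rewrite (@le_trans _ _ (Phi (a :: w) * (s n a * (T + S))))//; last first.
  by rewrite !ler_wpM2l.
have SL := @sendl n a; rewrite an nN in SL; have {}SL := SL erefl.
rewrite (@le_trans _ _ (Phi (a :: w) * ((s n.+1 a + fend n a * (s n.+1 n * g n.+1 n a)) * (T + S))))//;
  last by rewrite ler_wpM2l// ler_wpM2r// addr_ge0.
have HS : \sum_(i < (size w).+1)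
   Phi (a :: take i w ++ n :: drop i w) *
   (s n.+1 a * tail_weight n.+1 a (take i w ++ n :: drop i w)) <=
   Phi (a :: w) * (s n.+1 a * S).
  rewrite !mulr_sumr; apply: ler_sum => i _.
  have := @Phi_tail n a [::] w i nN; rewrite -ltnS ltn_ord => /(_ isT uw aw) /= Hi.
  rewrite mulrCA [leRHS]mulrCA ler_wpM2l// mulrA [_ * tail_factor _ _ _ _]mulrC.
  by rewrite ler_wpM2r ?tail_weight_ge0.
have HB := Phi_beg nN uw aw.
set A := Phi (a :: w) in HS HB *.
have HB' : Phi (n :: a :: w) * (s n.+1 n * (g n.+1 n a * T)) <=
   A * (fend n a * (s n.+1 n * g n.+1 n a) * T).
  rewrite !mulrA -!mulrA [leRHS]mulrA [A * _]mulrC ler_wpM2r//.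
  by rewrite !mulr_ge0.
apply: le_trans (lerD (lexx _) (lerD HB' HS)) _.
have : 0 <= A * (fend n a * (s n.+1 n * g n.+1 n a) * S) by rewrite !mulr_ge0 ?Phi0.
nra.
Qed.

(** [Phi w] is the weight of a path. Inserting the new largest index [n] multiplies it
by at most [fin n a b] between [a] and [b], and by at most [fend n a] next to an
endpoint [a]. If the potentials [g] (for each step) and [s] (for each endpoint)
decrease in [n] fast enough to absorb these factors, the sum of the weights times
the potentials does not increase with [n], and it is easily computed at [0]. *)
Lemma insertion_sum : (forall n, (n < N)%N -> Phi [:: n] <= Phi [::]) ->
  \sum_(w <- simple_seqs N) Phi w * seq_weight N w <=
  Phi [::] * \sum_(m < N) s m.+1 m ^+ 2.
Proof.
move=> P1; suff : forall n, (n <= N)%N ->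
    \sum_(w <- simple_seqs n) Phi w * seq_weight n w <= Phi [::] * \sum_(m < N) s m.+1 m ^+ 2.
  exact.
elim=> [|n IH] nN; first by rewrite big_seq1 /= big_mkord.
rewrite sum_simple_seqsS; apply: le_trans (IH (ltnW nN)).
rewrite big_seq [leRHS]big_seq; apply: ler_sum => w /simple_seqsP[uw aw].
by apply: insertion_step => //; exact: P1.
Qed.

End insertion_sums.

Arguments simple_seqs : simpl never.

(** * The spatial kernel *)

Lemma le_of_eq (R : realType) (x y : R) : x = y -> x <= y.
Proof. by move->. Qed.

Lemma powR_ge1 (R : realType) (x p : R) : 1 <= x -> 0 <= p -> 1 <= x `^ p.
Proof. by move=> x1 p0; rewrite -[leLHS](powRr0 x) ler_powR. Qed.

Lemma powR_le1 (R : realType) (x p : R) : 0 <= x -> x <= 1 -> 0 <= p -> x `^ p <= 1.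
Proof.
move=> x0 x1 p0; have := @ge0_ler_powR R p p0 x 1.
by rewrite powR1; apply; rewrite ?nnegrE.
Qed.

Section truncated_power.
Context {R : realType}.
Variables (delta tau : R).
Hypotheses (delta1 : 1 < delta) (tau0 : 0 < tau).

Definition tpow (v : R) : R := if v <= tau then 1 else (tau / v) `^ delta.

Let delta0 : 0 < delta. Proof. exact: lt_trans delta1. Qed.

Lemma tpow_ge0 v : 0 <= tpow v.
Proof. by rewrite /tpow; case: ifP => // _; exact: powR_ge0. Qed.

Lemma tpow_le1 v : tpow v <= 1.
Proof.
rewrite /tpow; case: (leP v tau) => // tv; have v0 : 0 < v by exact: (lt_trans tau0 tv).
apply: powR_le1; rewrite ?(ltW delta0) ?divr_ge0 ?(ltW v0) ?(ltW tau0)//.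
by rewrite ler_pdivrMr// mul1r ltW.
Qed.

Lemma tpow_far v : tau < v -> tpow v = (tau / v) `^ delta.
Proof. by move=> tv; rewrite /tpow leNgt tv. Qed.

Lemma tpow_le v u : 0 < u -> u <= v -> tpow v <= (tau / u) `^ delta.
Proof.
move=> u0 uv; have v0 : 0 < v by exact: lt_le_trans uv.
have uv' : (tau / v) `^ delta <= (tau / u) `^ delta.
  rewrite ge0_ler_powR ?nnegrE ?(ltW delta0) ?divr_ge0 ?(ltW v0) ?(ltW u0) ?(ltW tau0)//.
  by rewrite ler_pM2l// lef_pV2 ?posrE.
rewrite /tpow; case: (leP v tau) => // vt; apply: le_trans uv'.
by apply: powR_ge1 (ltW delta0); rewrite ler_pdivlMr// mul1r.
Qed.

(** A decomposition into dyadic layers, which reduces sums of the kernel to volumes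
of balls. *)
Lemma tpow_dyadic K v : v <= 2 ^+ K * tau ->
  tpow v <= (v <= tau)%R%:R +
    \sum_(l < K) (2 `^ (- delta)) ^+ l * (v <= 2 ^+ l.+1 * tau)%R%:R.
Proof.
elim: K => [|K IH] vK.
  rewrite expr0 mul1r in vK.
  by rewrite big_ord0 addr0 vK; exact: tpow_le1.
rewrite big_ord_recr /= vK mulr1 addrA.
have [/IH H|Kv] := leP v (2 ^+ K * tau).
  by rewrite (le_trans H)// lerDl exprn_ge0// powR_ge0.
have p2 : 0 < 2 ^+ K :> R by rewrite exprn_gt0.
rewrite (le_trans (tpow_le (mulr_gt0 p2 tau0) (ltW Kv)))//.
have -> : tau / (2 ^+ K * tau) = (2 ^+ K)^-1.
  by rewrite invfM mulrC divfK ?gt_eqF.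
have -> : (2 ^+ K)^-1 `^ delta = (2 `^ (- delta)) ^+ K :> R.
  rewrite -[X in X `^ _]powR_inv1 ?(ltW p2)// -powRrM mulN1r -powR_mulrn// -powRrM.
  by rewrite mulrC powRrM powR_mulrn ?powR_ge0.
by rewrite lerDr addr_ge0// sumr_ge0// => l _.
Qed.

Lemma sum_expr_le (q : R) K : 0 <= q < 1 -> \sum_(l < K) q ^+ l <= (1 - q)^-1.
Proof.
move=> /andP[q0 q1]; have q1' : 0 < 1 - q by rewrite subr_gt0.
rewrite -(ler_pM2l q1') mulfV ?gt_eqF//.
suff -> : (1 - q) * \sum_(l < K) q ^+ l = 1 - q ^+ K.
  by rewrite gerBl exprn_ge0.
elim: K => [|K IH]; first by rewrite big_ord0 expr0 mulr0 subrr.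
by rewrite big_ord_recr /= mulrDr IH exprS; ring.
Qed.

End truncated_power.

Section spatial_kernel.
Context {R : realType} {C : finType}.
Variables (delta tau gamma B v0 : R) (D : C -> C -> R).
Hypotheses (delta1 : 1 < delta) (tau0 : 0 < tau) (gamma01 : 0 < gamma < 1).
Hypotheses (B1 : 1 <= B) (v00 : 0 <= v0) (D0 : forall x y, 0 <= D x y).
Hypothesis Dsym : forall x y, D x y = D y x.
Hypothesis Dquasi : forall x y z, D x y <= B * Num.max (D x z) (D z y).
Hypothesis Dball : forall x v, v0 <= v ->
  \sum_(z : C) (D x z <= v)%R%:R <= B * v * #|C|%:R.

Local Notation phi := (tpow delta tau).
Local Notation q := (2 * 2 `^ (- delta)).
Definition ball_const : R := B * (1 + 2 * (1 - q)^-1).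

Let B0 : 0 < B. Proof. exact: lt_le_trans B1. Qed.
Let delta0 : 0 < delta. Proof. exact: lt_trans delta1. Qed.

Let q01 : 0 <= q < 1.
Proof.
rewrite mulr_ge0 ?powR_ge0//= powRN -lter_pdivlMr ?invr_gt0 ?powR_gt0// invrK mul1r.
by rewrite -[ltLHS]powRr1// /powR pnatr_eq0/= ltr_expR ltr_pM2r ?ln_gt0 ?ltr1n.
Qed.

Lemma ball_const_ge1 : 1 <= ball_const.
Proof.
have [q0 q1] := andP q01.
rewrite /ball_const (le_trans B1)// ler_peMr ?(ltW B0)// lerDl.
by rewrite mulr_ge0// invr_ge0 subr_ge0 ltW.
Qed.

(** The layers form a geometric series since [delta > 1]. *)
Lemma kernel_sum a x : 0 < a -> v0 * a <= tau ->
  \sum_z phi (a * D x z) <= ball_const * (tau / a) * #|C|%:R.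
Proof.
move=> a0 va; have ta0 : 0 < tau / a by rewrite divr_gt0.
have [K HK] : exists K, forall z, a * D x z <= 2 ^+ K * tau.
  pose S := \sum_z (a * D x z / tau).
  exists (Num.truncn S).+1 => z; rewrite -ler_pdivrMr//.
  apply: (@le_trans _ _ S).
    rewrite /S (bigD1 z)//= lerDl sumr_ge0// => i _.
    by rewrite divr_ge0 ?(ltW tau0)// mulr_ge0// ltW.
  rewrite ltW// (lt_le_trans (truncnS_gt _))// -natrX ler_nat.
  by rewrite ltnW// ltn_expl.
apply: (le_trans (ler_sum _ (fun z _ => tpow_dyadic delta1 tau0 (HK z)))).
have ball l : \sum_z (a * D x z <= 2 ^+ l * tau)%R%:R <= B * (2 ^+ l * (tau / a)) * #|C|%:R.
  under eq_bigr do rewrite -ler_pdivlMl// mulrCA [a^-1 * _]mulrC.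
  apply: Dball; apply: (@le_trans _ _ (tau / a)).
    by rewrite ler_pdivlMr.
  by rewrite ler_peMl ?(ltW ta0)// exprn_ege1// ler1n.
rewrite big_split/= exchange_big/=.
under [X in _ + X]eq_bigr do rewrite -mulr_sumr.
have b0 := ball 0; rewrite expr0 !mul1r in b0.
have HT : \sum_(l < K) (2 `^ (- delta)) ^+ l * \sum_z (a * D x z <= 2 ^+ l.+1 * tau)%R%:R <=
    \sum_(l < K) (2 `^ (- delta)) ^+ l * (B * (2 ^+ l.+1 * (tau / a)) * #|C|%:R).
  by apply: ler_sum => l _; rewrite ler_wpM2l ?ball// exprn_ge0// powR_ge0.
apply: (le_trans (lerD b0 HT)).
have -> : \sum_(l < K) (2 `^ (- delta)) ^+ l * (B * (2 ^+ l.+1 * (tau / a)) * #|C|%:R) =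
    2 * B * (tau / a) * #|C|%:R * \sum_(l < K) q ^+ l.
  by rewrite mulr_sumr; apply: eq_bigr => l _; rewrite exprMn exprS; ring.
have := sum_expr_le K q01; set S := \sum_(_ < _) _ => HS.
have -> : ball_const * (tau / a) * #|C|%:R = B * (tau / a) * #|C|%:R +
   2 * B * (tau / a) * #|C|%:R * (1 - q)^-1 by rewrite /ball_const; ring.
by rewrite lerD2l ler_wpM2l// !mulr_ge0 ?invr_ge0 ?(ltW a0) ?(ltW tau0) ?(ltW B0).
Qed.

(** [kscale i j] times the volume of the ball between them governs the connection
of the vertices [i] and [j]; the successors are the typical ages. *)
Definition kscale (i j : nat) : R :=
  (maxn i j).+1%:R `^ (1 - gamma) * (minn i j).+1%:R `^ gamma.

Lemma kscaleC i j : kscale i j = kscale j i.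
Proof. by rewrite /kscale maxnC minnC. Qed.

Lemma kscale_gt0 i j : 0 < kscale i j.
Proof. by rewrite mulr_gt0 ?powR_gt0. Qed.

Lemma kscale_lt i j : (i < j)%N ->
  kscale i j = j.+1%:R `^ (1 - gamma) * i.+1%:R `^ gamma.
Proof.
by move=> ij; rewrite /kscale (maxn_idPr (ltnW ij)) (minn_idPl (ltnW ij)).
Qed.

Lemma kscale_le i j N : (i < N)%N -> (j < N)%N -> kscale i j <= N%:R.
Proof.
have [g0 g1] := andP gamma01.
move=> iN jN; apply: (@le_trans _ _ (N%:R `^ (1 - gamma) * N%:R `^ gamma)).
  rewrite ler_pM ?powR_ge0// ge0_ler_powR ?nnegrE ?subr_ge0 ?(ltW g0) ?(ltW g1)//.
    by rewrite ler_nat gtn_max iN.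
  by rewrite ler_nat gtn_min iN.
rewrite -powRD ?subrK ?powRr1//.
by apply/implyP => _; rewrite pnatr_eq0 -lt0n (leq_ltn_trans _ iN).
Qed.

Definition interior_factor eps (n a b : nat) : R :=
  let s := (1 - gamma) * (1 + delta) in
  eps * n.+1%:R `^ (- s) * (maxn a b).+1%:R `^ (s - 1).

Definition endpoint_factor eps (n a : nat) : R :=
  eps * a.+1%:R `^ (- gamma) * n.+1%:R `^ (gamma - 1).

(** It bounds the constants of both summations below, and vanishes with [tau]. *)
Definition loss : R := 2 * ball_const * B `^ delta * tau.

Lemma loss_ge : ball_const * tau <= loss.
Proof.
have b1 := ball_const_ge1; have B1' := powR_ge1 B1 (ltW delta0).
rewrite /loss ler_pM2r// mulrAC ler_peMl ?(le_trans _ b1)//; nra.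
Qed.

Lemma endpoint_sum n a N x : (a < n < N)%N -> v0 * N%:R <= tau ->
  \sum_z phi (kscale a n * D x z) <= endpoint_factor loss n a * #|C|%:R.
Proof.
move=> /andP[an nN] vN; have an0 : 0 < kscale a n by exact: kscale_gt0.
have kN : kscale a n <= N%:R by rewrite kscale_le// (ltn_trans an).
apply: le_trans (kernel_sum _ an0 (le_trans (ler_wpM2l v00 kN) vN)) _.
rewrite ler_wpM2r// mulrA (le_trans (ler_wpM2r _ loss_ge)) ?invr_ge0 ?(ltW an0)//.
rewrite /endpoint_factor kscale_lt// invfM -!powRN opprB.
by rewrite mulrA -mulrA [X in _ * X <= _]mulrC mulrA.
Qed.

(** The trade-off behind the phase transition: a youngest vertex [n] in the middle of
a path contributes [n^-s] with [s = (1 - gamma) * (1 + delta)], and [s > 1] means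
that [gamma < delta / (delta + 1)]. *)
Lemma interior_exponents s n a b : s = (1 - gamma) * (1 + delta) ->
  (a < n)%N -> (b < n)%N ->
  (kscale b n)^-1 * (kscale a n) `^ (- delta) <=
  n.+1%:R `^ (- s) * (maxn a b).+1%:R `^ (s - 1) * (kscale a b) `^ (- delta).
Proof.
move=> -> an bn; have [g0 g1] := andP gamma01.
have E (x p : R) : 0 < x -> x `^ p = expR (p * ln x) by move=> x0; rewrite /powR gt_eqF.
have P k : 0 < k.+1%:R :> R by [].
have K i j : kscale i j =
    expR ((1 - gamma) * ln (maxn i j).+1%:R + gamma * ln (minn i j).+1%:R).
  by rewrite /kscale !E// expRD.
have L k l : (k <= l)%N -> ln k.+1%:R <= ln l.+1%:R :> R.
  by move=> kl; rewrite ler_ln ?posrE// ler_nat.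
have K' i j p := E (kscale i j) p (kscale_gt0 i j).
rewrite (K' a n (- delta)) (K' a b (- delta)) !K !expRK -[(expR _)^-1]expRN.
rewrite !E// -!expRD.
rewrite ler_expR.
rewrite (maxn_idPr (ltnW an)) (maxn_idPr (ltnW bn)) (minn_idPl (ltnW an)) (minn_idPl (ltnW bn)).
have [ab|ba] := leqP a b.
  by apply: le_of_eq; ring.
have H : 0 <= (gamma * (delta - 1)) * (ln a.+1%:R - ln b.+1%:R).
  by rewrite !mulr_ge0 ?subr_ge0 ?(ltW g0) ?(ltW delta1)// L// ltnW.
by rewrite -subr_ge0; apply: le_trans H _; apply: le_of_eq; ring.
Qed.

Lemma interior_half n a b x y : (a < n)%N -> (b < n)%N -> 0 < D x y ->
  ball_const * (tau / kscale b n) * (tau / (kscale a n * (D x y / B))) `^ delta <=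
  interior_factor (loss / 2) n a b * (tau / (kscale a b * D x y)) `^ delta.
Proof.
move=> an bn Dxy.
have K0 i j := kscale_gt0 i j.
have bc := lt_le_trans ltr01 ball_const_ge1.
have H i j : (tau / (kscale i j * D x y)) `^ delta =
    (tau / D x y) `^ delta * kscale i j `^ (- delta).
  have -> : tau / (kscale i j * D x y) = (tau / D x y) * (kscale i j)^-1.
    by field; rewrite !gt_eqF.
  rewrite powRM ?divr_ge0 ?invr_ge0 ?(ltW (K0 _ _)) ?(ltW tau0) ?(ltW Dxy)//.
  by congr (_ * _); rewrite -[(kscale i j)^-1]powR_inv1 ?(ltW (K0 _ _))// -powRrM mulN1r.
have -> : tau / (kscale a n * (D x y / B)) = B * (tau / (kscale a n * D x y)).
  by field; rewrite !gt_eqF.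
rewrite powRM ?(ltW B0) ?divr_ge0 ?mulr_ge0 ?(ltW tau0) ?(ltW (K0 _ _)) ?(ltW Dxy)//.
rewrite !H /interior_factor; cbv zeta.
have := interior_exponents erefl an bn.
set n1 := n.+1%:R `^ _; set m1 := (maxn a b).+1%:R `^ _.
set U := (kscale b n)^-1 * _; set V := n1 * m1 * _ => UV.
have -> : ball_const * (tau / kscale b n) *
    (B `^ delta * ((tau / D x y) `^ delta * kscale a n `^ (- delta))) =
    (loss / 2) * (tau / D x y) `^ delta * U.
  rewrite /U /loss; field; rewrite gt_eqF//.
have -> : loss / 2 * n1 * m1 * ((tau / D x y) `^ delta * kscale a b `^ (- delta)) =
    loss / 2 * (tau / D x y) `^ delta * V by rewrite /V; ring.
have l0 : 0 <= loss / 2.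
  by rewrite divr_ge0// (le_trans _ loss_ge)// mulr_ge0 ?(ltW tau0) ?(ltW bc).
by rewrite ler_wpM2l// mulr_ge0// powR_ge0.
Qed.

Lemma interior_factorC eps n a b : interior_factor eps n a b = interior_factor eps n b a.
Proof. by rewrite /interior_factor maxnC. Qed.

(** By the quasi-triangle inequality, one of the two steps through [n] covers a fixed
part of the distance from [a] to [b] and pays for it, while the other step is
summed over all positions of [n]. *)
Lemma interior_sum n a b N x y : (a < n < N)%N -> (b < n < N)%N ->
  v0 * N%:R <= tau -> tau < kscale a b * D x y ->
  \sum_z phi (kscale a n * D x z) * phi (kscale n b * D z y) <=
  interior_factor loss n a b * phi (kscale a b * D x y) * #|C|%:R.
Proof.
move=> /andP[an nN] /andP[bn _] vN far.
have Dxy : 0 < D x y.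
  by rewrite -(pmulr_rgt0 _ (kscale_gt0 a b)) (lt_trans tau0).
have K0 i j := kscale_gt0 i j.
have DB : 0 < D x y / B by rewrite divr_gt0.
pose A := (tau / (kscale a n * (D x y / B))) `^ delta.
pose A' := (tau / (kscale b n * (D x y / B))) `^ delta.
have split z : phi (kscale a n * D x z) * phi (kscale n b * D z y) <=
    A * phi (kscale b n * D y z) + A' * phi (kscale a n * D x z).
  rewrite (kscaleC n b) (Dsym z y).
  have : D x y / B <= Num.max (D x z) (D y z).
    by rewrite ler_pdivrMr// mulrC (Dsym y z).
  rewrite le_max => /orP[h|h].
    apply: ler_wpDr; first by rewrite mulr_ge0 ?powR_ge0 ?tpow_ge0.
    rewrite ler_wpM2r ?tpow_ge0//.
  apply: (tpow_le delta1 tau0 (mulr_gt0 (K0 _ _) DB)).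
    by rewrite ler_wpM2l ?(ltW (K0 _ _))//.
  apply: ler_wpDl; first by rewrite mulr_ge0 ?powR_ge0 ?tpow_ge0.
  rewrite mulrC ler_wpM2r ?tpow_ge0//.
  apply: (tpow_le delta1 tau0 (mulr_gt0 (K0 _ _) DB)).
  by rewrite ler_wpM2l ?(ltW (K0 _ _))//.
apply: (le_trans (ler_sum _ (fun z _ => split z))).
rewrite big_split /= -!mulr_sumr tpow_far//.
have kN i : (i < n)%N -> v0 * kscale i n <= tau.
  by move=> ni; apply: le_trans vN; rewrite ler_wpM2l// kscale_le// (ltn_trans ni).
have S1 := kernel_sum y (K0 b n) (kN _ bn).
have S2 := kernel_sum x (K0 a n) (kN _ an).
have H1 := interior_half an bn Dxy.
have H2 := interior_half bn an Dxy.
rewrite (interior_factorC _ n b a) (kscaleC b a) in H2.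
have -> : interior_factor loss n a b = interior_factor (loss / 2) n a b + interior_factor (loss / 2) n a b.
  by rewrite -mulrDl -mulrDl -splitr.
rewrite mulrDl mulrDl; apply: lerD.
  apply: le_trans (ler_wpM2l (powR_ge0 _ _) S1) _.
  rewrite -/A in H1 *; rewrite [leLHS]mulrA [A * _]mulrC.
  exact: (ler_wpM2r (ler0n _ _) H1).
apply: le_trans (ler_wpM2l (powR_ge0 _ _) S2) _.
rewrite -/A' in H2 *; rewrite [leLHS]mulrA [A' * _]mulrC.
exact: (ler_wpM2r (ler0n _ _) H2).
Qed.
End spatial_kernel.

(** * Weights of paths, averaged over the positions *)

Section configurations.
Context {R : realType} {C : finType} (M : nat).
Local Notation N := M.+1.
Variable near : nat -> nat -> C -> C -> bool.
Variable phi : nat -> nat -> C -> C -> R.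
Hypothesis phi0 : forall i j x y, 0 <= phi i j x y.

Implicit Types c : {ffun 'I_N -> C}.

Definition at_ c (i : nat) : C := c (inord i).

Definition update c (n : nat) (z : C) : {ffun 'I_N -> C} :=
  [ffun i => if i == inord n then z else c i].

Lemma at_update_eq c n z : at_ (update c n z) n = z.
Proof. by rewrite /at_ ffunE eqxx. Qed.

Lemma at_update_neq c n z i : (i < N)%N -> (n < N)%N -> i != n ->
  at_ (update c n z) i = at_ c i.
Proof.
move=> iN nN; rewrite /at_ ffunE; case: ifP => // /eqP /(congr1 val) /=.
by rewrite !inordK// => ->; rewrite eqxx.
Qed.

(** Resampling one coordinate allows to sum over it first, with the other ones fixed. *)
Lemma sum_resample (F : {ffun 'I_N -> C} -> R) n : 
  #|C|%:R * \sum_c F c = \sum_c \sum_z F (update c n z).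
Proof.
rewrite pair_bigA /=.
pose h (u : {ffun 'I_N -> C} * C) := (update u.1 n u.2, at_ u.1 n).
have hK : involutive h.
  move=> [c z]; rewrite /h /=; congr pair; last by rewrite at_update_eq.
  by apply/ffunP => i; rewrite !ffunE /at_; case: eqP => // ->.
rewrite [RHS](reindex_inj (inv_inj hK)) /=.
rewrite (eq_bigr (fun u => F u.1)); last first.
  move=> [c z] _ /=; congr F; apply/ffunP => i; rewrite !ffunE /at_.
  by case: eqP => // ->.
rewrite -(pair_bigA _ (fun c _ => F c)) /= mulr_sumr.
by apply: eq_bigr => c _; rewrite sumr_const mulr_natl.
Qed.

Definition far_at c a b := ~~ near a b (at_ c a) (at_ c b).

(** This property of geodesics is what provides the hypothesis that [a] and [b] are
far from each other when a vertex between them is removed. *)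
Fixpoint no_shortcut c (w : seq nat) : bool :=
  if w is a :: v then all (far_at c a) (behead v) && no_shortcut c v else true.

Fixpoint path_kernel c (w : seq nat) : R :=
  if w is a :: v then
    (if v is b :: _ then phi a b (at_ c a) (at_ c b) else 1) * path_kernel c v
  else 1.

Definition path_sum (w : seq nat) : R :=
  \sum_c (no_shortcut c w)%:R * path_kernel c w.

Lemma path_kernel_ge0 c w : 0 <= path_kernel c w.
Proof. by elim: w => //= a [|b v] IH; rewrite mulr_ge0. Qed.

Lemma path_kernel_cat c u a v :
  path_kernel c (u ++ a :: v) = path_kernel c (rcons u a) * path_kernel c (a :: v).
Proof.
elim: u => [|e u IH]; first by rewrite /= mulr1 mul1r.
by rewrite cat_cons rcons_cons; case: u IH => [|f u] IH; rewrite [LHS]/= [path_kernel _ (e :: _)]/= -mulrA -IH.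
Qed.

Lemma eq_no_shortcut c c' w : {in w, forall i, at_ c i = at_ c' i} ->
  no_shortcut c w = no_shortcut c' w.
Proof.
elim: w => //= a v IH H; rewrite IH; last by move=> i iv; rewrite H// inE iv orbT.
congr andb; apply: eq_in_all => b bv; rewrite /far_at !H ?mem_head// inE (mem_behead bv) ?orbT//.
Qed.

Lemma eq_path_kernel c c' w : {in w, forall i, at_ c i = at_ c' i} ->
  path_kernel c w = path_kernel c' w.
Proof.
elim: w => //= a v IH H; rewrite IH; last by move=> i iv; rewrite H// inE iv orbT.
by case: v H {IH} => [//|b v] H; rewrite !H ?inE ?eqxx ?orbT.
Qed.

Lemma no_shortcut_interior c u a n b v :
  no_shortcut c (u ++ a :: n :: b :: v) ->
  far_at c a b && no_shortcut c (u ++ a :: b :: v).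
Proof.
elim: u => [|e u IH].
  by rewrite /= => /and4P[/andP[-> ->] _ -> ->].
rewrite !cat_cons [no_shortcut _ (e :: _)]/= => /andP[H /IH/andP[-> H']].
rewrite [no_shortcut _ _]/= H' andbT; case: u H {IH H'} => [|f u] /=; first by case/and3P => _ -> ->.
by rewrite !all_cat /= => /and5P[-> -> _ -> ->].
Qed.

Lemma no_shortcut_rcons c u a n :
  no_shortcut c (rcons (rcons u a) n) -> no_shortcut c (rcons u a).
Proof.
elim: u => [|e u IH] //.
rewrite !rcons_cons [no_shortcut _ (e :: _)]/= => /andP[H /IH].
rewrite [no_shortcut _ (e :: _)]/= => ->; rewrite andbT.
case: u H {IH} => [|f u] //=.
by rewrite !all_rcons => /and3P[_ -> ->].
Qed.

Section bounds.
Variables (fin : nat -> nat -> nat -> R) (fend : nat -> nat -> R).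
Hypothesis C0 : (0 < #|C|)%N.
Hypothesis fin0 : forall n a b, 0 <= fin n a b.
Hypothesis fend0 : forall n a, 0 <= fend n a.
Hypothesis phiC : forall i j x y, phi i j x y = phi j i y x.
Hypothesis fendP : forall n a x, (a < n < N)%N ->
  \sum_z phi a n x z <= fend n a * #|C|%:R.
Hypothesis finP : forall n a b x y, (a < n < N)%N -> (b < n < N)%N ->
  ~~ near a b x y ->
  \sum_z phi a n x z * phi n b z y <= fin n a b * phi a b x y * #|C|%:R.

Let C0' : 0 < #|C|%:R :> R. Proof. by rewrite ltr0n. Qed.

Lemma path_sum_ge0 w : 0 <= path_sum w.
Proof. by apply: sumr_ge0 => c _; rewrite mulr_ge0 ?path_kernel_ge0. Qed.

Lemma at_fresh c n z w : (n < N)%N -> all (ltn^~ n) w ->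
  {in w, forall i, at_ (update c n z) i = at_ c i}.
Proof.
move=> nN aw i iw; have := allP aw _ iw => /= ni.
by rewrite at_update_neq ?neq_ltn ?ni// (ltn_trans ni).
Qed.

Lemma path_sum_begin n u a : (n < N)%N -> all (ltn^~ n) (a :: u) ->
  path_sum (n :: a :: u) <= fend n a * path_sum (a :: u).
Proof.
move=> nN au; rewrite -(ler_pM2l C0') (sum_resample _ n) mulrA !mulr_sumr.
apply: ler_sum => c _.
have fr z := at_fresh c z nN au.
have an : (a < n)%N by case/andP: au.
set A := path_kernel c (a :: u); set L := no_shortcut c (a :: u).
apply: (@le_trans _ _ (\sum_z phi a n (at_ c a) z * (L%:R * A))).
  apply: ler_sum => z _.
  rewrite [no_shortcut _ _]/= -/(no_shortcut _ (a :: u)) (eq_no_shortcut (fr z)) -/L.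
  rewrite [path_kernel _ _]/= -/(path_kernel _ (a :: u)) (eq_path_kernel (fr z)) -/A.
  rewrite at_update_eq fr ?mem_head// phiC mulrCA ler_wpM2l// ler_wpM2r ?path_kernel_ge0//.
  by rewrite ler_nat; case: L; rewrite ?andbT ?andbF ?leq_b1.
rewrite -mulr_suml; apply: ler_wpM2r; first by rewrite mulr_ge0 ?path_kernel_ge0.
by rewrite [leRHS]mulrC; apply: fendP; rewrite an.
Qed.

Lemma path_sum_end n u a : (n < N)%N -> all (ltn^~ n) (rcons u a) ->
  path_sum (rcons (rcons u a) n) <= fend n a * path_sum (rcons u a).
Proof.
move=> nN au; rewrite -(ler_pM2l C0') (sum_resample _ n) mulrA !mulr_sumr.
apply: ler_sum => c _.
have fr z := at_fresh c z nN au.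
have an : (a < n)%N by move: au; rewrite all_rcons => /andP[].
set A := path_kernel c (rcons u a); set L := no_shortcut c (rcons u a).
apply: (@le_trans _ _ (\sum_z phi a n (at_ c a) z * (L%:R * A))).
  apply: ler_sum => z _.
  rewrite -[X in path_kernel _ X]cats1 cat_rcons path_kernel_cat.
  rewrite (eq_path_kernel (fr z)) -/A /= !mulr1 at_update_eq fr ?mem_rcons ?mem_head//.
  rewrite mulrA mulrC ler_wpM2l// ler_wpM2r ?path_kernel_ge0//.
  rewrite ler_nat /L -(eq_no_shortcut (fr z)).
  by have := @no_shortcut_rcons (update c n z) u a n; case: no_shortcut => // ->.
rewrite -mulr_suml; apply: ler_wpM2r; first by rewrite mulr_ge0 ?path_kernel_ge0.
by rewrite [leRHS]mulrC; apply: fendP; rewrite an.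
Qed.

(** Once [n] is removed, [a] and [b] become consecutive; before, they were not, and
this is why they are far from each other. *)
Lemma path_sum_interior n u v a b : (n < N)%N ->
  all (ltn^~ n) (u ++ a :: b :: v) ->
  path_sum (u ++ a :: n :: b :: v) <= fin n a b * path_sum (u ++ a :: b :: v).
Proof.
move=> nN auv; rewrite -(ler_pM2l C0') (sum_resample _ n) mulrA !mulr_sumr.
apply: ler_sum => c _.
have fr z := at_fresh c z nN auv.
move: (auv); rewrite all_cat /= => /and4P[au an bn av].
have mu : {subset rcons u a <= u ++ a :: b :: v}.
  by move=> i; rewrite mem_rcons mem_cat !inE => /orP[->|->]; rewrite ?orbT.
have mv : {subset b :: v <= u ++ a :: b :: v}.
  by move=> i; rewrite mem_cat !inE => /orP[->|->]; rewrite ?orbT.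
set L := no_shortcut c (u ++ a :: b :: v).
pose F := far_at c a b.
pose A := path_kernel c (rcons u a) * path_kernel c (b :: v).
have A0 : 0 <= A by exact: mulr_ge0 (path_kernel_ge0 _ _) (path_kernel_ge0 _ _).
apply: (@le_trans _ _ (\sum_z (phi a n (at_ c a) z * phi n b z (at_ c b)) * ((F && L)%:R * A))).
  apply: ler_sum => z _.
  rewrite path_kernel_cat [path_kernel _ (a :: _)]/= -/(path_kernel _ (b :: v)).
  rewrite (eq_path_kernel (fun i H => fr z i (mu i H))).
  rewrite (eq_path_kernel (fun i H => fr z i (mv i H))).
  rewrite at_update_eq !fr ?mem_cat ?inE ?eqxx ?orbT//.
  set p1 := phi _ _ _ _; set p2 := phi _ _ _ _.
  have -> : p1 * p2 * ((F && L)%:R * A) = (F && L)%:R * (path_kernel c (rcons u a) * (p1 * (p2 * path_kernel c (b :: v)))).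
    by rewrite /A; ring.
  have p10 : 0 <= p1 by exact: phi0.
  have p20 : 0 <= p2 by exact: phi0.
  apply: ler_wpM2r.
    exact: mulr_ge0 (path_kernel_ge0 _ _) (mulr_ge0 p10 (mulr_ge0 p20 (path_kernel_ge0 _ _))).
   rewrite ler_nat /F /L -(eq_no_shortcut (fr z)).
  have := @no_shortcut_interior (update c n z) u a n b v.
  by rewrite /far_at !fr ?mem_cat ?inE ?eqxx ?orbT//; case: no_shortcut => // ->.
rewrite -mulr_suml.
have [FL|FL] := boolP (F && L); last first.
  by rewrite mul0r mulr0 mulr_ge0 ?mulr_ge0 ?path_kernel_ge0.
have [F1 L1] := andP FL; rewrite L1 !mul1r path_kernel_cat.
rewrite [path_kernel _ (a :: _)]/= -/(path_kernel _ (b :: v)).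
apply: (@le_trans _ _ (fin n a b * phi a b (at_ c a) (at_ c b) * #|C|%:R * A)).
  by apply: (ler_wpM2r A0); rewrite finP ?an ?bn.
by apply: le_of_eq; rewrite /A /=; ring.
Qed.

End bounds.
End configurations.

Section path_sums.
Context {R : realType} {C : finType} (M : nat).
Variables (delta tau gamma B v0 : R) (D : C -> C -> R).
Local Notation N := M.+1.
Hypotheses (delta1 : 1 < delta) (tau0 : 0 < tau) (gamma01 : 0 < gamma < 1).
Hypotheses (B1 : 1 <= B) (v00 : 0 <= v0) (D0 : forall x y, 0 <= D x y).
Hypothesis C0 : (0 < #|C|)%N.
Hypothesis Dsym : forall x y, D x y = D y x.
Hypothesis Dquasi : forall x y z, D x y <= B * Num.max (D x z) (D z y).
Hypothesis Dball : forall x v, v0 <= v ->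
  \sum_(z : C) (D x z <= v)%R%:R <= B * v * #|C|%:R.
Hypothesis vN : v0 * N%:R <= tau.

Local Notation sg := ((1 - gamma) * (1 + delta)).
Local Notation ka := ((1 - gamma) / 2).
Local Notation eps := (loss delta tau B).
Hypothesis sg1 : 1 < sg.
Hypotheses (eps_ka : 4 * eps <= ka) (eps_sg : 4 * eps <= sg - 1).

Definition near_pair (i j : nat) (x y : C) : bool := kscale gamma i j * D x y <= tau.
Definition pair_kernel (i j : nat) (x y : C) : R := tpow delta tau (kscale gamma i j * D x y).

Local Notation Phi := (path_sum M near_pair pair_kernel).

Let g (n a b : nat) : R :=
  1 + (maxn a b).+1%:R `^ (sg - 1) * n%:R `^ (- (sg - 1)).
Let s (n a : nat) : R :=
  N%:R `^ ((1 + gamma) / 2) * a.+1%:R `^ (- gamma) * (a.+1%:R `^ (- ka) + n%:R `^ (- ka)).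

Let ka0 : 0 < ka. Proof. have [_ g1] := andP gamma01; lra. Qed.
Let sg0 : 0 < sg - 1. Proof. by rewrite subr_gt0. Qed.

Let eps0 : 0 <= eps.
Proof.
apply: le_trans (loss_ge delta1 tau0 B1).
by rewrite mulr_ge0 ?(ltW tau0)// (le_trans _ (ball_const_ge1 delta1 B1)).
Qed.

Let natr_succ (n : nat) : n.+1%:R = n%:R + 1 :> R. Proof. by rewrite natr1. Qed.

Let g_le2 n a b : (maxn a b < n)%N -> g n a b <= 2.
Proof.
move=> abn; rewrite /g -lerBrDl (_ : 2 - 1 = 1); last by lra.
have n0 : 0 < n%:R :> R by rewrite ltr0n (leq_ltn_trans _ abn).
rewrite powRN ler_pdivrMr ?powR_gt0// mul1r ge0_ler_powR ?nnegrE ?(ltW sg0)//.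
by rewrite ler_nat.
Qed.

Let g_ge0 n a b : 0 <= g n a b.
Proof. by rewrite addr_ge0// mulr_ge0 ?powR_ge0. Qed.

Let s_ge0 n a : 0 <= s n a.
Proof. by rewrite !mulr_ge0 ?addr_ge0 ?powR_ge0. Qed.

Let end0 n a : 0 <= endpoint_factor gamma eps n a.
Proof. exact: mulr_ge0 (mulr_ge0 eps0 (powR_ge0 _ _)) (powR_ge0 _ _). Qed.

Let in0 n a b : 0 <= interior_factor delta gamma eps n a b.
Proof. exact: mulr_ge0 (mulr_ge0 eps0 (powR_ge0 _ _)) (powR_ge0 _ _). Qed.

Let s_step n a : (a < n < N)%N ->
  s n.+1 a + endpoint_factor gamma eps n a * (g n.+1 a n * s n.+1 n) <= s n a.
Proof.
move=> /andP[an nN]; have n0 : 0 < n%:R :> R by rewrite ltr0n (leq_ltn_trans _ an).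
have G : g n.+1 a n <= 2 by apply: g_le2; rewrite gtn_max ltnS (ltnW an) ltnS leqnn.
have H := powR_decrement ka0 n0; rewrite -natr_succ in H.
set x := n.+1%:R in H *.
have x0 : 0 < x by [].
apply: (@le_trans _ _ (s n.+1 a + endpoint_factor gamma eps n a * (2 * s n.+1 n))).
  by rewrite lerD2l ler_wpM2l ?end0// ler_wpM2r.
rewrite -lerBrDl /s -mulrBr opprD addrACA subrr add0r /endpoint_factor -/x.
set y := N%:R `^ _; set z := a.+1%:R `^ _.
have yz : 0 <= y * z by rewrite mulr_ge0 ?powR_ge0.
have -> : eps * z * x `^ (gamma - 1) * (2 * (y * x `^ (- gamma) * (x `^ (- ka) + x `^ (- ka)))) =
   y * z * (4 * eps * (x `^ (gamma - 1) * x `^ (- gamma) * x `^ (- ka))) by ring.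
rewrite ler_wpM2l// (le_trans _ H)//.
rewrite -!powRD ?(gt_eqF x0) ?implybT//.
rewrite (_ : gamma - 1 - gamma - ka = - (ka + 1)); last by lra.
by rewrite ler_wpM2r ?powR_ge0.
Qed.

Let g_step n a b : (a < n < N)%N -> (b < n < N)%N ->
  g n.+1 a b + interior_factor delta gamma eps n a b * (g n.+1 a n * g n.+1 n b) <= g n a b.
Proof.
move=> /andP[an nN] /andP[bn _].
have n0 : 0 < n%:R :> R by rewrite ltr0n (leq_ltn_trans _ an).
have G : g n.+1 a n <= 2 by apply: g_le2; rewrite gtn_max ltnS (ltnW an) ltnS leqnn.
have G' : g n.+1 n b <= 2 by apply: g_le2; rewrite gtn_max leqnn ltnS (ltnW bn).
have H := powR_decrement sg0 n0; rewrite -natr_succ subrK in H.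
have F0 := in0 n a b.
apply: (@le_trans _ _ (g n.+1 a b + interior_factor delta gamma eps n a b * (2 * 2))).
  by rewrite lerD2l ler_wpM2l// ler_pM.
rewrite -lerBrDl /interior_factor; cbv zeta.
have -> : g n a b - g n.+1 a b = (maxn a b).+1%:R `^ (sg - 1) *
    (n%:R `^ (- (sg - 1)) - n.+1%:R `^ (- (sg - 1))) by rewrite /g; ring.
set x := n.+1%:R `^ (- sg); set y := (maxn a b).+1%:R `^ _.
have -> : eps * x * y * (2 * 2) = y * (4 * eps * x) by ring.
rewrite ler_wpM2l ?powR_ge0// (le_trans _ H)//.
by rewrite -/x ler_wpM2r ?powR_ge0.
Qed.

Let sum_powR (K : nat) :
  \sum_(m < K.+1) m.+1%:R `^ (- (gamma + 1)) <= 1 + gamma^-1 - gamma^-1 * K.+1%:R `^ (- gamma).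
Proof.
have [gm0 _] := andP gamma01.
elim: K => [|K IH]; first by rewrite big_ord_recl big_ord0 !powR1; lra.
rewrite big_ord_recr /=; apply: le_trans (lerD IH (lexx _)) _.
have := @powR_decrement R gamma K.+1%:R gm0 (ltr0Sn _ _); rewrite -natr_succ.
rewrite -ler_pdivlMl// mulrBr => H; lra.
Qed.

(** The potentials [g] and [s] satisfy the recursive inequalities because [tau], hence
[loss], is small. At level [N] they are at least [1] on every path, and at level
[0] they leave [N^(1 + gamma)] times the convergent sum of [m^-(1 + gamma)]. *)
Lemma sum_path_sum_le :
  \sum_(w <- simple_seqs N | w != [::]) Phi w <=
  (#|C| ^ N)%:R * (4 * (1 + gamma^-1) * N%:R `^ (1 + gamma)).
Proof.
have [gm0 gm1] := andP gamma01.
have phi0 i j x y : 0 <= pair_kernel i j x y by exact: tpow_ge0.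
have PhiN w : 0 <= Phi w by exact: path_sum_ge0.
have phiC i j x y : pair_kernel i j x y = pair_kernel j i y x.
  by rewrite /pair_kernel kscaleC Dsym.
have s_step' n a : (a < n < N)%N ->
    s n.+1 a + endpoint_factor gamma eps n a * (s n.+1 n * g n.+1 n a) <= s n a.
  by move=> H; have := s_step H; rewrite /g maxnC [_ * s _ _]mulrC.
have fendP n a x : (a < n < N)%N ->
    \sum_z pair_kernel a n x z <= endpoint_factor gamma eps n a * #|C|%:R.
  by move=> H; exact: (endpoint_sum delta1 tau0 gamma01 B1 v00 D0 Dball x H vN).
have finP n a b x y : (a < n < N)%N -> (b < n < N)%N -> ~~ near_pair a b x y ->
    \sum_z pair_kernel a n x z * pair_kernel n b z y <=
    interior_factor delta gamma eps n a b * pair_kernel a b x y * #|C|%:R.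
  rewrite /near_pair -ltNge => an bn far.
  exact: (interior_sum delta1 tau0 gamma01 B1 v00 D0 Dsym Dquasi Dball an bn vN far).
have fend0 := end0; have fin0 := in0.
have Phi1 n : (n < N)%N -> Phi [:: n] <= Phi [::].
  by move=> _; apply: ler_sum => c _; rewrite /= mulr1.
have H := insertion_sum fin0 fend0 g_ge0 s_ge0 PhiN s_step s_step' g_step
  (fun n u a nN _ => path_sum_end near_pair phi0 C0 fendP nN)
  (fun n u a nN _ => path_sum_begin near_pair phi0 C0 phiC fendP nN)
  (fun n u v a b nN _ => path_sum_interior phi0 C0 fin0 finP nN) Phi1.
have Phi_nil : Phi [::] = (#|C| ^ N)%:R.
  rewrite /path_sum (eq_bigr (fun _ => 1)) ?sumr_const ?card_ffun ?card_ord//.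
  by move=> c _; rewrite /= mulr1.
apply: (@le_trans _ _ (\sum_(w <- simple_seqs N) Phi w * seq_weight g s N N w)).
  rewrite [leRHS](bigID (fun w => w != [::]))/= ler_wpDr//.
    rewrite sumr_ge0// => -[|//] _; rewrite mulr_ge0//= big_geq//.
  rewrite big_seq_cond [leRHS]big_seq_cond.
  apply: ler_sum => w /andP[/simple_seqsP[_ aw]].
  case: w aw => [//|a w] aw _; rewrite [seq_weight _ _ _ _ _]/=.
  rewrite ler_peMr//; have s1 i : (i < N)%N -> 1 <= s N i.
    move=> iN; rewrite /s (@le_trans _ _ (N%:R `^ ((1 + gamma) / 2) * i.+1%:R `^ (- gamma) * i.+1%:R `^ (- ka)))//.
      rewrite -mulrA -powRD ?pnatr_eq0 ?implybT//.
      rewrite (_ : - gamma - ka = - ((1 + gamma) / 2)); last by lra.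
      rewrite powRN ler_pdivlMr ?powR_gt0// mul1r ge0_ler_powR ?nnegrE ?ler_nat//.
      by lra.
    by rewrite ler_wpM2l ?mulr_ge0 ?powR_ge0// lerDl powR_ge0.
  have g1 n i j : 1 <= g n i j by rewrite /g lerDl mulr_ge0 ?powR_ge0.
  case/andP: aw => aN aw; rewrite mulr_ege1 ?s1//.
  elim: w a aN aw => [|b w IH] a aN /=; first by rewrite s1.
  by case/andP=> bN /(IH _ bN) H'; rewrite mulr_ege1.
apply: le_trans H _; rewrite Phi_nil ler_wpM2l//.
have -> : \sum_(m < N) s m.+1 m ^+ 2 =
    4 * N%:R `^ (1 + gamma) * \sum_(m < N) m.+1%:R `^ (- (gamma + 1)).
  rewrite mulr_sumr; apply: eq_bigr => m _; rewrite /s.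
  set x := m.+1%:R; have x0 : x != 0 by rewrite pnatr_eq0.
  have <- : (N%:R `^ ((1 + gamma) / 2)) ^+ 2 = N%:R `^ (1 + gamma).
    by rewrite -powR_mulrn ?powR_ge0// -powRrM divfK.
  have <- : (x `^ (- gamma) * x `^ (- ka)) ^+ 2 = x `^ (- (gamma + 1)).
    rewrite -powRD ?x0 ?implybT// -powR_mulrn ?powR_ge0// -powRrM.
    by congr (_ `^ _); lra.
  ring.
have := sum_powR M; set S := \sum_(_ < _) _ => HS.
have {}HS : S <= 1 + gamma^-1.
  by rewrite (le_trans HS)// gerBl mulr_ge0 ?powR_ge0// invr_ge0 ltW.
by rewrite [leRHS]mulrAC ler_wpM2l// mulr_ge0// powR_ge0.
Qed.

End path_sums.

(** * Geodesics *)

Section geodesics.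
Variable Z : rel nat.

Fixpoint shortcut_free (w : seq nat) : bool :=
  if w is a :: v then all (fun b => ~~ Z a b) (behead v) && shortcut_free v else true.

(** In a path of minimal length, a repetition or a shortcut could be used to shorten it. *)
Lemma geodesic a s : path Z a s -> exists s', [/\ path Z a s',
  last a s' = last a s, uniq (a :: s') & shortcut_free (a :: s')].
Proof.
pose geo a s := path Z a s /\ forall s', path Z a s' -> last a s' = last a s ->
  (size s <= size s')%N.
have geo_uniq : forall s a, geo a s -> uniq (a :: s) /\ shortcut_free (a :: s).
  elim=> [//|b t IH] {}a [pt Hmin].
  have [ab bt] := andP pt.
  have gb : geo b t.
    split=> // s' ps' ls'.
    by have := Hmin (b :: s'); rewrite /= ab ps' => /(_ isT ls').
  have [ut st] := IH _ gb; split.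
    rewrite cons_uniq ut andbT; apply/negP => abt.
    have [u [v tE]] : exists u v, b :: t = u ++ a :: v.
      by case/splitPr: abt => u v; exists u, v.
    move: pt; rewrite tE cat_path /= => /and3P[_ _ av].
    have := Hmin v av; rewrite tE last_cat /= size_cat /= => /(_ erefl).
    by rewrite addnS ltnNge leq_addl.
  rewrite [shortcut_free _]/= -/(shortcut_free (b :: t)) st andbT.
  apply/allP => y yt; apply/negP => Zay.
  have {}yt : y \in t by exact: yt.
  have {}bt : path Z b t by exact: bt.
  have [u [v tE]] : exists u v, t = u ++ y :: v by case/splitPr: yt => u v; exists u, v.
  move: bt; rewrite tE cat_path /= => /and3P[_ _ yv].
  have := Hmin (y :: v); rewrite tE /= Zay yv last_cat /= size_cat /= => /(_ isT erefl).
  by rewrite addnS ltnS ltnNge leq_addl.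
move=> pas.
have ex : exists n, `[< exists s', [/\ path Z a s', last a s' = last a s & size s' = n] >].
  by exists (size s); apply/asboolP; exists s.
case: (ex_minnP ex) => n /asboolP[s' [ps' ls' ss']] Hmin.
have [us fs] : uniq (a :: s') /\ shortcut_free (a :: s').
  apply: geo_uniq; split => // t pt lt; rewrite ss'; apply: Hmin.
  by apply/asboolP; exists t; split; rewrite // lt.
by exists s'.
Qed.

End geodesics.

(** * Cells of the torus *)

Section cell_distance.
Variable L : nat.

Definition cyc_dist (i j : nat) : nat := minn ((i - j) + (j - i)) (L.+1 - ((i - j) + (j - i))).

Lemma cyc_distC i j : cyc_dist i j = cyc_dist j i.
Proof. by rewrite /cyc_dist addnC. Qed.

Lemma cyc_dist_tri i j k : (i < L.+1)%N -> (j < L.+1)%N -> (k < L.+1)%N ->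
  (cyc_dist i j <= cyc_dist i k + cyc_dist k j)%N.
Proof. by rewrite /cyc_dist; lia. Qed.

Lemma card_cyc_ball (i : 'I_L.+1) k :
  (#|[pred j : 'I_L.+1 | cyc_dist i j <= k]| <= (2 * k).+1)%N.
Proof.
have [Lk|kL] := leqP L (2 * k).
  by rewrite (leq_trans (max_card _))// card_ord ltnS.
pose s : seq 'I_L.+1 := [seq inord ((i + e) %% L.+1) | e <- iota 0 k.+1] ++
  [seq inord ((i + L.+1 - e) %% L.+1) | e <- iota 1 k].
have ss : size s = (2 * k).+1 by rewrite size_cat !size_map !size_iota; lia.
rewrite -ss; apply: leq_trans (card_size s); apply/subset_leq_card/fintype.subsetP => j.
rewrite inE /cyc_dist => ij; rewrite mem_cat; have iL := ltn_ord i; have jL := ltn_ord j.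
have key e : (e %% L.+1)%N = j -> inord (e %% L.+1) = j.
  by move=> ->; exact: inord_val.
have [ji|ij'] := leqP i j.
  have [h|h] := leqP (j - i) k.
    apply/orP; left; apply/mapP; exists (j - i)%N; first by rewrite mem_iota; lia.
    by rewrite key// subnKC// modn_small.
  apply/orP; right; apply/mapP; exists (L.+1 - (j - i))%N; first by rewrite mem_iota; lia.
  by rewrite key// (_ : (_ - _ = j)%N) ?modn_small//; lia.
have [h|h] := leqP (i - j) k.
  apply/orP; right; apply/mapP; exists (i - j)%N; first by rewrite mem_iota; lia.
  by rewrite key// (_ : (_ - _ = j + L.+1)%N) ?modnDr ?modn_small//; lia.
apply/orP; left; apply/mapP; exists (L.+1 - (i - j))%N; first by rewrite mem_iota; lia.
by rewrite key// (_ : (_ + _ = j + L.+1)%N) ?modnDr ?modn_small//; lia.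
Qed.

Context {R : realType} {d : nat}.
Local Notation cell := {ffun 'I_d -> 'I_L.+1}.
Implicit Types c e : cell.

Definition cell_dist c e : nat := \max_(i < d) cyc_dist (c i) (e i).

Lemma cell_distC c e : cell_dist c e = cell_dist e c.
Proof. by apply: eq_bigr => i _; rewrite cyc_distC. Qed.

Lemma cell_dist_tri c e f : (cell_dist c e <= cell_dist c f + cell_dist f e)%N.
Proof.
apply/bigmax_leqP => i _; apply: leq_trans (cyc_dist_tri (ltn_ord _) (ltn_ord _) (ltn_ord (f i))) _.
by apply: leq_add; apply: (leq_bigmax_cond (P := xpredT)).
Qed.

Lemma card_cell_ball c k : (#|[pred e : cell | cell_dist c e <= k]| <= (2 * k).+1 ^ d)%N.
Proof.
pose F i := [pred j : 'I_L.+1 | cyc_dist (c i) j <= k]%N.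
apply: (@leq_trans #|family F|).
  apply/subset_leq_card/fintype.subsetP => e; rewrite inE => /bigmax_leqP H.
  by apply/familyP => i; rewrite inE H.
rewrite card_family -[X in (_ <= _ ^ X)%N](card_ord d) cardE /image_mem.
elim: (enum 'I_d) => //= i s IH; rewrite expnS leq_mul//; exact: card_cyc_ball.
Qed.

(** A lower bound for the [d]-th power of the torus distance between points of two
cells that are neither equal nor adjacent. *)
Definition cell_vol c e : R := ((cell_dist c e)%:R / (2 * L.+1%:R)) ^+ d.

Lemma cell_vol_ge0 c e : 0 <= cell_vol c e.
Proof. by rewrite exprn_ge0// divr_ge0// mulr_ge0. Qed.

Lemma cell_volC c e : cell_vol c e = cell_vol e c.
Proof. by rewrite /cell_vol cell_distC. Qed.

Lemma cell_vol_quasi c e f :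
  cell_vol c e <= 6 ^+ d * Num.max (cell_vol c f) (cell_vol f e).
Proof.
have L0 : 0 < 2 * L.+1%:R :> R by rewrite mulr_gt0.
wlog fe : c e / (cell_dist c f <= cell_dist f e)%N.
  move=> H; have [|/ltnW] := leqP (cell_dist c f) (cell_dist f e); first exact: H.
  rewrite cell_distC (cell_distC c) => /H; rewrite maxC.
  by rewrite (cell_volC e) (cell_volC e f) (cell_volC f c).
apply: (@le_trans _ _ (6 ^+ d * cell_vol f e)); last first.
  by rewrite ler_wpM2l ?exprn_ge0// le_max lexx orbT.
rewrite /cell_vol -exprMn; apply: lerXn2r; rewrite ?nnegrE ?mulr_ge0 ?invr_ge0 ?(ltW L0)//.
rewrite mulrA ler_wpM2r ?invr_ge0 ?(ltW L0)// -natrM ler_nat.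
by have := cell_dist_tri c e f; lia.
Qed.

Lemma cell_vol_ball c v : (2 * L.+1%:R) ^- d <= v ->
  \sum_(e : cell) (cell_vol c e <= v)%R%:R <= 6 ^+ d * v * #|cell|%:R.
Proof.
move=> v0; have L0 : 0 < 2 * L.+1%:R :> R by rewrite mulr_gt0.
pose A := [pred e : cell | cell_vol c e <= v].
have -> : \sum_(e : cell) (cell_vol c e <= v)%R%:R = #|A|%:R :> R.
  rewrite -sum1_card natr_sum [RHS]big_mkcond; apply: eq_bigr => e _.
  by rewrite inE; case: (cell_vol c e <= v).
pose k := \max_(e in A) cell_dist c e.
have Ak : (#|A| <= (2 * k).+1 ^ d)%N.
  apply: leq_trans (card_cell_ball c k); apply/subset_leq_card/fintype.subsetP => e eA.
  by rewrite inE /k (bigD1 e)//= leq_max leqnn.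
rewrite card_ffun !card_ord natrX mulrAC -exprMn.
have kv : (k%:R / (2 * L.+1%:R)) ^+ d <= v \/ k = 0%N.
  have [->|k0] := eqVneq k 0%N; [by right|left].
  have [e0 e0A|A0] := pickP A; last by move: k0; rewrite /k big_pred0.
  have : (0 < #|A|)%N by apply/card_gt0P; exists e0.
  by move=> /(eq_bigmax_cond (cell_dist c))[e eA kE]; rewrite /k kE; exact: eA.
have [{}kv|k0] := kv; last first.
  rewrite k0 muln0 exp1n in Ak; apply: (@le_trans _ _ 1); first by rewrite lern1.
  rewrite -ler_pdivrMl ?exprn_gt0 ?mulr_gt0// mulr1 (le_trans _ v0)//.
  rewrite lef_pV2 ?posrE ?exprn_gt0 ?mulr_gt0//.
  by apply: lerXn2r; rewrite ?nnegrE ?mulr_ge0// ler_wpM2r// ler_nat.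
have [k0|k0] := posnP k.
  rewrite k0 muln0 exp1n in Ak; apply: (@le_trans _ _ 1); first by rewrite lern1.
  rewrite -ler_pdivrMl ?exprn_gt0 ?mulr_gt0// mulr1 (le_trans _ v0)//.
  rewrite lef_pV2 ?posrE ?exprn_gt0 ?mulr_gt0//.
  by apply: lerXn2r; rewrite ?nnegrE ?mulr_ge0// ler_wpM2r// ler_nat.
apply: (@le_trans _ _ ((3 * k) ^ d)%:R).
  apply: (@le_trans _ _ ((2 * k).+1 ^ d)%:R); first by rewrite ler_nat.
  by rewrite !natrX; apply: lerXn2r; rewrite ?nnegrE// ler_nat; lia.
apply: le_trans (ler_wpM2l _ kv); last by rewrite exprn_ge0 ?mulr_ge0.
rewrite natrX -exprMn; apply: lerXn2r; rewrite ?nnegrE ?mulr_ge0 ?invr_ge0 ?(ltW L0)//.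
by rewrite natrM; apply: le_of_eq; field.
Qed.

Lemma cell_gt0 : (0 < #|cell|)%N.
Proof. by rewrite card_ffun card_ord expn_gt0. Qed.

End cell_distance.

Section torus_cells.
Context {R : realType} {d : nat}.
Implicit Types x y : d.-tuple R.

Lemma ge_enorm (z : 'I_d -> R) i : `|z i| <= enorm z.
Proof.
rewrite -sqrtr_sqr ler_wsqrtr// (bigD1 i)//= lerDl sumr_ge0// => j _.
exact: sqr_ge0.
Qed.

Definition cell_index (L : nat) x (i : 'I_d) : nat :=
  Num.truncn (L.+1%:R * (2^-1 - tnth x i)).

Definition cell_of L x : {ffun 'I_d -> 'I_L.+1} := [ffun i => inord (cell_index L x i)].

Lemma cell_indexP L x i : torus x ->
  (cell_index L x i)%:R <= L.+1%:R * (2^-1 - tnth x i) < (cell_index L x i).+1%:R.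
Proof.
by move=> /(_ i)/andP[x1 x2]; rewrite truncn_itv// mulr_ge0// subr_ge0.
Qed.

Lemma cell_index_lt L x i : torus x -> (cell_index L x i < L.+1)%N.
Proof.
move=> tx; have /andP[H _] := cell_indexP L i tx; have /andP[x1 _] := tx i.
rewrite -(ltr_nat R) (le_lt_trans H)// gtr_pMr//; lra.
Qed.

Lemma cell_ofE L x i : torus x -> cell_of L x i = cell_index L x i :> nat.
Proof. by move=> tx; rewrite ffunE inordK// cell_index_lt. Qed.

(** Points of cells at cyclic distance [k] are at distance at least [k - 1] cells, and
[k - 1] is at least [k / 2] when [k] is at least [2]. *)
Lemma cell_vol_le_dist L x y : (0 < d)%N -> torus x -> torus y ->
  (2 <= cell_dist (cell_of L x) (cell_of L y))%N ->
  cell_vol (cell_of L x) (cell_of L y) <= torus_dist x y ^+ d.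
Proof.
move=> d0 tx ty c2; set k := cell_dist _ _ in c2.
have n0 : 0 < L.+1%:R :> R by [].
rewrite /cell_vol -/k; apply: (@le_trans _ _ (((k%:R - 1) / L.+1%:R) ^+ d)).
  have k2 : 2 <= k%:R :> R by rewrite ler_nat.
  apply: lerXn2r; rewrite ?nnegrE ?divr_ge0 ?mulr_ge0//; first lra.
  rewrite invfM mulrA ler_wpM2r ?invr_ge0//; lra.
have [i ki] : exists i : 'I_d, k = cyc_dist L (cell_of L x i) (cell_of L y i).
  have : (0 < #|'I_d|)%N by rewrite card_ord.
  move/(bigop.eq_bigmax (fun i : 'I_d => cyc_dist L (cell_of L x i) (cell_of L y i))) => [i ki].
  by exists i; exact: ki.
have k1 : 1 <= k%:R :> R by rewrite ler1n ltnW.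
suff H (z : R) (u : 'I_3) : z = tnth x i - tnth y i + ((u : nat)%:R - 1) -> (k%:R - 1) / L.+1%:R <= `|z|.
  have P0 : 0 <= (k%:R - 1) / L.+1%:R :> R by rewrite divr_ge0// subr_ge0.
  suff HD : (k%:R - 1) / L.+1%:R <= torus_dist x y.
    by apply: lerXn2r; rewrite ?nnegrE// (le_trans P0).
  rewrite /torus_dist; apply: le_bigmin.
    apply: le_trans (ge_enorm _ i); apply: (H _ (Ordinal (isT : 1 < 3)%N)) => /=.
    by rewrite subrr addr0.
  by move=> u _; apply: le_trans (ge_enorm _ i); apply: (H _ (u i)).
move=> ->; rewrite ler_pdivrMr// -[X in _ * X](ger0_norm (ltW n0)) -normrM mulrC.
have := cell_indexP L i tx; have := cell_indexP L i ty.
rewrite -!cell_ofE//; set p := nat_of_ord (cell_of L x i); set q := nat_of_ord (cell_of L y i).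
rewrite -!natr1; move=> /andP[q1 q2] /andP[p1 p2].
have pL : (p < L.+1)%N by exact: ltn_ord.
have qL : (q < L.+1)%N by exact: ltn_ord.
have kk : [/\ k%:R <= q%:R - p%:R :> R & k%:R + (q%:R - p%:R) <= L%:R + 1 :> R] \/
    [/\ k%:R <= p%:R - q%:R :> R & k%:R + (p%:R - q%:R) <= L%:R + 1 :> R].
  have [pq|qp] := leqP p q; [left|right]; split; rewrite ?lerBrDr ?addrA ?lerBlDr ?natr1 -?natrD ler_nat ki /cyc_dist -/p -/q; lia.
set n := L%:R + 1 in kk q1 q2 p1 p2 *; rewrite ler_normr.
set X := tnth x i in p1 p2 *; set Y := tnth y i in q1 q2 *.
case: u => -[|[|[|//]]] /= _; rewrite ?sub0r ?subrr; apply/orP.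
- case: kk => -[h1 h2]; [right|right]; nra.
- case: kk => -[h1 h2]; [left|right]; nra.
- case: kk => -[h1 h2]; [left|left]; nra.
Qed.

Lemma torus_dist_ge0 x y : 0 <= torus_dist x y.
Proof. by rewrite /torus_dist; apply: le_bigmin => [|u _]; exact: sqrtr_ge0. Qed.

Lemma torus_dist_le_cell L x y : torus x -> torus y -> cell_of L x = cell_of L y ->
  torus_dist x y <= Num.sqrt d%:R / L.+1%:R.
Proof.
move=> tx ty xy; apply: (le_trans (bigmin_le_id _ _ _ _)).
have n0 : 0 < L.+1%:R :> R by [].
have -> : Num.sqrt d%:R / L.+1%:R = Num.sqrt (\sum_(i < d) L.+1%:R ^- 2) :> R.
  rewrite sumr_const card_ord -[(L.+1%:R ^- 2) *+ d]mulr_natl sqrtrM// -exprVn.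
  by rewrite sqrtr_sqr ger0_norm ?invr_ge0.
rewrite ler_wsqrtr// ler_sum// => i _.
have := cell_indexP L i tx; have := cell_indexP L i ty.
rewrite -!cell_ofE// xy; set q := nat_of_ord _; rewrite -[q.+1%:R]natr1 => /andP[q1 q2] /andP[p1 p2].
rewrite -exprVn -real_normK ?num_real// ler_pXn2r ?nnegrE ?invr_ge0//.
rewrite -[leRHS]mul1r ler_pdivlMr// -[X in _ * X](ger0_norm (ltW n0)) -normrM ler_norml.
set n := L.+1%:R in p1 p2 q1 q2 *; apply/andP; split; nra.
Qed.

Definition cell_box L (c : 'I_d -> nat) : set (d.-tuple R) :=
  [set x | forall i, 2^-1 - (c i).+1%:R / L.+1%:R < tnth x i <= 2^-1 - (c i)%:R / L.+1%:R].

Lemma cell_box_indexP L (c : 'I_d -> nat) x : torus x ->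
  cell_box L c x <-> cell_index L x =1 c.
Proof.
move=> tx; have n0 : 0 < L.+1%:R :> R by [].
suff E i : (2^-1 - (c i).+1%:R / L.+1%:R < tnth x i <= 2^-1 - (c i)%:R / L.+1%:R) =
    (cell_index L x i == c i).
  split=> H i; first by apply/eqP; rewrite -E; exact: H.
  by rewrite E H.
rewrite truncn_eq; last by rewrite mulr_ge0// subr_ge0; have /andP[] := tx i.
rewrite -ler_pdivrMl// -ltr_pdivlMl// ![L.+1%:R^-1 * _]mulrC.
set a := (c i)%:R / _; set b := (c i).+1%:R / _; set z := tnth x i.
by apply/andP/andP => -[h1 h2]; split; lra.
Qed.

Lemma cell_boxP L (c : {ffun 'I_d -> 'I_L.+1}) x : torus x ->
  cell_box L (fun i => c i : nat) x <-> cell_of L x = c.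
Proof.
move=> tx; rewrite cell_box_indexP//; split=> [H|<- i]; last by rewrite cell_ofE.
by apply/ffunP => i; apply: val_inj; rewrite /= cell_ofE.
Qed.

Lemma cell_box_torus L (c : 'I_d -> nat) : (forall i, (c i < L.+1)%N) ->
  cell_box L c `<=` torus.
Proof.
move=> cL x H i; have /andP[x1 x2] := H i; have n0 : 0 < L.+1%:R :> R by [].
apply/andP; split; last by rewrite (le_trans x2)// gerBl divr_ge0.
rewrite (le_lt_trans _ x1)//.
have : (c i).+1%:R / L.+1%:R <= 1 :> R by rewrite ler_pdivrMr// mul1r ler_nat.
set a := _ / _; lra.
Qed.

Lemma measurable_cell_box L (c : 'I_d -> nat) : measurable (cell_box L c).
Proof.
rewrite (_ : cell_box L c = \bigcap_(i in [set: 'I_d])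
    ((@tnth _ R)^~ i @^-1` `]2^-1 - (c i).+1%:R / L.+1%:R, 2^-1 - (c i)%:R / L.+1%:R]%classic)).
  apply: fin_bigcap_measurable => [|i _]; first exact: finite_finset.
  rewrite -[X in measurable X]setTI.
  exact: (@measurable_tnth _ R d i measurableT).
apply/seteqP; split => x /= H i; first by move=> _; rewrite /= in_itv; exact: H.
by have := H i Logic.I; rewrite /= in_itv.
Qed.

Lemma lebesgue_cell_box L (c : 'I_d -> nat) :
  lebesgue_tuple d (cell_box L c) = ((L.+1%:R ^- 1) ^+ d)%:E.
Proof.
pose A i : set R := `]2^-1 - (c i).+1%:R / L.+1%:R, 2^-1 - (c i)%:R / L.+1%:R]%classic.
have -> : cell_box L c = [set v | forall i, A i (tnth v i)].
  by apply/seteqP; split => x /= H i; have := H i; rewrite /A /= in_itv.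
rewrite lebesgue_tuple_box; last by move=> i; exact: measurable_itv.
rewrite (eq_bigr (fun=> (L.+1%:R ^- 1)%:E)).
  by rewrite prodEFin prodr_const card_ord.
move=> i _; rewrite /A lebesgue_measure_itv /= lte_fin.
rewrite ifT; last by rewrite ltrD2l ltrN2 ltr_pM2r ?invr_gt0// ltr_nat.
rewrite -EFinB; congr EFin; rewrite expr1.
have : L.+1%:R != 0 :> R by rewrite pnatr_eq0.
move: (L.+1%:R : R) => n n0; rewrite -natr1; by field.
Qed.

End torus_cells.

(** * Real-valued probabilities *)

Section integral_bounds.
Context {disp : measure_display} {T : measurableType disp} {R : realType}.
Variable P : probability T R.
Local Open Scope ereal_scope.

(** The integral of a nonnegative function is a supremum over the simple functions
below it, hence monotone. It is applied to products of connection probabilities. *)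
Lemma ge0_le_integral_nomeas (A : set T) (f g : T -> \bar R) :
  (forall x, A x -> 0 <= f x) -> (forall x, A x -> f x <= g x) ->
  \int[P]_(x in A) f x <= \int[P]_(x in A) g x.
Proof.
move=> f0 fg; have g0 x : A x -> 0 <= g x by move=> Ax; rewrite (le_trans (f0 _ Ax)) ?fg.
rewrite !ge0_integralE//; apply: le_ereal_sup => _ [h hf <-]; exists h => // x.
by apply: le_trans (hf x) _; rewrite /patch; case: ifPn => //; rewrite inE => /fg.
Qed.

Lemma integral_le_cst (A : set T) (f : T -> \bar R) (c : R) : measurable A ->
  (forall x, A x -> 0 <= f x <= c%:E) -> \int[P]_(x in A) f x <= c%:E * P A.
Proof.
move=> mA H; rewrite -(integral_cst P mA); apply: ge0_le_integral_nomeas => x /H/andP[]//.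
Qed.

Lemma integral_ge_cst (A B : set T) (f : T -> \bar R) (c : R) : measurable A -> measurable B ->
  B `<=` A -> (0 <= c)%R -> (forall x, A x -> 0 <= f x) ->
  (forall x, B x -> c%:E <= f x) -> c%:E * P B <= \int[P]_(x in A) f x.
Proof.
move=> mA mB BA c0 f0 cf.
apply: (@le_trans _ _ (\int[P]_(x in A) (c%:E * (\1_B x)%:E))).
  rewrite ge0_integralZl_EFin//; last exact/measurable_EFinP.
  by rewrite integral_indic// setIidl.
apply: ge0_le_integral_nomeas => x Ax; first by rewrite mule_ge0.
by rewrite indicE; case: (boolP (x \in B)) => [/set_mem/cf|]; rewrite ?mule1// mule0 f0.
Qed.

End integral_bounds.

Section real_probability.
Context {disp : measure_display} {T : measurableType disp} {R : realType}.
Variable P : probability T R.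

(** Probabilities as real numbers, so that the estimates take place in [R]. *)
Definition prob (A : set T) : R := fine (P A).
Local Notation pr := prob.

Lemma prE A : measurable A -> P A = (pr A)%:E.
Proof. by move=> mA; rewrite fineK// fin_num_measure. Qed.

Lemma pr_ge0 A : 0 <= pr A.
Proof. exact: fine_ge0. Qed.

(** Expectations of a pointwise inequality between weighted numbers of events. *)
Lemma pr_sum_le (I J : Type) (r : seq I) (s : seq J) (a : I -> R) (b : J -> R)
    (A : I -> set T) (B : J -> set T) :
  (forall i, 0 <= a i) -> (forall j, 0 <= b j) ->
  (forall i, measurable (A i)) -> (forall j, measurable (B j)) ->
  (forall w, \sum_(i <- r) a i * \1_(A i) w <= \sum_(j <- s) b j * \1_(B j) w) ->
  \sum_(i <- r) a i * pr (A i) <= \sum_(j <- s) b j * pr (B j).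
Proof.
move=> a0 b0 mA mB H.
have E (K : Type) (u : seq K) (c : K -> R) (C : K -> set T) : (forall k, 0 <= c k) ->
    (forall k, measurable (C k)) ->
    (\int[P]_w (\sum_(k <- u) c k * \1_(C k) w)%:E = (\sum_(k <- u) c k * pr (C k))%:E)%E.
  move=> c0 mC; under eq_integral do rewrite -sumEFin.
  rewrite ge0_integral_sum//.
  - rewrite -sumEFin; apply: eq_bigr => k _; rewrite EFinM -prE//.
    under eq_integral do rewrite EFinM.
    rewrite ge0_integralZl_EFin//; last exact/measurable_EFinP.
    by rewrite integral_indic// setIT.
  - by move=> k; apply/measurable_EFinP; exact: measurable_funM.
  - by move=> k w _; rewrite lee_fin mulr_ge0.
rewrite -lee_fin -!E//; apply: ge0_le_integral_nomeas => w _; last by rewrite lee_fin.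
by rewrite lee_fin sumr_ge0// => i _; rewrite mulr_ge0.
Qed.

Lemma indic1 (A : set T) w : A w -> \1_A w = 1 :> R.
Proof. by move=> Aw; rewrite indicE mem_set. Qed.

(** Markov's inequality for the number of events that occur. *)
Lemma pr_le_sum (I : Type) (r : seq I) (A : I -> set T) (B : set T) (k : R) :
  0 <= k -> (forall i, measurable (A i)) -> measurable B ->
  (forall w, B w -> k <= \sum_(i <- r) \1_(A i) w) ->
  k * pr B <= \sum_(i <- r) pr (A i).
Proof.
move=> k0 mA mB H.
have := @pr_sum_le unit I [:: tt] r (fun=> k) (fun=> 1) (fun=> B) A (fun=> k0)
  (fun=> ler01) (fun=> mB) mA.
rewrite big_seq1 (eq_bigr (fun i => pr (A i))); last by move=> i _; rewrite mul1r.
apply => w; rewrite big_seq1 (eq_bigr (fun i => \1_(A i) w)); last by move=> i _; rewrite mul1r.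
rewrite indicE; case: (boolP (w \in B)) => [/set_mem/H|_]; first by rewrite mulr1.
by rewrite mulr0 sumr_ge0.
Qed.

Lemma le_pr A B : measurable A -> measurable B -> A `<=` B -> pr A <= pr B.
Proof.
move=> mA mB AB; have := @pr_le_sum unit [:: tt] (fun=> B) A 1.
rewrite mul1r big_seq1; apply => // w /AB Bw; by rewrite big_seq1 indic1.
Qed.

Lemma pr_le1 A : measurable A -> pr A <= 1.
Proof. by move=> mA; rewrite -lee_fin -prE// probability_le1. Qed.

Lemma pr_setT : pr setT = 1.
Proof. by rewrite /prob probability_setT. Qed.

Lemma pr_setC A : measurable A -> pr (~` A) = 1 - pr A.
Proof. by move=> mA; apply: EFin_inj; rewrite -prE ?probability_setC ?prE//; exact: measurableC. Qed.

Lemma pr_split A B : measurable A -> measurable B -> pr A = pr (A `&` B) + pr (A `&` ~` B).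
Proof.
move=> mA mB; apply: EFin_inj; rewrite EFinD -!prE//; last 2 first.
- by apply: measurableI => //; exact: measurableC.
- exact: measurableI.
rewrite -measureU//; first by rewrite -setIUr setUv setIT.
- exact: measurableI.
- by apply: measurableI => //; exact: measurableC.
- by rewrite setIACA setICr setI0.
Qed.

Lemma pr_setU_le A B : measurable A -> measurable B -> pr (A `|` B) <= pr A + pr B.
Proof.
move=> mA mB; have := @pr_le_sum bool [:: true; false] (fun b => if b then A else B) (A `|` B) 1.
rewrite mul1r !big_cons big_nil addr0; apply => // [[]//||w].
  exact: measurableU.
rewrite !big_cons big_nil addr0 => -[h|h].
  by rewrite (indic1 h) lerDl.
by rewrite (indic1 h) lerDr.
Qed.

End real_probability.

(** * The filtration of the network *)

Section network_events.
Context {R : realType} {disp : measure_display} {T : measurableType disp} {d : nat}.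
Context {W : nat -> {mfun T >-> R}} {X : nat -> {mfun T >-> d.-tuple R}}.
Context {E : nat -> nat -> {mfun T >-> bool}} {P : probability T R}.
Context {rho : R -> R} {beta gamma : R}.
Hypothesis net : age_based_network W X E P rho beta gamma.
Local Notation pst := (past W X E).
Local Notation pab := (past_and_birth W X E).
Local Notation age := (birth_time W).
Local Notation pr := (prob P).

Lemma preimage_system d' (T' : measurableType d') (f : T -> T') (B : set T') :
  measurable B -> g_sigma_algebra_preimage f (f @^-1` B).
Proof. by move=> mB; exists B => //; rewrite setTI. Qed.

Lemma measurable_preimage_system d' (T' : measurableType d') (f : {mfun T >-> T'}) :
  g_sigma_algebra_preimage f `<=` measurable.
Proof. by move=> _ [B mB <-]; exact: measurable_funP. Qed.

Lemma past_measurable n A : pst n A -> measurable A.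
Proof.
move: A; apply: smallest_sub; first exact: sigma_algebra_measurable.
move=> A [k _ [[|]|[j _]]]; exact: measurable_preimage_system.
Qed.

Lemma past_birth_measurable n A : pab n A -> measurable A.
Proof.
move: A; apply: smallest_sub; first exact: sigma_algebra_measurable.
move=> A [[|]|]; [exact: past_measurable| |]; exact: measurable_preimage_system.
Qed.

Lemma pastI n A B : pst n A -> pst n B -> pst n (A `&` B).
Proof. exact: (@measurableI _ (g_sigma_algebraType _)). Qed.

Lemma pastC n A : pst n A -> pst n (~` A).
Proof. exact: (@measurableC _ (g_sigma_algebraType _)). Qed.

Lemma pastT n : pst n setT.
Proof. exact: (@measurableT _ (g_sigma_algebraType _)). Qed.

Lemma past_bigI n (Q : nat -> Prop) (F : nat -> set T) :
  (forall k, Q k -> pst n (F k)) -> pst n (\bigcap_(k in [set k | Q k]) F k).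
Proof.
move=> H; rewrite bigcap_mkcond; apply: (@bigcapT_measurable _ (g_sigma_algebraType _)) => k.
by case: ifPn => [|_]; [rewrite inE => /H|exact: pastT].
Qed.

Lemma past_birthI n A B : pab n A -> pab n B -> pab n (A `&` B).
Proof. exact: (@measurableI _ (g_sigma_algebraType _)). Qed.

Lemma past_birth_past n A : pst n A -> pab n A.
Proof. by move=> pA; apply: sub_sigma_algebra; left; left. Qed.

Lemma past_birth_W n B : measurable B -> pab n (W n @^-1` B).
Proof. by move=> mB; apply: sub_sigma_algebra; left; right; exact: preimage_system. Qed.

Lemma past_birth_X n B : measurable B -> pab n (X n @^-1` B).
Proof. by move=> mB; apply: sub_sigma_algebra; right; exact: preimage_system. Qed.

Lemma past_mono m n A : (m <= n)%N -> pst m A -> pst n A.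
Proof.
move=> mn; apply: sub_sigma_algebra2 A => A [k /= km H]; exists k => //=.
exact: leq_trans mn.
Qed.

Lemma past_birth_pastS n A : pab n A -> pst n.+1 A.
Proof.
move: A; apply: smallest_sub; first exact: smallest_sigma_algebra.
move=> A [[|]|]; first exact: past_mono.
- by move=> H; apply: sub_sigma_algebra; exists n => //=; left; left.
- by move=> H; apply: sub_sigma_algebra; exists n => //=; left; right.
Qed.

Lemma past_W n k B : (k < n)%N -> measurable B -> pst n (W k @^-1` B).
Proof. by move=> kn mB; apply: (past_mono kn); exact: (past_birth_pastS (past_birth_W mB)). Qed.

Lemma past_X n k B : (k < n)%N -> measurable B -> pst n (X k @^-1` B).
Proof. by move=> kn mB; apply: (past_mono kn); exact: (past_birth_pastS (past_birth_X mB)). Qed.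

Lemma past_E n j k : (j < k < n)%N -> pst n [set w | E j k w].
Proof.
move=> /andP[jk kn]; apply: sub_sigma_algebra; exists k => //=; right; exists j => //=.
by have := @preimage_system _ _ (E j k) [set true] Logic.I.
Qed.

Lemma generated_age (G : set (set T)) k (B : set R) :
  (forall i (B' : set R), (i <= k)%N -> measurable B' -> <<s G >> (W i @^-1` B')) ->
  measurable B -> <<s G >> (age k @^-1` B).
Proof.
move=> HW mB; pose T' : measurableType _ := g_sigma_algebraType G.
have mage : measurable_fun [set: T'] (age k : T' -> R).
  apply: (@measurable_sum _ T' R setT _ _ (fun i : 'I_k.+1 => (W i : T' -> R))) => i.
  by move=> _ B' mB'; rewrite setTI; apply: HW => //; rewrite -ltnS.
by have := mage measurableT _ mB; rewrite setTI.
Qed.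

Lemma past_age n k (B : set R) : (k < n)%N -> measurable B -> pst n (age k @^-1` B).
Proof.
move=> kn mB; apply: generated_age => // i B' ik mB'.
by apply: past_W => //; exact: leq_ltn_trans kn.
Qed.

Lemma past_birth_age n (B : set R) : measurable B -> pab n (age n @^-1` B).
Proof.
move=> mB; apply: generated_age => // i B'; rewrite leq_eqVlt => /orP[/eqP ->|ik] mB'.
  exact: past_birth_W.
by apply: past_birth_past; exact: past_W.
Qed.

Lemma past_independent n A (B : set R) (C : set (d.-tuple R)) :
  pst n A -> measurable B -> measurable C ->
  pr (A `&` W n @^-1` B `&` X n @^-1` C) = pr A * pr (W n @^-1` B) * pr (X n @^-1` C).
Proof.
move=> pA mB mC; have := @birth_independent _ _ _ _ _ _ _ _ _ _ _ net n.
pose F (i : 'I_3) := tnth [tuple A; W n @^-1` B; X n @^-1` C] i.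
pose J : {fset 'I_3} := [fset x | x in enum 'I_3]%fset.
have JT i : i \in J by rewrite !inE mem_enum.
move=> /(_ J F (fun _ _ => Logic.I)).
rewrite (_ : \bigcap_(i in [set` J]) F i =
    A `&` W n @^-1` B `&` X n @^-1` C); last first.
  apply/seteqP; split => w /= H.
    split; [split|]; [exact: (H ord0 (JT _))|exact: (H (lift ord0 ord0) (JT _))|exact: (H ord_max (JT _))].
  case: H => -[HA HW] HX [[|[|[|//]]] i3] _ //=.
have mW : measurable (W n @^-1` B) by rewrite -[X in measurable X]setTI; exact: measurable_funP.
have mX : measurable (X n @^-1` C) by rewrite -[X in measurable X]setTI; exact: measurable_funP.
have -> : (\prod_(i <- J) P (F i) = P A * P (W n @^-1` B) * P (X n @^-1` C))%E.
  rewrite (perm_big (enum 'I_3)) /=; last first.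
    by apply: uniq_perm; rewrite ?enum_uniq ?fset_uniq// => i; rewrite JT mem_enum.
  rewrite big_enum/= !big_ord_recl big_ord0 mule1 muleA.
  by rewrite /F !(tnth_nth set0).
have mA := past_measurable pA.
move=> H; apply: EFin_inj; rewrite !EFinM -!prE//; last first.
  by apply: measurableI => //; exact: measurableI.
apply: H => -[[|[|[|//]]] i3] _; rewrite /F !(tnth_nth set0) /=.
- exact: pA.
- exact: preimage_system.
- exact: preimage_system.
Qed.

Lemma pr_W n B : measurable B -> pr (W n @^-1` B) = fine (exponential_prob 1 B).
Proof. by move=> mB; rewrite -(waiting_time_exponential net n mB). Qed.

Lemma pr_cell n L (c : {ffun 'I_d -> 'I_L.+1}) :
  pr (X n @^-1` cell_box L (fun i => c i)) = (L.+1%:R ^-1) ^+ d.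
Proof.
rewrite /prob.
have := position_uniform net n (measurable_cell_box L (fun i => c i : nat)).
rewrite /distribution /pushforward => ->.
by rewrite setIidl ?lebesgue_cell_box// ; apply: cell_box_torus => i; exact: ltn_ord.
Qed.

Lemma past_indep_X n A C : pst n A -> measurable C ->
  pr (A `&` X n @^-1` C) = pr A * pr (X n @^-1` C).
Proof.
move=> pA mC; have := past_independent pA measurableT mC.
by rewrite preimage_setT setIT pr_setT mulr1.
Qed.

Lemma past_indep_W n A B : pst n A -> measurable B ->
  pr (A `&` W n @^-1` B) = pr A * pr (W n @^-1` B).
Proof.
move=> pA mB; have := past_independent pA mB measurableT.
by rewrite preimage_setT setIT pr_setT mulr1.
Qed.

End network_events.

(** * Edges given the past *)

Section connection_bounds.
Context {R : realType} {disp : measure_display} {T : measurableType disp} {d : nat}.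
Context {W : nat -> {mfun T >-> R}} {X : nat -> {mfun T >-> d.-tuple R}}.
Context {E : nat -> nat -> {mfun T >-> bool}} {P : probability T R}.
Context {delta : R} {rho : R -> R} {beta gamma : R}.
Hypothesis net : age_based_network W X E P rho beta gamma.
Hypothesis rhoP : profile_function d delta rho.
Hypotheses (beta0 : 0 < beta) (gamma01 : 0 < gamma < 1).
Local Notation pst := (past W X E).
Local Notation pab := (past_and_birth W X E).
Local Notation age := (birth_time W).
Local Notation conn := (connection_prob W X rho beta gamma).
Local Notation pr := (prob P).
Local Notation dist j n w := (torus_dist (X n w) (X j w)).

Lemma age_gt0 n w : 0 < age n w.
Proof.
rewrite /birth_time big_ord_recr /= ltr_wpDl ?(waiting_time_gt0 net)//.
by rewrite sumr_ge0// => i _; rewrite ltW// (waiting_time_gt0 net).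
Qed.

Lemma age_mono m n w : (m <= n)%N -> age m w <= age n w.
Proof.
move=> /subnKC <-; elim: (n - m)%N => [|k IH]; first by rewrite addn0.
rewrite addnS (le_trans IH)// /birth_time [leRHS]big_ord_recr /= lerDl.
by rewrite ltW// (waiting_time_gt0 net).
Qed.

Lemma ageS n w : age n.+1 w = age n w + W n.+1 w.
Proof. by rewrite /birth_time big_ord_recr. Qed.

(** In this form the connection probability is visibly monotone in both ages. *)
Lemma connE j n w : conn j n w =
  rho (beta^-1 * (age n w `^ (1 - gamma) * age j w `^ gamma * dist j n w ^+ d)).
Proof.
rewrite /connection_prob; set t := age n w; set s := age j w; set D := _ ^+ d.
have t0 : 0 < t by exact: age_gt0.
have s0 : 0 < s by exact: age_gt0.
congr (rho (_ * _)).
rewrite powRM ?invr_ge0 ?(ltW t0) ?(ltW s0)// -(powR_inv1 (ltW s0)) -powRrM mulN1r.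
rewrite powRD ?(gt_eqF t0) ?implybT// powRr1 ?(ltW t0)// !powRN.
have := powR_gt0 gamma t0; have := powR_gt0 gamma s0; set u := s `^ _; set v := t `^ _ => u0 v0.
by field; rewrite !gt_eqF.
Qed.

Lemma conn_arg_ge0 (a b D : R) : 0 <= D -> 0 <= beta^-1 * (a `^ (1 - gamma) * b `^ gamma * D).
Proof. by move=> D0; rewrite !mulr_ge0 ?invr_ge0 ?powR_ge0 ?(ltW beta0). Qed.

Lemma dist_ge0 j n w : 0 <= dist j n w ^+ d.
Proof. by rewrite exprn_ge0// torus_dist_ge0. Qed.

Lemma conn_ge0 j n w : 0 <= conn j n w.
Proof. by rewrite connE (profile_ge0 rhoP)// conn_arg_ge0// dist_ge0. Qed.

Lemma conn_le (a b D : R) j n w : 0 <= a -> 0 <= b -> 0 <= D ->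
  a <= age n w -> b <= age j w -> D <= dist j n w ^+ d ->
  conn j n w <= rho (beta^-1 * (a `^ (1 - gamma) * b `^ gamma * D)).
Proof.
have [g0 g1] := andP gamma01.
move=> a0 b0 D0 aT bT DT; rewrite connE; apply: (profile_nonincreasing rhoP).
  exact: conn_arg_ge0.
rewrite ler_wpM2l ?invr_ge0 ?(ltW beta0)// ler_pM// ?mulr_ge0 ?powR_ge0//.
rewrite ler_pM ?powR_ge0// ge0_ler_powR ?nnegrE ?subr_ge0 ?(ltW g0) ?(ltW g1)//.
  exact: (le_trans a0).
exact: (le_trans b0).
Qed.

Lemma conn_ge (a b D : R) j n w : age n w <= a -> age j w <= b -> dist j n w ^+ d <= D ->
  rho (beta^-1 * (a `^ (1 - gamma) * b `^ gamma * D)) <= conn j n w.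
Proof.
have [g0 g1] := andP gamma01.
move=> aT bT DT; rewrite connE; apply: (profile_nonincreasing rhoP).
  exact/conn_arg_ge0/dist_ge0.
have An := ltW (age_gt0 n w); have Aj := ltW (age_gt0 j w).
rewrite ler_wpM2l ?invr_ge0 ?(ltW beta0)// ler_pM// ?mulr_ge0 ?powR_ge0 ?dist_ge0//.
rewrite ler_pM ?powR_ge0// ge0_ler_powR ?nnegrE ?subr_ge0 ?(ltW g0) ?(ltW g1)//.
  exact: (le_trans An).
exact: (le_trans Aj).
Qed.

Definition edges n (J : {set 'I_n}) : set T := [set w | forall j : 'I_n, j \in J -> E j n w].

Lemma measurable_edge j k : measurable [set w | E j k w].
Proof.
rewrite (_ : [set w | _] = E j k @^-1` [set true]); last by apply/seteqP; split.
by rewrite -[X in measurable X]setTI; exact: measurable_funP.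
Qed.

Lemma past_edges n (J : {set 'I_n}) : pst n.+1 (edges J).
Proof.
have -> : edges J = \bigcap_(j in [set j : nat | True])
    (if insub j is Some i then if i \in J then [set w | E j n w] else setT else setT).
  apply/seteqP; split => w H.
    by move=> j _; case: insubP => // i _ <-; case: ifP => // /H.
  by move=> j jJ; have := H j Logic.I; rewrite valK jJ.
apply: past_bigI => j _; case: insubP => [i jn <-|_]; last exact: pastT.
case: ifP => _; last exact: pastT.
by apply: past_E; rewrite ltn_ord /=.
Qed.

Lemma prod_conn_ge0 n (J : {set 'I_n}) w : (0 <= \prod_(j in J) (conn j n w)%:E)%E.
Proof. by rewrite prodEFin lee_fin prodr_ge0// => j _; exact: conn_ge0. Qed.

Lemma edges_le n (J : {set 'I_n}) A (c : 'I_n -> R) : pab n A ->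
  (forall w j, A w -> j \in J -> conn j n w <= c j) ->
  pr (A `&` edges J) <= (\prod_(j in J) c j) * pr A.
Proof.
move=> pA H; have mA := past_birth_measurable pA.
have mE := past_measurable (past_edges J).
rewrite -lee_fin EFinM -!prE//; last exact: measurableI.
rewrite (edges_conditional net J pA); apply: integral_le_cst => // w Aw.
rewrite prod_conn_ge0 prodEFin lee_fin; apply: ler_prod => j jJ.
by rewrite conn_ge0 H.
Qed.

(** The lower bound is only asked on [B]: typically, when the new vertex falls in a
prescribed cell. *)
Lemma edges_ge n (J : {set 'I_n}) A B (c : R) : pab n A -> measurable B -> B `<=` A ->
  0 <= c -> (forall w, B w -> c <= \prod_(j in J) conn j n w) ->
  c * pr B <= pr (A `&` edges J).
Proof.
move=> pA mB BA c0 H; have mA := past_birth_measurable pA.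
have mE := past_measurable (past_edges J).
rewrite -lee_fin EFinM -!prE//; last exact: measurableI.
rewrite (edges_conditional net J pA); apply: integral_ge_cst => // w.
  by move=> _; exact: prod_conn_ge0.
by move=> /H Hw; rewrite prodEFin lee_fin.
Qed.

End connection_bounds.

(** * Percolation marks and revealed edges *)

Section marks.
Context {R : realType} {disp : measure_display} {T : measurableType disp} {d : nat}.
Context {W : nat -> {mfun T >-> R}} {X : nat -> {mfun T >-> d.-tuple R}}.
Context {E : nat -> nat -> {mfun T >-> bool}} {P : probability T R}.
Context {p : R} {K : nat -> nat -> {mfun T >-> bool}}.
Hypothesis marks : percolation_marks W X E P p K.
Local Notation pr := (prob P).

Definition marked (S : seq (nat * nat)) : set T := [set w | all (fun e => K e.1 e.2 w) S].

Lemma measurable_mark j k : measurable [set w | K j k w].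
Proof.
rewrite (_ : [set w | _] = K j k @^-1` [set true]); last by apply/seteqP; split.
by rewrite -[X in measurable X]setTI; exact: measurable_funP.
Qed.

Lemma measurable_marked S : measurable (marked S).
Proof.
elim: S => [|e S IH].
  by rewrite (_ : marked _ = setT); [exact: measurableT|apply/seteqP; split].
rewrite (_ : marked _ = [set w | K e.1 e.2 w] `&` marked S).
  by apply: measurableI => //; exact: measurable_mark.
apply/seteqP; split => w /=; first by move=> /andP[].
by move=> [h1 h2]; apply/andP.
Qed.

Lemma pr_marked A (S : seq (nat * nat)) : <<s \bigcup_n past W X E n >> A ->
  uniq S -> all (fun e => e.1 < e.2)%N S -> pr (A `&` marked S) = p ^+ size S * pr A.
Proof.
move=> nA uS aS.
pose J : {fset option (nat * nat)} := [fset x | x in None :: map Some S]%fset.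
pose F (e : option (nat * nat)) : set T := if e is Some e' then K e'.1 e'.2 @^-1` [set true] else A.
have JP e : e \in J = (e \in None :: map Some S) by rewrite !inE.
have SP e : (Some e \in J) = (e \in S).
  by rewrite JP inE /= mem_map// => ? ? [].
have mA : measurable A.
  move: nA; apply: smallest_sub; first exact: sigma_algebra_measurable.
  by move=> B [n _]; exact: past_measurable.
have := @marks_independent _ _ _ _ _ _ _ _ _ _ marks J F.
have -> : \bigcap_(i in [set` J]) F i = A `&` marked S.
  apply/seteqP; split => w /=.
    move=> H; split; first by apply: (H None); rewrite /= JP inE.
    by apply/allP => e eS; apply: (H (Some e)); rewrite /= SP.
  move=> [Aw mw] [e|] //= eJ; apply: (allP mw); by rewrite -SP.
have -> : (\prod_(i <- J) P (F i) = (p ^+ size S)%:E * P A)%E.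
  rewrite (perm_big (None :: map Some S)) /=; last first.
    apply: uniq_perm; rewrite ?fset_uniq//= (map_inj_uniq (fun u v => @Some_inj _ u v)) uS andbT.
    by apply/negP => /mapP[].
  rewrite big_cons big_map /= muleC; congr (_ * _)%E.
  rewrite (eq_big_seq (fun=> p%:E)); last first.
    by move=> e eS; apply: (mark_bernoulli marks); have := allP aS _ eS.
  by rewrite big_const_seq count_predT; elim: (size S) => //= n ->; rewrite exprS EFinM.
move=> H; apply: EFin_inj; rewrite EFinM -!prE//; last first.
  by apply: measurableI => //; exact: measurable_marked.
apply: H => [[[j k]|]|[[j k]|]] //= eJ.
- by have := allP aS (j, k); rewrite -SP => /(_ eJ).
- exact: preimage_system.
Qed.

End marks.

Section revealed_cells.
Context {R : realType} {disp : measure_display} {T : measurableType disp} {d : nat}.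
Context {W : nat -> {mfun T >-> R}} {X : nat -> {mfun T >-> d.-tuple R}}.
Context {E : nat -> nat -> {mfun T >-> bool}} {P : probability T R}.
Context {delta : R} {rho : R -> R} {beta gamma : R}.
Hypothesis net : age_based_network W X E P rho beta gamma.
Hypothesis rhoP : profile_function d delta rho.
Hypotheses (beta0 : 0 < beta) (gamma01 : 0 < gamma < 1).
Variables (L : nat) (a : R).
Local Notation pst := (past W X E).
Local Notation age := (birth_time W).
Local Notation conn := (connection_prob W X rho beta gamma).
Local Notation pr := (prob P).
Local Notation cell := {ffun 'I_d -> 'I_L.+1}.

(** The vertices are revealed through their cells and lower bounds of their ages, which
is all that an upper bound of the connection probabilities depends on. *)
Definition revealed (c : nat -> cell) (S : seq (nat * nat)) n : set T :=
  \bigcap_(k in [set k | (k < n)%N])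
    ([set w | a * k.+1%:R <= age k w] `&` X k @^-1` cell_box L (fun i => c k i) `&`
     [set w | forall j : 'I_k, (val j, k) \in S -> E j k w]).

Lemma past_age_ge n k : (k < n)%N -> pst n [set w | a * k.+1%:R <= age k w].
Proof.
move=> kn; rewrite (_ : [set w | _] = age k @^-1` `[a * k.+1%:R, +oo[%classic).
  by apply: past_age.
by apply/seteqP; split => w /=; rewrite in_itv/= andbT.
Qed.

Lemma past_revealed c S n : pst n (revealed c S n).
Proof.
apply: past_bigI => k /= kn; apply: pastI; first apply: pastI.
- exact: past_age_ge.
- by apply: past_X => //; exact: measurable_cell_box.
rewrite (_ : [set w | _] = edges (E := E) [set j : 'I_k | (val j, k) \in S]%SET).
  by apply: past_mono kn _; exact: past_edges.
by apply/seteqP; split => w /= H j; have := H j; rewrite inE.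
Qed.

Lemma revealedS c S n : revealed c S n.+1 =
  (revealed c S n `&` [set w | a * n.+1%:R <= age n w] `&`
     X n @^-1` cell_box L (fun i => c n i)) `&`
   edges (E := E) [set j : 'I_n | (val j, n) \in S]%SET.
Proof.
apply/seteqP; split => w.
  move=> H; have [[Ha HX] HE] := H n (ltnSn n); split; [split; [split|]|] => //.
  - by move=> k /= kn; apply: H; rewrite /= ltnS ltnW.
  - by move=> j; rewrite inE; exact: HE.
move=> [[[H Ha] HX] HE] k /=; rewrite ltnS leq_eqVlt => /orP[/eqP ->|]; last exact: H.
by split => // j jS; apply: HE; rewrite inE.
Qed.

(** By induction: the cell of the vertex [n] is uniform and independent of the past, and
given both, its edges have probability at most the product of the [f j n]. *)
Lemma pr_revealed_le c S N (f : nat -> nat -> R) : uniq S ->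
  all (fun e => e.1 < e.2)%N S -> (forall j k, 0 <= f j k) ->
  (forall w j k, (j, k) \in S -> (j < k < N)%N -> revealed c [::] k.+1 w -> conn j k w <= f j k) ->
  forall n, (n <= N)%N -> pr (revealed c S n) <=
  ((L.+1%:R ^-1) ^+ d) ^+ n * \prod_(e <- S | (e.2 < n)%N) f e.1 e.2.
Proof.
move=> uS aS f0 H; elim=> [|n IH] nN.
  rewrite expr0 mul1r big_pred0// pr_le1//; exact: (past_measurable (past_revealed c S (n := 0%N))).
have mbox := measurable_cell_box L (fun i => c n i : nat) (R := R).
rewrite revealedS; set J := (X in edges X); set A := (X in X `&` edges _).
have pA : past_and_birth W X E n A.
  rewrite /A -setIA; apply: past_birthI.
    exact: (past_birth_past (past_revealed c S (n := n))).
  apply: past_birthI; last exact: past_birth_X.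
  rewrite (_ : [set w | _] = age n @^-1` `[a * n.+1%:R, +oo[%classic).
    exact: past_birth_age.
  by apply/seteqP; split => w /=; rewrite in_itv/= andbT.
have R0 w : A w -> revealed c [::] n.+1 w.
  move=> [[Hr Ha] HX] k /=; rewrite ltnS leq_eqVlt => /orP[/eqP ->|kn].
    by split.
  by have [HH _] := Hr k kn; split.
apply: le_trans (edges_le net rhoP beta0 (c := fun j : 'I_n => f j n) pA _) _.
  move=> w j Aw; rewrite inE => jS; apply: H => //; last exact: R0.
  by rewrite ltn_ord.
have -> : \prod_(j in J) f j n = \prod_(e <- S | e.2 == n) f e.1 e.2.
  rewrite -[RHS]big_filter (perm_big [seq (val j, n) | j <- enum J]) /=.
    by rewrite big_map big_enum.
  apply: uniq_perm; first exact: filter_uniq.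
    by rewrite map_inj_uniq ?enum_uniq// => j j' [] /val_inj.
  move=> [j k]; rewrite mem_filter /=; apply/andP/mapP => [[/eqP kn jS]|[j' j'J [-> ->]]].
    have jn : (j < n)%N by have := allP aS _ jS; rewrite /= kn.
    by exists (Ordinal jn); rewrite ?mem_enum ?inE /= -?kn.
  by move: j'J; rewrite mem_enum inE.
have -> : \prod_(e <- S | (e.2 < n.+1)%N) f e.1 e.2 =
    \prod_(e <- S | e.2 == n) f e.1 e.2 * \prod_(e <- S | (e.2 < n)%N) f e.1 e.2.
  rewrite (bigID (fun e : nat * nat => e.2 == n)) /=; congr (_ * _); apply: eq_bigl => e.
    by case: eqP => [->|]; rewrite ?andbF// ltnSn.
  by rewrite ltnS ltn_neqAle andbC.
set F := \prod_(e <- S | e.2 == n) _; set G := \prod_(e <- S | _) _ in IH *.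
have F0 : 0 <= F by rewrite prodr_ge0.
set q := (L.+1%:R ^-1) ^+ d in IH *.
have mR := past_measurable (past_revealed c S (n := n)).
have mX : measurable (X n @^-1` cell_box L (fun i => c n i)).
  by rewrite -[X in measurable X]setTI; exact: measurable_funP.
have AR : pr A <= pr (revealed c S n `&` X n @^-1` cell_box L (fun i => c n i)).
  apply: le_pr; [exact: past_birth_measurable pA|exact: measurableI|].
  by move=> w [[]].
rewrite (past_indep_X net (past_revealed c S (n := n)) mbox) (pr_cell net) -/q in AR.
have q0 : 0 <= q by rewrite !exprn_ge0// invr_ge0.
rewrite exprSr [leRHS]mulrCA ler_wpM2l// (le_trans AR)//.
by rewrite mulrAC ler_wpM2r// IH// ltnW.
Qed.

End revealed_cells.

(** * The number of connected pairs *)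

Section connected_pairs.
Context {R : realType} {disp : measure_display} {T : measurableType disp} {d : nat}.
Context {W : nat -> {mfun T >-> R}} {X : nat -> {mfun T >-> d.-tuple R}}.
Context {E : nat -> nat -> {mfun T >-> bool}} {P : probability T R}.
Context {delta : R} {rho : R -> R} {beta gamma : R}.
Hypothesis net : age_based_network W X E P rho beta gamma.
Hypothesis rhoP : profile_function d delta rho.
Hypotheses (beta0 : 0 < beta) (gamma01 : 0 < gamma < 1) (d0 : (0 < d)%N).
Context {p : R} {K : nat -> nat -> {mfun T >-> bool}}.
Hypothesis marks : percolation_marks W X E P p K.
Hypothesis p0 : 0 <= p.
Variables (L M : nat) (a tau del : R).
Local Notation N := M.+1.
Local Notation age := (birth_time W).
Local Notation conn := (connection_prob W X rho beta gamma).
Local Notation pr := (prob P).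
Local Notation cell := {ffun 'I_d -> 'I_L.+1}.
Local Notation D := (@cell_vol L R d).
Local Notation kernel := (pair_kernel del tau gamma D).
Local Notation nearby := (near_pair tau gamma D).
Local Notation v0 := ((2 * L.+1%:R) ^- d : R).
Hypotheses (a0 : 0 < a) (tau0 : 0 < tau) (del1 : 1 < del).
Hypothesis vN : v0 * N%:R <= tau.
Hypothesis p_kernel : forall v, 0 < v -> p * rho (beta^-1 * (a * v)) <= (tau / v) `^ del.
Implicit Types c : {ffun 'I_N -> cell}.

Definition open_edge w i j := [&& i != j, E (minn i j) (maxn i j) w & K (minn i j) (maxn i j) w].

(** Steps between near vertices are granted for free. The remaining steps of a path are
then open edges between far vertices, whose probability is at most the kernel. *)
Definition open_or_near w : rel nat := fun i j =>
  [&& (i < N)%N, (j < N)%N &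
      nearby i j (cell_of L (X i w)) (cell_of L (X j w)) || open_edge w i j].

Definition cells w : {ffun 'I_N -> cell} := [ffun i : 'I_N => cell_of L (X i w)].

Lemma at_cells w i : (i < N)%N -> at_ (cells w) i = cell_of L (X i w).
Proof. by move=> iN; rewrite /at_ ffunE inordK. Qed.

(** The steps that need an edge, with the older end first as in the network. *)
Fixpoint far_steps c (v : seq nat) : seq (nat * nat) :=
  if v is x :: t then
    if t is y :: _ then
      if nearby x y (at_ c x) (at_ c y) then far_steps c t
      else (minn x y, maxn x y) :: far_steps c t
    else [::]
  else [::].

Lemma far_stepsE c x y t : far_steps c (x :: y :: t) =
  if nearby x y (at_ c x) (at_ c y) then far_steps c (y :: t)
  else (minn x y, maxn x y) :: far_steps c (y :: t).
Proof. by []. Qed.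

Lemma mem_far_steps c v e : e \in far_steps c v -> (e.1 \in v) && (e.2 \in v).
Proof.
elim: v => [//|x [//|y t] IH]; rewrite far_stepsE.
have sub u : u \in y :: t -> u \in x :: y :: t by move=> ut; rewrite inE ut orbT.
case: ifP => _ => [/IH/andP[h1 h2]|]; first by rewrite !sub.
rewrite inE => /orP[/eqP ->|/IH/andP[h1 h2]]; last by rewrite !sub.
by case: leqP => _ /=; rewrite !inE !eqxx ?orbT.
Qed.

Lemma far_steps_uniq c v : uniq v -> uniq (far_steps c v).
Proof.
elim: v => [//|x [//|y t] IH] /andP[xt uy]; rewrite far_stepsE.
case: ifP => _; [exact: IH|rewrite cons_uniq IH// andbT].
apply/negP => /mem_far_steps/=; apply/negP; rewrite negb_and.
by case: leqP => _; rewrite xt ?orbT.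
Qed.

Lemma far_steps_lt c v : uniq v -> all (fun e => e.1 < e.2)%N (far_steps c v).
Proof.
elim: v => [//|x [//|y t] IH] /andP[xt uy]; rewrite far_stepsE.
case: ifP => _; first exact: IH.
apply/andP; split; last exact: IH.
by move: xt; rewrite inE negb_or => /andP[xy _] /=; lia.
Qed.

Lemma far_steps_far c v e : e \in far_steps c v -> ~~ nearby e.1 e.2 (at_ c e.1) (at_ c e.2).
Proof.
elim: v => [//|x [//|y t] IH]; rewrite far_stepsE.
case: ifP => nr; first exact: IH.
rewrite inE => /orP[/eqP ->|]; last exact: IH.
case: (leqP x y) => _ /=; first by rewrite nr.
by move: nr; rewrite /near_pair kscaleC cell_volC => ->.
Qed.

Let f c j k : R := rho (beta^-1 * (a * (kscale gamma j k * D (at_ c j) (at_ c k)))).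

Lemma kernel_far c i j : (i < N)%N -> (j < N)%N -> ~~ nearby i j (at_ c i) (at_ c j) ->
  p * f c i j <= kernel i j (at_ c i) (at_ c j).
Proof.
move=> iN jN; rewrite /near_pair -ltNge => far; rewrite /pair_kernel tpow_far//.
by apply: p_kernel; exact: lt_trans far.
Qed.

Lemma far_steps_kernel c v : all (ltn^~ N) v ->
  \prod_(e <- far_steps c v) (p * f c e.1 e.2) <= path_kernel kernel c v.
Proof.
elim: v => [|x [|y t] IH]; rewrite ?big_nil//= ?mulr1//.
move=> /and3P[xN yN tN]; have := IH; rewrite /= yN tN => /(_ isT) H.
have k0 : 0 <= path_kernel kernel c (y :: t).
  by apply: path_kernel_ge0 => *; exact: tpow_ge0.
case: ifP => nr.
  apply: le_trans H _; rewrite -[X in X <= _]mul1r ler_wpM2r//.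
  by rewrite /pair_kernel /tpow; move: nr; rewrite /near_pair => ->.
rewrite big_cons /=; apply: ler_pM => //.
- rewrite mulr_ge0// (profile_ge0 rhoP)// mulr_ge0 ?invr_ge0 ?(ltW beta0)//.
  by rewrite mulr_ge0 ?(ltW a0)// mulr_ge0 ?(ltW (kscale_gt0 _ _ _)) ?cell_vol_ge0.
- rewrite big_seq prodr_ge0// => e _.
  rewrite mulr_ge0// (profile_ge0 rhoP)// mulr_ge0 ?invr_ge0 ?(ltW beta0)//.
  by rewrite mulr_ge0 ?(ltW a0)// mulr_ge0 ?(ltW (kscale_gt0 _ _ _)) ?cell_vol_ge0.
- have F : ~~ nearby x y (at_ c x) (at_ c y) by rewrite nr.
  case: (leqP x y) => _ /=; first exact: kernel_far.
  rewrite /f kscaleC cell_volC; exact: kernel_far.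
Qed.

(** The cells are part of the data, so that, for fixed data, this is a conjunction of
conditions on the far steps to which [pr_revealed_le] applies. *)
Definition realised (u : seq nat * {ffun 'I_N -> cell}) : set T :=
  if no_shortcut nearby u.2 u.1 then
    revealed (W := W) (X := X) (E := E) a (at_ u.2) (far_steps u.2 u.1) N `&`
    marked (K := K) (far_steps u.2 u.1)
  else set0.

Lemma measurable_realised u : measurable (realised u).
Proof.
rewrite /realised; case: ifP => _ //; apply: measurableI; last exact: measurable_marked.
exact: (past_measurable (past_revealed a (at_ u.2) _ (n := N))).
Qed.

Lemma pr_realised_le v c : uniq v -> all (ltn^~ N) v ->
  pr (realised (v, c)) <= ((L.+1%:R ^-1) ^+ d) ^+ N *
    ((no_shortcut nearby c v)%:R * path_kernel kernel c v).
Proof.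
move=> uv vlt; rewrite /realised /=; case: ifP => sc; last first.
  by rewrite /prob measure0 mul0r mulr0.
have pR := past_revealed (W := W) (X := X) (E := E) a (at_ c) (far_steps c v) (n := N).
rewrite mul1r (pr_marked marks) ?far_steps_uniq ?far_steps_lt//; last first.
  by apply: sub_sigma_algebra; exists N.
have fge0 j k : 0 <= f c j k.
  rewrite (profile_ge0 rhoP)// mulr_ge0 ?invr_ge0 ?(ltW beta0)//.
  by rewrite mulr_ge0 ?(ltW a0)// mulr_ge0 ?(ltW (kscale_gt0 _ _ _)) ?cell_vol_ge0.
have H := @pr_revealed_le _ _ _ _ _ _ _ _ _ _ _ _ net rhoP beta0 L a (at_ c) (far_steps c v) N
  (f c) (far_steps_uniq c uv) (far_steps_lt c uv) fge0.
have {}H := H _ N (leqnn _).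
apply: le_trans (ler_wpM2l (exprn_ge0 _ p0) (H _)) _; last first.
  rewrite mulrCA ler_wpM2l ?exprn_ge0 ?invr_ge0//.
  apply: le_trans (far_steps_kernel c vlt).
  rewrite big_split /= ler_pM ?exprn_ge0 ?prodr_ge0//.
    by rewrite big_const_seq count_predT iter_mulr_1.
  rewrite big_seq_cond [leRHS]big_seq_cond; apply: le_of_eq; apply: eq_bigl => e.
  rewrite andbT; apply: andb_idr => /mem_far_steps/andP[_ e2]; exact: (allP vlt).
move=> w j k jkS /andP[jk kN] Hr; rewrite /f kscale_lt//.
have cell_at i : (i <= k)%N -> a * i.+1%:R <= age i w /\ cell_of L (X i w) = at_ c i.
  move=> ik; have [[h1 h2] _] := Hr i ik; split=> //.
  by apply/cell_boxP => //; exact: (position_torus net).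
have [aj cj] := cell_at _ (ltnW jk); have [ak ck] := cell_at _ (leqnn k).
have [g0 g1] := andP gamma01.
have -> : beta^-1 * (a * (k.+1%:R `^ (1 - gamma) * j.+1%:R `^ gamma * D (at_ c j) (at_ c k))) =
   beta^-1 * ((a * k.+1%:R) `^ (1 - gamma) * (a * j.+1%:R) `^ gamma * D (at_ c j) (at_ c k)).
  rewrite !powRM ?(ltW a0)// -[in LHS](powRr1 (ltW a0)) -[X in a `^ X](subrK gamma 1).
  by rewrite powRD ?(gt_eqF a0) ?implybT//; ring.
apply: (conn_le net rhoP) => //; rewrite ?mulr_ge0 ?(ltW a0) ?cell_vol_ge0//.
have tX i : torus (X i w) by exact: (position_torus net).
rewrite cell_volC -cj -ck; apply: cell_vol_le_dist => //.
rewrite ltnNge; apply/negP => D1.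
have := far_steps_far jkS; rewrite /near_pair /= => /negP; apply.
apply: le_trans vN; rewrite mulrC ler_pM ?cell_vol_ge0 ?(ltW (kscale_gt0 _ _ _))//.
  rewrite cell_volC -cj -ck /cell_vol -exprVn; apply: lerXn2r; rewrite ?nnegrE ?divr_ge0 ?invr_ge0 ?mulr_ge0//.
  by rewrite -[leRHS]mul1r ler_wpM2r ?invr_ge0 ?mulr_ge0// lern1.
by apply: kscale_le => //; exact: ltn_trans jk kN.
Qed.

Lemma path_below w x t : (x < N)%N -> path (open_or_near w) x t -> all (ltn^~ N) (x :: t).
Proof.
elim: t x => [|z t IH] y yN; first by move=> _; apply/andP.
rewrite [path _ _ _]/= => /andP[/and3P[_ zN _] /(IH _ zN) h].
by apply/andP; split.
Qed.

(** Non-consecutive vertices of a geodesic are not near each other, since a near pair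
would be a shortcut. *)
Lemma realised_geodesic w x s : (x < N)%N -> (forall i, (i < N)%N -> a * i.+1%:R <= age i w) ->
  path (open_or_near w) x s -> shortcut_free (open_or_near w) (x :: s) ->
  realised (x :: s, cells w) w.
Proof.
move=> xN Ha ps sf.
have sN := path_below xN ps.
have tX i : torus (X i w) by exact: (position_torus net).
have scut : no_shortcut nearby (cells w) (x :: s).
  elim: (x :: s) sf sN => [//|y t IH].
  rewrite [shortcut_free _ _]/= [no_shortcut _ _ _]/= => /andP[h1 h2] /andP[yN tN].
  rewrite IH// andbT; apply/allP => z zt; have := allP h1 _ zt.
  have zN : (z < N)%N by have := allP tN _ (mem_behead zt).
  have {}yN : (y < N)%N by exact: yN.
  rewrite /open_or_near yN zN /= negb_or /far_at !at_cells// => /andP[].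
  done.
have edge : forall t y, path (open_or_near w) y t -> all (ltn^~ N) (y :: t) ->
    forall e, e \in far_steps (cells w) (y :: t) -> E e.1 e.2 w && K e.1 e.2 w.
  elim=> [//|z t IH] y; rewrite [path _ _ _]/= => /andP[yz zt] /andP[yN0 ztN] e.
  have yN : (y < N)%N by exact: yN0.
  rewrite far_stepsE; case: ifP => nr; first exact: IH.
  rewrite inE => /orP[/eqP ->|]; last exact: IH.
  move: yz => /and3P[_ zN]; rewrite !at_cells// in nr.
  by rewrite nr /= => /and3P[_ -> ->].
rewrite /realised -[(_, _).1]/(x :: s) -[(_, _).2]/(cells w) scut; split.
  move=> k /= kN; split; first split; first exact: Ha.
    by apply/cell_boxP => //; rewrite at_cells.
  by move=> j jk; have /andP[] := edge _ _ ps sN _ jk.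
by apply/allP => e /(edge _ _ ps sN)/andP[].
Qed.

Lemma uniq_le_sum_indic (I : eqType) (r s : seq I) (A : I -> set T) w : uniq s ->
  (forall v, v \in s -> v \in r /\ A v w) -> (size s)%:R <= \sum_(v <- r) \1_(A v) w :> R.
Proof.
move=> us H; have -> : \sum_(v <- r) \1_(A v) w = (size [seq v <- r | w \in A v])%:R :> R.
  elim: r {H} => [|v r IH]; first by rewrite big_nil.
  by rewrite big_cons IH indicE /=; case: (w \in A v); rewrite -natrD.
rewrite ler_nat; apply: uniq_leq_size => // v /H[vr Avw].
by rewrite mem_filter vr andbT mem_set.
Qed.

Definition open_below w : rel nat := fun i j => [&& (i < N)%N, (j < N)%N & open_edge w i j].

Local Notation sg := ((1 - gamma) * (1 + del)).
Local Notation eps := (loss del tau (6 ^+ d)).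
Hypothesis sg1 : 1 < sg.
Hypotheses (eps_ka : 4 * eps <= (1 - gamma) / 2) (eps_sg : 4 * eps <= sg - 1).

(** Distinct ordered pairs of connected vertices have distinct geodesics, all of them
realised; so [k ^ 2 * pr B] is at most the sum of the probabilities of being
realised over all simple paths and all configurations of cells. *)
Lemma connected_pairs_bound (B : set T) (k : nat) : measurable B ->
  (forall w, B w -> (forall i, (i < N)%N -> a * i.+1%:R <= age i w) /\
    exists l : seq nat, [/\ uniq l, (k <= size l)%N, all (ltn^~ N) l &
      forall x y, x \in l -> y \in l -> exists s, path (open_below w) x s /\ last x s = y]) ->
  (k ^ 2)%:R * pr B <= 4 * (1 + gamma^-1) * N%:R `^ (1 + gamma).
Proof.
move=> mB H.
pose r := [seq (v, c) | v <- [seq v <- simple_seqs N | v != [::]],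
                        c <- enum {ffun 'I_N -> cell}].
apply: (@le_trans _ _ (\sum_(u <- r) pr (realised u))).
  apply: pr_le_sum => // [u|w Bw]; first exact: measurable_realised.
  have [Ha [l [ul kl lN conn_l]]] := H w Bw.
  have geo x y : exists s, x \in l -> y \in l -> [/\ path (open_or_near w) x s, last x s = y,
      uniq (x :: s) & shortcut_free (open_or_near w) (x :: s)].
    have [/andP[xl yl]|] := boolP ((x \in l) && (y \in l)); last first.
      by move=> h; exists [::] => xl yl; rewrite xl yl in h.
    have [s [ps ls]] := conn_l x y xl yl.
    have ps' : path (open_or_near w) x s.
      apply: sub_path ps => i j /and3P[iN jN o]; apply/and3P; split => //.
      by rewrite o orbT.
    have [s' [h1 h2 h3 h4]] := geodesic ps'.
    by exists s' => _ _; split; rewrite // h2.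
  have {}geo x := choice (geo x).
  pose g x := projT1 (geo x).
  have Hg x : forall y, x \in l -> y \in l -> [/\ path (open_or_near w) x (g x y),
      last x (g x y) = y, uniq (x :: g x y) & shortcut_free (open_or_near w) (x :: g x y)].
    exact: (projT2 (geo x)).
  pose vs := [seq (u.1 :: g u.1 u.2, cells w) | u <- [seq (x, y) | x <- l, y <- l]].
  have Hl u : u \in [seq (x, y) | x <- l, y <- l] -> u.1 \in l /\ u.2 \in l.
    by move=> /allpairsP[[x y] /= [xl yl ->]].
  apply: (@le_trans _ _ (size vs)%:R).
    by rewrite ler_nat size_map size_allpairs expnS expn1 leq_mul.
  apply: uniq_le_sum_indic.
    rewrite map_inj_in_uniq; last first.
      move=> [x y] [x' y'] /Hl[/= xl yl] /Hl[/= xl' yl'] [xx gg].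
      have [_ e1 _ _] := Hg x y xl yl; have [_ e2 _ _] := Hg x' y' xl' yl'.
      by rewrite -e1 -e2 gg xx.
    by apply: allpairs_uniq => // -[? ?] [? ?] _ _ [-> ->].
  move=> _ /mapP[[x y] /Hl[/= xl yl] ->].
  have [p1 p2 p3 p4] := Hg x y xl yl.
  have xN : (x < N)%N by exact: (allP lN).
  have R1 := realised_geodesic xN Ha p1 p4.
  split => //; apply/allpairsP; exists (x :: g x y, cells w); split => //=; last first.
    by rewrite mem_enum.
  rewrite mem_filter /=; apply: mem_simple_seqs => //.
  exact: path_below xN p1.
have Lc : 0 < L.+1%:R :> R by [].
have cardC : #|{: cell}|%:R = L.+1%:R ^+ d :> R by rewrite card_ffun !card_ord natrX.
apply: (@le_trans _ _ (((L.+1%:R ^-1) ^+ d) ^+ N *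
    \sum_(v <- simple_seqs N | v != [::]) path_sum M nearby kernel v)).
  rewrite /r big_allpairs_dep /= big_filter mulr_sumr.
  rewrite big_seq_cond [leRHS]big_seq_cond.
  apply: ler_sum => v /andP[/simple_seqsP[uv vN'] _].
  rewrite /path_sum mulr_sumr big_enum /=; apply: ler_sum => c _.
  exact: pr_realised_le.
have S := @sum_path_sum_le R _ M del tau gamma (6 ^+ d) v0 D del1 tau0 gamma01.
have d6 : 1 <= 6 ^+ d :> R by rewrite exprn_ege1// ler1n.
have v00 : 0 <= v0 by rewrite invr_ge0 exprn_ge0// mulr_ge0.
have {}S := S d6 v00 (@cell_vol_ge0 _ _ _) (@cell_gt0 _ _) (@cell_volC _ _ _)
  (@cell_vol_quasi _ _ _) (@cell_vol_ball _ _ _) vN sg1 eps_ka eps_sg.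
apply: le_trans (ler_wpM2l _ S) _; first by rewrite !exprn_ge0// invr_ge0.
rewrite natrX cardC [leLHS]mulrA -exprMn -exprMn mulVf ?gt_eqF// !expr1n mul1r.
by [].
Qed.

End connected_pairs.

(** * Measurability of the largest component *)

Section largest_component_measurable.
Context {R : realType} {disp : measure_display} {T : measurableType disp}.
Variable G : T -> graph.
Hypothesis vertexG : forall n, measurable [set w | vertex (G w) n].
Hypothesis adjG : forall j k, measurable [set w | adj (G w) j k].

Lemma measurable_path n s : measurable [set w | path (adj (G w)) n s].
Proof.
elim: s n => [|m s IH] n.
  by rewrite (_ : [set w | _] = setT); [exact: measurableT|apply/seteqP; split].
rewrite (_ : [set w | _] = [set w | adj (G w) n m] `&` [set w | path (adj (G w)) m s]).
  exact: measurableI.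
by apply/seteqP; split => w /= => [/andP|/andP].
Qed.

Lemma measurable_component n m : measurable [set w | component (G w) n m].
Proof.
have -> : [set w | component (G w) n m] =
    ([set w | vertex (G w) n] `&` [set w | vertex (G w) m]) `&`
    \bigcup_(i in [set: nat]) (if @choice.unpickle (seq nat) i is Some s then
       if last n s == m then [set w | path (adj (G w)) n s] else set0 else set0).
  apply/seteqP; split => w.
    move=> [vn vm [s [ps ls]]]; split => //; exists (@choice.pickle (seq nat) s) => //.
    by rewrite choice.pickleK ls eqxx.
  move=> [[vn vm] [i _]]; case: choice.unpickle => [s|//]; case: eqP => [ls|//] ps.
  by split => //; exists s.
have mF (o : option (seq nat)) : measurable (if o is Some s then
    if last n s == m then [set w | path (adj (G w)) n s] else set0 else set0).
  case: o => [s|]; last exact: measurable0.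
  by case: ifP => _; [exact: measurable_path|exact: measurable0].
apply: measurableI; first exact: measurableI.
apply: bigcupT_measurable => i. exact: (mF (@choice.unpickle (seq nat) i)).
Qed.

(** The size of a component is a countable sum of indicators of events, each of which is
a countable union over finite paths. *)
Lemma measurable_largest_component :
  measurable_fun setT (fun w => largest_component (G w) : \bar R).
Proof.
have -> : (fun w => largest_component (G w) : \bar R) =
    (fun w => esups (fun n => counting (component (G w) n)) 0%N).
  apply/funext => w; rewrite /largest_component /esups /sdrop; congr ereal_sup.
  by apply/seteqP; split => x [n _ <-]; exists n.
apply: (measurable_fun_esups (f := fun n w => counting (component (G w) n))) => n.
rewrite (_ : (fun w => _) = (fun w => \sum_(m <oo) \d_ m (component (G w) n))%E); last first.
  by apply/funext => w; rewrite counting_dirac.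
apply: (ge0_emeasurable_sum (P := xpredT) (h := fun m w => \d_ m (component (G w) n) : \bar R)) => // m _.
rewrite (_ : (fun w => _) = (fun w => (\1_[set w | component (G w) n m] w)%:E)); last first.
  apply/funext => w; rewrite diracE indicE.
  suff -> : (m \in component (G w) n) = (w \in [set w | component (G w) n m]) by [].
  by apply/idP/idP; rewrite !inE.
by apply/measurable_EFinP; apply: measurable_indic; exact: measurable_component.
Qed.

Lemma measurable_largest_lt (c eps : R) :
  measurable [set w | (largest_component (G w) * c%:E < eps%:E)%E].
Proof.
have mf : measurable_fun setT (fun w => largest_component (G w) * c%:E : \bar R)%E.
  by apply: emeasurable_funM; [exact: measurable_largest_component|exact: measurable_cst].
by have := emeasurable_fun_infty_o measurableT mf (eps%:E); rewrite setTI.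
Qed.

End largest_component_measurable.

(** * Ages of the vertices are not small *)

Section waiting_times.
Context {R : realType} {disp : measure_display} {T : measurableType disp} {d : nat}.
Context {W : nat -> {mfun T >-> R}} {X : nat -> {mfun T >-> d.-tuple R}}.
Context {E : nat -> nat -> {mfun T >-> bool}} {P : probability T R}.
Context {rho : R -> R} {beta gamma : R}.
Hypothesis net : age_based_network W X E P rho beta gamma.
Local Notation age := (birth_time W).
Local Notation pr := (prob P).

Lemma pr_W_le n (x : R) : 0 < x -> pr [set w | W n w <= x] = 1 - expR (- x).
Proof.
move=> x0; have -> : [set w | W n w <= x] = W n @^-1` `[0, x]%classic.
  apply/seteqP; split => w /=; rewrite in_itv/=; last by move=> /andP[].
  by rewrite (ltW (waiting_time_gt0 net _ _)).
rewrite (pr_W net)//.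
rewrite exponential_prob_itv0c//= mulN1r//.
Qed.

(** Each waiting time is independent of the past, hence of the previous ones. *)
Lemma pr_all_W (Q : pred nat) (B : set R) (th : R) : measurable B ->
  (forall n, pr (W n @^-1` B) <= th) ->
  forall n, past W X E n (\bigcap_(i in [set i | (i < n)%N && Q i]) W i @^-1` B) /\
   pr (\bigcap_(i in [set i | (i < n)%N && Q i]) W i @^-1` B) <= th ^+ (\sum_(i < n) Q i).
Proof.
move=> mB Bth n; set F := fun n => \bigcap_(i in [set i | (i < n)%N && Q i]) W i @^-1` B.
have pF k : past W X E k (F k).
  by apply: past_bigI => i /andP[ik _]; exact: past_W.
split; first exact: pF.
rewrite -/(F n); elim: n => [|n IH].
  by rewrite big_ord0 expr0 pr_le1//; exact: past_measurable (pF 0%N).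
have th0 : 0 <= th by rewrite (le_trans (pr_ge0 P (W 0%N @^-1` B))).
have -> : F n.+1 = if Q n then F n `&` W n @^-1` B else F n.
  apply/seteqP; split => w.
    move=> H; have Fn : F n w.
      by move=> i /= /andP[ilt Qi]; apply: H; rewrite /= ltnS ltnW.
    by case: ifP => Qn //; split => //; apply: H; rewrite /= ltnSn.
  case: ifP => Qn H i /= /andP[]; rewrite ltnS leq_eqVlt => /orP[/eqP ->|ilt] Qi.
  - by case: H.
  - by case: H => H _; apply: H; rewrite /= ilt.
  - by rewrite Qi in Qn.
  - by apply: H; rewrite /= ilt.
rewrite big_ord_recr /=; case: (Q n); rewrite ?addn0//.
by rewrite (past_indep_W net)// addn1 exprSr ler_pM ?pr_ge0.
Qed.

Lemma measurable_age n (B : set R) : measurable B -> measurable (age n @^-1` B).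
Proof. by move=> mB; apply: (@past_measurable _ _ _ _ W X E n.+1); exact: past_age. Qed.

(** If the age is so small, at least half of the [n + 1] waiting times are at most
[1 / 64]. Each set of that many waiting times has this property with probability
at most [8^-(n + 1)], and there are at most [2^(n + 1)] sets. *)
Lemma pr_age_small n : pr [set w | age n w < 128^-1 * n.+1%:R] <= 4^-1 ^+ n.+1.
Proof.
pose B : set R := `]-oo, 64^-1]%classic.
have Bth k : pr (W k @^-1` B) <= 64^-1.
  have -> : W k @^-1` B = [set w | W k w <= 64^-1].
    by apply/seteqP; split => w; rewrite /B /= in_itv.
  by rewrite pr_W_le// lerBlDr -lerBlDl; exact: expR_ge1Dx.
pose Q (S : {set 'I_n.+1}) : pred nat := fun i => i \in [seq val j | j <- enum S].
pose F (S : {set 'I_n.+1}) : set T := \bigcap_(i in [set i | (i < n.+1)%N && Q S i]) W i @^-1` B.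
have QS S : (\sum_(i < n.+1) Q S i)%N = #|S|.
  rewrite -sum1_card [RHS]big_mkcond; apply: eq_bigr => i _.
  by rewrite /Q mem_map ?mem_enum; [case: ifP|exact: val_inj].
pose A (S : {set 'I_n.+1}) : set T := if (n.+1 <= 2 * #|S|)%N then F S else set0.
have mB : measurable B by exact: measurable_itv.
have mA S : measurable (A S).
  rewrite /A; case: ifP => _ //.
  exact: past_measurable (pr_all_W (Q S) mB Bth n.+1).1.
have -> : [set w | age n w < 128^-1 * n.+1%:R] = age n @^-1` `]-oo, 128^-1 * n.+1%:R[%classic.
  by apply/seteqP; split => w /=; rewrite in_itv.
have H := @pr_le_sum _ _ _ P _ (enum {set 'I_n.+1}) A _ 1 ler01 mA
  (measurable_age n (measurable_itv `]-oo, 128^-1 * n.+1%:R[)).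
rewrite mul1r in H; apply: le_trans (H _) _; last first.
  apply: (@le_trans _ _ (\sum_(S <- enum {set 'I_n.+1}) (8^-1 : R) ^+ n.+1)).
    apply: ler_sum => S _; rewrite /A; case: ifP => S2; last first.
      by rewrite /prob measure0 exprn_ge0.
    apply: le_trans (pr_all_W (Q S) mB Bth n.+1).2 _; rewrite QS.
    rewrite (_ : 64^-1 = 8^-1 ^+ 2); last by rewrite exprVn; congr (_^-1); ring.
    by rewrite -exprM; apply: ler_wiXn2l => //; rewrite ?invr_ge0// invf_le1// ler1n.
  rewrite big_enum/= sumr_const -cardsT -powersetT card_powerset cardsT card_ord -[_ *+ (2 ^ _)]mulr_natl natrX.
  rewrite -exprMn; apply: lerXn2r; rewrite ?nnegrE//; lra.
move=> w /=; rewrite in_itv/= => Hw.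
pose S : {set 'I_n.+1} := [set i : 'I_n.+1 | W i w <= 64^-1]%SET.
suff AS : A S w.
  rewrite (bigD1_seq S) ?mem_enum ?enum_uniq//= indic1// lerDl sumr_ge0//.
rewrite /A; case: ifP => [_|/negbT].
  move=> i /= /andP[_ /mapP[j]]; rewrite mem_enum inE => jS ->.
  by rewrite /B /= in_itv.
rewrite -ltnNge => S2; exfalso.
have : 64^-1 * (n.+1 - #|S|)%:R <= age n w.
  rewrite /birth_time (bigID (fun i : 'I_n.+1 => i \in S)) /=.
  rewrite -[leLHS]add0r lerD//.
    by rewrite sumr_ge0// => i _; rewrite ltW// (waiting_time_gt0 net).
  have -> : (n.+1 - #|S|)%N = #|~: S|%SET by rewrite [RHS]cardsCs finset.setCK card_ord.
  rewrite -sum1_card natr_sum mulr_sumr.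
  rewrite [leLHS](eq_bigl (fun i : 'I_n.+1 => i \notin S)); last by move=> i; rewrite inE.
  by apply: ler_sum => i; rewrite inE -ltNge mulr1 => /ltW.
apply/negP; rewrite -ltNge (lt_le_trans Hw)//.
have -> : 128^-1 * n.+1%:R = 64^-1 * (n.+1%:R / 2) :> R by field.
rewrite ler_wpM2l// ler_pdivrMr// -natrM ler_nat; lia.
Qed.

Definition ages_ok N : set T := [set w | forall k, (k < N)%N -> 128^-1 * k.+1%:R <= age k w].

Lemma measurable_ages_ok N : measurable (ages_ok N).
Proof.
have -> : ages_ok N = \bigcap_(k in [set k | (k < N)%N]) (age k @^-1` `[128^-1 * k.+1%:R, +oo[%classic).
  by apply/seteqP; split => w /= H k kN; have := H k kN; rewrite /= in_itv/= andbT.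
apply: (@past_measurable _ _ _ _ W X E N).
by apply: past_bigI => k kN; exact: past_age.
Qed.

Lemma pr_ages_ok N : 2 / 3 <= pr (ages_ok N).
Proof.
have mO := measurable_ages_ok N.
have := pr_setC P mO.
suff : pr (~` ages_ok N) <= 3^-1 by lra.
have H := @pr_le_sum _ _ _ P _ (iota 0 N) (fun k => age k @^-1` `]-oo, 128^-1 * k.+1%:R[%classic)
  (~` ages_ok N) 1 ler01 (fun k => measurable_age k (measurable_itv _)) (measurableC mO).
rewrite mul1r in H; apply: le_trans (H _) _.
  move=> w nO; have [k [kN Hk]] : exists k, (k < N)%N /\ age k w < 128^-1 * k.+1%:R.
    apply: contrapT => ne; apply: nO => k kN; rewrite leNgt; apply/negP => h.
    by apply: ne; exists k.
  rewrite (bigD1_seq k) ?mem_iota ?iota_uniq//= indic1; last by rewrite /= in_itv.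
  by rewrite lerDl sumr_ge0.
apply: (@le_trans _ _ (\sum_(k <- iota 0 N) 4^-1 * (4^-1 : R) ^+ k)).
  apply: ler_sum => k _; rewrite -exprS; apply: le_trans (pr_age_small k).
  by apply: le_of_eq; congr (pr _); apply/seteqP; split => w /=; rewrite in_itv.
rewrite -mulr_sumr -[iota 0 N]/(iota 0 N) -[X in iota 0 X]subn0 -/(index_iota 0 N) big_mkord.
have := @sum_expr_le R 4^-1 N; set Sm := \sum_(_ < _) _ => HS.
have {}HS := HS ltac:(lra).
have E4 : (1 - 4^-1)^-1 = 4 / 3 :> R by field.
rewrite E4 in HS; lra.
Qed.

End waiting_times.

(** * No giant component in the subcritical regime *)

Section percolated_graph.
Context {R : realType} {disp : measure_display} {T : measurableType disp} {d : nat}.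
Context {W : nat -> {mfun T >-> R}} {X : nat -> {mfun T >-> d.-tuple R}}.
Context {E : nat -> nat -> {mfun T >-> bool}} {P : probability T R}.
Context {rho : R -> R} {beta gamma : R}.
Hypothesis net : age_based_network W X E P rho beta gamma.
Context {K : nat -> nat -> {mfun T >-> bool}}.
Local Notation age := (birth_time W).
Local Notation pr := (prob P).
Local Notation G := (percolate (network W E) K).

Lemma measurable_born t n : measurable [set w | age n w <= t].
Proof.
rewrite (_ : [set w | _] = age n @^-1` `]-oo, t]%classic).
  by apply: (@measurable_age _ _ _ _ _ X E).
by apply/seteqP; split => w /=; rewrite in_itv.
Qed.

Lemma measurable_large_component t (c eps : R) :
  measurable [set w | (largest_component (G t w) * c%:E < eps%:E)%E].
Proof.
apply: measurable_largest_lt => [n|j k]; first exact: measurable_born.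
rewrite (_ : [set w | _] = [set w | age j w <= t] `&` [set w | age k w <= t] `&`
   (if j != k then [set w | E (minn j k) (maxn j k) w] `&` [set w | K (minn j k) (maxn j k) w] else set0)).
  apply: measurableI; first by apply: measurableI; exact: measurable_born.
  by case: ifP => _ //; apply: measurableI; [exact: measurable_edge|exact: measurable_mark].
apply/seteqP; split => w /=; first by move=> /andP[/and4P[h1 h2 h3 h4] h5]; rewrite h3.
move=> [[h1 h2]]; case: ifP => [h3 [h4 h5]|//].
by apply/andP; split; [apply/and4P; split|].
Qed.

Lemma adj_sym t w : symmetric (adj (G t w)).
Proof.
by move=> i j /=; rewrite minnC maxnC eq_sym andbCA.
Qed.

Lemma component_path t w n x y : component (G t w) n x -> component (G t w) n y ->
  exists s, path (adj (G t w)) x s /\ last x s = y.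
Proof.
move=> [_ _ [s1 [p1 <-]]] [_ _ [s2 [p2 <-]]].
exists (rev (belast n s1) ++ s2).
have l1 : last (last n s1) (rev (belast n s1)) = n.
  by case: s1 {p1} => [//|z s] /=; rewrite rev_cons last_rcons.
rewrite cat_path last_cat l1 p2 andbT; split => //.
by rewrite rev_path; rewrite (eq_path (e' := adj (G t w))) // => u v; rewrite adj_sym.
Qed.

End percolated_graph.

Lemma counting_size (R : realType) (A : set nat) N : A `<=` `I_N ->
  exists l : seq nat, [/\ uniq l, (forall i, i \in l <-> A i) &
    counting A = (size l)%:R%:E :> \bar R].
Proof.
move=> AN; have fA : finite_set A by apply: sub_finite_set AN _; exact: finite_II.
exists (fset_set A); split; first exact: fset_uniq.
  by move=> i; rewrite in_fset_set// inE.
by rewrite /counting asboolT.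
Qed.

Section subcritical.
Context {R : realType} {disp : measure_display} {T : measurableType disp} {d : nat}.
Context {W : nat -> {mfun T >-> R}} {X : nat -> {mfun T >-> d.-tuple R}}.
Context {E : nat -> nat -> {mfun T >-> bool}} {P : probability T R}.
Context {delta : R} {rho : R -> R} {beta gamma : R}.
Hypothesis net : age_based_network W X E P rho beta gamma.
Hypothesis rhoP : profile_function d delta rho.
Hypotheses (beta0 : 0 < beta) (gamma01 : 0 < gamma < 1) (d0 : (0 < d)%N).
Hypotheses (delta1 : 1 < delta) (subcritical : gamma < delta / (delta + 1)).
Local Notation age := (birth_time W).
Local Notation pr := (prob P).

(** By subcriticality there is [del < delta] with [(1 - gamma) * (1 + del) > 1]. Then
[tau] is taken small to make the loss small, and [p] small, according to the upper
Potter bound, to have the long edges dominated by the kernel. *)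
Lemma subcritical_constants : exists del tau p : R,
  [/\ 1 < del, 1 < (1 - gamma) * (1 + del), 0 < tau,
   4 * loss del tau (6 ^+ d) <= (1 - gamma) / 2 &
   4 * loss del tau (6 ^+ d) <= (1 - gamma) * (1 + del) - 1] /\
  [/\ 0 < p, p <= 1 & forall v, 0 < v -> p * rho (beta^-1 * (128^-1 * v)) <= (tau / v) `^ del].
Proof.
have [g0 g1] := andP gamma01.
have gd : gamma / (1 - gamma) < delta.
  rewrite ltr_pdivrMr ?subr_gt0//; move: subcritical.
  have dp : 0 < delta + 1 by move: delta1; lra.
  rewrite ltr_pdivlMr// => h; lra.
pose m := Num.max 1 (gamma / (1 - gamma)); pose del := (m + delta) / 2.
have md : m < delta by rewrite gt_max delta1.
have m1 : 1 <= m by rewrite le_max lexx.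
have mg : gamma / (1 - gamma) <= m by rewrite le_max lexx orbT.
have del1 : 1 < del by rewrite /del; lra.
have deld : del < delta by rewrite /del; lra.
have mdel : m < del by rewrite /del; lra.
have sg1 : 1 < (1 - gamma) * (1 + del).
  have := le_lt_trans mg mdel; rewrite ltr_pdivrMr ?subr_gt0//; lra.
have d6 : 1 <= 6 ^+ d :> R by rewrite exprn_ege1// ler1n.
pose l1 := 2 * ball_const del (6 ^+ d) * (6 ^+ d) `^ del.
have l10 : 0 < l1.
  have bc0 := lt_le_trans ltr01 (ball_const_ge1 del1 d6).
  have pd0 : 0 < (6 ^+ d) `^ del :> R by rewrite powR_gt0// exprn_gt0.
  by rewrite /l1; apply: mulr_gt0 pd0; apply: mulr_gt0 bc0.
pose mn := Num.min ((1 - gamma) / 2) ((1 - gamma) * (1 + del) - 1).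
have mn0 : 0 < mn by rewrite lt_min; apply/andP; split; lra.
pose tau := mn / (4 * l1).
have tau0 : 0 < tau by rewrite divr_gt0// mulr_gt0.
have lossE : 4 * loss del tau (6 ^+ d) = mn.
  by rewrite /loss -/l1 /tau; field; rewrite gt_eqF.
have hd : 0 < del < delta by rewrite deld (lt_trans _ del1).
have [C C0 HC] := profile_upper_bound rhoP hd.
pose b := beta^-1 * 128^-1; have b0 : 0 < b by rewrite mulr_gt0 ?invr_gt0.
pose p := Num.min 1 (tau `^ del * b `^ del / C).
exists del, tau, p; rewrite lossE; split; split => //.
- by rewrite ge_min lexx.
- by rewrite ge_min lexx orbT.
- by rewrite lt_min ltr01 divr_gt0// mulr_gt0// powR_gt0.
- by rewrite ge_min lexx.
move=> v v0; rewrite mulrA -/b.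
have bv : 0 < b * v by rewrite mulr_gt0.
apply: (@le_trans _ _ ((tau `^ del * b `^ del / C) * (C * (b * v) `^ (- del)))).
  rewrite ler_pM ?HC//; last by rewrite ge_min lexx orbT.
    by rewrite le_min ler01 divr_ge0 ?mulr_ge0 ?powR_ge0 ?(ltW C0).
  by rewrite (profile_ge0 rhoP)// ltW.
have vi0 : 0 <= v^-1 by rewrite invr_ge0 ltW.
apply: le_of_eq; rewrite powRN (@powRM _ b v del (ltW b0) (ltW v0)) (@powRM _ tau v^-1 del (ltW tau0) vi0).
rewrite -[in RHS](powR_inv1 (ltW v0)) -powRrM mulN1r powRN.
have := powR_gt0 del b0; have := powR_gt0 del v0.
move: (b `^ del) (v `^ del) => x y y0 x0; field.
by rewrite ?(gt_eqF C0) ?(gt_eqF x0) ?(gt_eqF y0).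
Qed.

Context {p : R} {K : nat -> nat -> {mfun T >-> bool}}.
Hypothesis marks : percolation_marks W X E P p K.
Variables (del tau : R).
Local Notation sg := ((1 - gamma) * (1 + del)).
Local Notation eta := (loss del tau (6 ^+ d)).
Hypotheses (p0 : 0 <= p) (tau0 : 0 < tau) (del1 : 1 < del) (sg1 : 1 < sg).
Hypotheses (eta_ka : 4 * eta <= (1 - gamma) / 2) (eta_sg : 4 * eta <= sg - 1).
Hypothesis p_kernel : forall v, 0 < v -> p * rho (beta^-1 * (128^-1 * v)) <= (tau / v) `^ del.
Local Notation G := (percolate (network W E) K).

(** A component with more than [x * t / 2] vertices gives [(x * t / 2) ^ 2] connected
pairs among the first [M + 1] vertices, which contain all those born by time [t]. *)
Lemma pr_large_component_le (M k : nat) (t x : R) : 0 < t -> 0 < x ->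
  t < 128^-1 * M.+1%:R -> k%:R <= x * t / 2 ->
  (k ^ 2)%:R * pr (ages_ok (W := W) M.+2 `&` ~` [set w | (largest_component (G t w) * (t^-1)%:E < x%:E)%E]) <=
  4 * (1 + gamma^-1) * M.+1%:R `^ (1 + gamma).
Proof.
move=> t0 x0 tM kx.
(* the mesh is so fine that equal and adjacent cells are always near *)
pose L := Num.truncn (M.+1%:R / tau).
have vN : (2 * L.+1%:R) ^- d * M.+1%:R <= tau.
  have L0 : 0 < L.+1%:R :> R by [].
  rewrite mulrC ler_pdivrMr ?exprn_gt0 ?mulr_gt0// mulrC -ler_pdivrMr//.
  apply: (@le_trans _ _ L.+1%:R); first by rewrite ltW// truncnS_gt.
  apply: (@le_trans _ _ (2 * L.+1%:R)); first by rewrite ler_peMl// ler1n.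
  by apply: ler_eXnr => //; rewrite -natrM ler1n muln_gt0.
apply: (connected_pairs_bound net rhoP beta0 gamma01 d0 marks p0 _ tau0 del1 vN p_kernel sg1 eta_ka eta_sg).
- by rewrite invr_gt0.
- apply: measurableI; first exact: (@measurable_ages_ok _ _ _ _ W X E).
  by apply: measurableC; exact: (measurable_large_component (X := X)).
move=> w [ok /= nS]; split; first by move=> i iM; apply: ok; rewrite ltnS ltnW.
have born i : age i w <= t -> (i < M.+1)%N.
  move=> it; rewrite ltnNge; apply/negP => Mi.
  have := ok _ (ltnSn _); have := age_mono net w Mi => h1 h2.
  have : 128^-1 * M.+2%:R <= t :> R by rewrite (le_trans h2)// (le_trans h1).
  have : 128^-1 * M.+1%:R <= 128^-1 * M.+2%:R :> R by rewrite ler_wpM2l// ler_nat.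
  lra.
have [n Hn] : exists n, ((x * t / 2)%:E <= counting (component (G t w) n) :> \bar R)%E.
  apply: contrapT => ne; apply: nS.
  have : (largest_component (G t w) <= (x * t / 2)%:E :> \bar R)%E.
    apply: ge_ereal_sup => _ [n _ <-]; rewrite leNgt; apply/negP => h.
    by apply: ne; exists n; exact: ltW.
  move=> h; apply: (@le_lt_trans _ _ ((x * t / 2)%:E * (t^-1)%:E)%E).
    by rewrite lee_wpmul2r// lee_fin invr_ge0 ltW.
  rewrite -EFinM lte_fin ltr_pdivrMr// ltr_pdivrMr// mulrC ltr_pMr ?mulr_gt0//; lra.
have [l [ul lP cl]] := @counting_size R (component (G t w) n) M.+1 (fun i H => born i (let: And3 _ h _ := H in h)).
exists l; split => //.
- by move: Hn; rewrite cl lee_fin => Hn; rewrite -(ler_nat R) (le_trans kx).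
- by apply/allP => i /lP[_ h _]; exact: born.
move=> y z /lP cy /lP cz; have [s [ps ls]] := component_path cy cz; exists s; split => //.
apply: sub_path ps => i j /andP[/and4P[h1 h2 h3 h4] h5].
by apply/and3P; split; [exact: born|exact: born|apply/and3P; split].
Qed.

(** The bound of order [t^(1 + gamma)] for the number of connected pairs is negligible
compared to [t^2]. *)
Lemma pr_small_component (x : R) : 0 < x -> exists t0, forall t, t0 <= t ->
  4^-1 <= pr [set w | (largest_component (G t w) * (t^-1)%:E < x%:E)%E].
Proof.
move=> x0; have [g0 g1] := andP gamma01.
pose C := 16 * (4 * (1 + gamma^-1) * 129 `^ (1 + gamma)) / x ^+ 2.
have C0 : 0 < C.
  by rewrite divr_gt0 ?exprn_gt0// !mulr_gt0 ?powR_gt0// addr_gt0// invr_gt0.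
exists (Num.max 1 (Num.max (4 / x) ((4 * C) `^ (1 - gamma)^-1))) => t.
rewrite !ge_max => /and3P[t1 tx tC].
have t0 : 0 < t by exact: lt_le_trans t1.
pose M := Num.truncn (128 * t); pose k := Num.truncn (x * t / 2).
have tM : t < 128^-1 * M.+1%:R.
  by rewrite -ltr_pdivrMl ?invr_gt0// invrK truncnS_gt.
have xt0 : 0 <= x * t / 2 by rewrite divr_ge0// mulr_ge0 ?ltW.
have kx : k%:R <= x * t / 2 by rewrite truncn_le.
have := pr_large_component_le t0 x0 tM kx.
set S := [set w | _]; set B := _ `&` ~` S => HB.
have k4 : x * t / 4 <= k%:R.
  have := truncnS_gt (x * t / 2); rewrite -/k -[k.+1%:R]natr1.
  have : 4 <= t * x by rewrite -ler_pdivrMr.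
  by rewrite (mulrC t); lra.
have M129 : M.+1%:R <= 129 * t.
  have : M%:R <= 128 * t by rewrite truncn_le mulr_ge0// ltW.
  rewrite -[M.+1%:R]natr1; lra.
have PB : pr B <= 4^-1.
  have xt : 0 < (x * t / 4) ^+ 2 by rewrite exprn_gt0// divr_gt0// mulr_gt0.
  have H1 : (x * t / 4) ^+ 2 * pr B <= 4 * (1 + gamma^-1) * (129 * t) `^ (1 + gamma).
    apply: (@le_trans _ _ ((k ^ 2)%:R * pr B)).
      by rewrite ler_wpM2r ?pr_ge0// natrX; apply: lerXn2r; rewrite ?nnegrE// divr_ge0// mulr_ge0 ?ltW.
    apply: le_trans HB _; rewrite ler_wpM2l//.
      by rewrite mulr_ge0// addr_ge0// invr_ge0 ltW.
    by rewrite ge0_ler_powR ?nnegrE ?addr_ge0 ?(ltW g0) ?mulr_ge0 ?(ltW t0).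
  rewrite -(ler_pM2l xt) (le_trans H1)//.
  have H2 : 4 * C <= t `^ (1 - gamma).
    have -> : 4 * C = ((4 * C) `^ (1 - gamma)^-1) `^ (1 - gamma).
      by rewrite -powRrM mulVf ?powRr1 ?gt_eqF ?subr_gt0// mulr_ge0 ?ltW.
    by rewrite ge0_ler_powR ?nnegrE ?powR_ge0 ?subr_ge0 ?(ltW g1) ?(ltW t0).
  rewrite powRM ?(ltW t0)//.
  have t2 : t `^ (1 + gamma) * t `^ (1 - gamma) = t ^+ 2.
    rewrite -powRD ?(gt_eqF t0) ?implybT//.
    by rewrite (_ : 1 + gamma + (1 - gamma) = 2%:R) ?powR_mulrn ?(ltW t0)//; lra.
  have -> : (x * t / 4) ^+ 2 * 4^-1 = x ^+ 2 * t ^+ 2 / 64 by field.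
  have CE : 16 * (4 * (1 + gamma^-1) * 129 `^ (1 + gamma)) = C * x ^+ 2.
    by rewrite /C divfK// gt_eqF// exprn_gt0.
  rewrite -t2; set u := t `^ (1 + gamma) in t2 *; set v := t `^ (1 - gamma) in H2 t2 *.
  have u0 : 0 < u by rewrite powR_gt0.
  have -> : 4 * (1 + gamma^-1) * (129 `^ (1 + gamma) * u) = (x ^+ 2 * u) * (4 * C) / 64.
    have -> : 4 * (1 + gamma^-1) * (129 `^ (1 + gamma) * u) =
      16 * (4 * (1 + gamma^-1) * 129 `^ (1 + gamma)) * u / 16 by field; rewrite gt_eqF.
    by rewrite CE; field.
  rewrite ler_wpM2r// mulrA ler_wpM2l// mulr_ge0 ?(ltW u0)// sqr_ge0//.
have mS : measurable S by exact: (measurable_large_component (X := X)).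
have mO := @measurable_ages_ok _ _ _ _ W X E M.+2.
have H := pr_ages_ok net M.+2; rewrite (pr_split P mO mS) in H.
have : pr (ages_ok (W := W) M.+2 `&` S) <= pr S.
  by apply: le_pr => //; exact: measurableI.
rewrite -/B in H; lra.
Qed.

Lemma not_giant_component : ~ giant_component P (percolate (network W E) K).
Proof.
rewrite /giant_component => H.
have N4 : nbhs (0%E : \bar R) [set y | (y < 4^-1%:E)%E].
  by apply: open_nbhs_nbhs; split; [exact: open_ereal_lt_ereal|rewrite /= lte_fin].
have [e /= e0 He] := H _ N4.
have e20 : 0 < e / 2 by rewrite divr_gt0.
have := He (e / 2); rewrite /ball /= sub0r normrN gtr0_norm// => /(_ _ e20).
rewrite ltr_pdivrMr// ltr_pMr// ltr1n => /(_ isT).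
apply/negP; rewrite -leNgt; apply: le_ereal_inf_tmp => _ [A [t1 [_ At1]] <-].
have [t0 Ht0] := pr_small_component e20.
pose t := Num.max t0 t1 + 1.
apply: (@le_trans _ _ (P [set w | (largest_component (G t w) * (t^-1)%:E < (e / 2)%:E)%E])).
  rewrite prE; last exact: (measurable_large_component (X := X)).
  rewrite lee_fin; apply: Ht0; rewrite /t; apply: (@le_trans _ _ (Num.max t0 t1)).
    by rewrite le_max lexx.
  by rewrite lerDl.
apply: ereal_sup_ubound; exists t => //; apply: At1.
by rewrite /t ltr_pwDr// le_max lexx orbT.
Qed.

End subcritical.

(** * Ages of the vertices are not large *)

Section age_tail.
Context {R : realType} {disp : measure_display} {T : measurableType disp} {d : nat}.
Context {W : nat -> {mfun T >-> R}} {X : nat -> {mfun T >-> d.-tuple R}}.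
Context {E : nat -> nat -> {mfun T >-> bool}} {P : probability T R}.
Context {rho : R -> R} {beta gamma : R}.
Hypothesis net : age_based_network W X E P rho beta gamma.
Local Notation age := (birth_time W).
Local Notation pr := (prob P).

Lemma measurable_W_gt n (x : R) : measurable [set w | x < W n w].
Proof.
rewrite (_ : [set w | _] = W n @^-1` `]x, +oo[%classic).
  by rewrite -[X in measurable X]setTI; exact: measurable_funP.
by apply/seteqP; split => w /=; rewrite in_itv/= andbT.
Qed.

Lemma pr_W_gt n (x : R) : 0 <= x -> pr [set w | x < W n w] <= expR (- x).
Proof.
rewrite le_eqVlt => /orP[/eqP <-|x0].
  by rewrite oppr0 expR0 pr_le1//; exact: measurable_W_gt.
have -> : [set w | x < W n w] = ~` [set w | W n w <= x].
  by apply/seteqP; split => w /=; rewrite ltNge => /negP.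
rewrite pr_setC; last first.
  rewrite (_ : [set w | _] = ~` [set w | x < W n w]); last first.
    by apply/seteqP; split => w /=; rewrite leNgt => /negP.
  by apply: measurableC; exact: measurable_W_gt.
by rewrite (pr_W_le net)// opprB addrC subrK.
Qed.

Lemma measurable_age_gt n (x : R) : measurable [set w | x < age n w].
Proof.
rewrite (_ : [set w | _] = ~` [set w | age n w <= x]).
  by apply: measurableC; exact: (measurable_born (X := X) (E := E)).
by apply/seteqP; split => w /=; rewrite ltNge => /negP.
Qed.

(** Markov's inequality, with each waiting time [W] bounded by the number of integers
[i] such that [i < W]. The count is cut at a level [I], and the event [I < W], of
probability at most [exp (- I)], is charged with the weight [x]; then [I] is taken
large. *)
Lemma pr_age_gt n (x : R) : 0 < x -> pr [set w | x < age n w] <= 2 * n.+1%:R / x.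
Proof.
move=> x0.
have main I : x * pr [set w | x < age n w] <= 2 * n.+1%:R + x * n.+1%:R * expR (- I%:R).
  (* the layers [i < W k], the last one with the weight [x] *)
  pose r := [seq (k, i) | k <- index_iota 0 n.+1, i <- index_iota 0 I.+1].
  pose A (u : nat * nat) := [set w | u.2%:R < W u.1 w].
  pose c (u : nat * nat) : R := if (u.2 < I)%N then 1 else x.
  have c0 u : 0 <= c u by rewrite /c; case: ifP => // _; exact: ltW.
  have := @pr_sum_le _ _ _ P _ _ [:: tt] r (fun=> x) c (fun=> [set w | x < age n w]) A
    (fun=> ltW x0) c0 (fun=> measurable_age_gt n x) (fun u => measurable_W_gt u.1 u.2%:R).
  rewrite big_seq1 => H; apply: le_trans (H _) _.
    move=> w; rewrite big_seq1 /r big_allpairs_dep.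
    have rec k : \sum_(i <- index_iota 0 I.+1) c (k, i) * \1_(A (k, i)) w =
        \sum_(i < I) \1_(A (k, i : nat)) w + x * \1_(A (k, I)) w.
      rewrite big_mkord big_ord_recr /= /c ltnn.
      by congr (_ + _); apply: eq_bigr => i _; rewrite /= ltn_ord mul1r.
    under eq_bigr do rewrite rec.
    have S0 k : 0 <= \sum_(i < I) (\1_(A (k, i : nat)) w : R) by apply: sumr_ge0.
    have [/= ageW|nage] := boolP (w \in [set w | x < age n w]); last first.
      by rewrite indicE (negPf nage) mulr0 sumr_ge0// => k _; rewrite addr_ge0// mulr_ge0 ?(ltW x0).
    rewrite indicE ageW mulr1.
    have [/existsP[k Ik]|/existsPn noI] := boolP [exists k : 'I_n.+1, I%:R < W k w].
      rewrite big_mkord (bigD1 k)//= indic1// mulr1.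
      rewrite [X in _ <= X + _]addrC -addrA lerDl addr_ge0// sumr_ge0// => i _.
      by rewrite addr_ge0// mulr_ge0 ?(ltW x0).
    move: ageW; rewrite inE /= => /ltW/le_trans; apply.
    rewrite /birth_time big_mkord.
    apply: ler_sum => k _; rewrite -[leLHS]addr0 lerD//; last by rewrite mulr_ge0 ?(ltW x0).
    have := noI k; rewrite -leNgt.
    have Wk0 : 0 < W k w by exact: (waiting_time_gt0 net).
    elim: I {H rec S0 noI c c0 r} => [|I IH] WI.
      by move: Wk0; rewrite ltNge WI.
    rewrite big_ord_recr /=; have [/IH h|h] := leP (W k w) I%:R.
      by rewrite (le_trans h)// lerDl.
    rewrite [X in _ + X]indic1//.
    have -> : \sum_(i < I) \1_(A (k : nat, i : nat)) w = I%:R :> R.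
      rewrite (eq_bigr (fun=> 1)) ?sumr_const ?card_ord// => i _.
      have Aw : A (k : nat, i : nat) w by rewrite /A /= (le_lt_trans _ h)// ler_nat ltnW.
      by rewrite indic1.
    by rewrite natr1.
  rewrite /r big_allpairs_dep.
  apply: (@le_trans _ _ (\sum_(k <- index_iota 0 n.+1) (2 + x * expR (- I%:R)))); last first.
    by rewrite big_const_seq count_predT size_iota subn0 iter_addr_0 -[leLHS]mulr_natr; apply: le_of_eq; ring.
  apply: ler_sum => k _.
  rewrite big_mkord big_ord_recr /= {2}/c ltnn.
  apply: lerD; last by rewrite ler_wpM2l ?(ltW x0)// pr_W_gt.
  apply: (@le_trans _ _ (\sum_(i < I) (2^-1 : R) ^+ i)); last first.
    by apply: le_trans (sum_expr_le I _) _; [lra|apply: le_of_eq; field].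
  apply: ler_sum => i _; rewrite /c /= ltn_ord mul1r.
  apply: le_trans (pr_W_gt _ _) _ => //.
  rewrite -mulrN1 expRM_natl; apply: lerXn2r; rewrite ?nnegrE ?expR_ge0//.
  rewrite expRN lef_pV2 ?posrE ?expR_gt0//.
  by apply: le_trans (expR_ge1Dx _); lra.
rewrite ler_pdivlMr// mulrC leNgt; apply/negP => lt2.
pose g := x * pr [set w | x < age n w] - 2 * n.+1%:R.
have g0 : 0 < g by rewrite subr_gt0.
pose I := Num.truncn (x * n.+1%:R / g).
have := main I; rewrite -lerBlDl -/g; apply/negP; rewrite -ltNge.
have HI : x * n.+1%:R / g < 1 + I%:R by rewrite addrC natr1 truncnS_gt.
have eI : 1 + I%:R <= expR I%:R :> R by rewrite expR_ge1Dx.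
rewrite expRN ltr_pdivrMr ?expR_gt0// [g * _]mulrC -ltr_pdivrMr//.
exact: lt_le_trans HI eI.
Qed.

End age_tail.

(** * Connectors of two old vertices *)

Section no_connector.
Context {R : realType} {disp : measure_display} {T : measurableType disp} {d : nat}.
Context {W : nat -> {mfun T >-> R}} {X : nat -> {mfun T >-> d.-tuple R}}.
Context {E : nat -> nat -> {mfun T >-> bool}} {P : probability T R}.
Context {delta : R} {rho : R -> R} {beta gamma : R}.
Hypothesis net : age_based_network W X E P rho beta gamma.
Hypothesis rhoP : profile_function d delta rho.
Hypotheses (beta0 : 0 < beta) (gamma01 : 0 < gamma < 1).
Local Notation pst := (past W X E).
Local Notation age := (birth_time W).
Local Notation conn := (connection_prob W X rho beta gamma).
Local Notation pr := (prob P).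

Definition joins (j j' k : nat) : set T := [set w | E j k w] `&` [set w | E j' k w].

Lemma past_joins j j' k n : (j < k < n)%N -> (j' < k < n)%N -> pst n (joins j j' k).
Proof. by move=> jk j'k; apply: pastI; exact: past_E. Qed.

Variables (j j' s0 : nat) (F : set T) (t q2 : R) (C : set (d.-tuple R)).
Hypotheses (js : (j < s0)%N) (js' : (j' < s0)%N) (jj' : j != j').
Hypotheses (pF : pst s0 F) (Fage : F `<=` [set w | age s0.-1 w <= t]).
Hypotheses (mC : measurable C) (q20 : 0 <= q2).
Hypothesis joinsP : forall n w, (s0 <= n)%N -> F w -> age n w <= 2 * t -> C (X n w) ->
  q2 <= conn j n w * conn j' n w.

(** The bound on the ages is carried along, since it keeps the connection probabilities
from being small; only the vertices in [Q] are required not to be connectors. *)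
Definition not_joined (Q : pred nat) n : set T :=
  F `&` \bigcap_(k in [set k | (s0 <= k < n)%N])
    ([set w | age k w <= t] `&` (if Q k then ~` joins j j' k else setT)).

Lemma past_not_joined Q n : (s0 <= n)%N -> pst n (not_joined Q n).
Proof.
move=> sn; apply: pastI; first exact: (past_mono sn pF).
apply: past_bigI => k /andP[sk kn]; apply: pastI.
  rewrite (_ : [set w | _] = age k @^-1` `]-oo, t]%classic); first exact: past_age.
  by apply/seteqP; split => w /=; rewrite in_itv.
case: ifP => _; last exact: pastT.
by apply: pastC; apply: past_joins; rewrite ?kn (leq_trans _ sk).
Qed.

(** Given the past, the vertex [n] falls in [C] with probability [kap], and then has both
edges with conditional probability at least [q2]. *)
Lemma pr_not_joined_le (Q : pred nat) (kap : R) n : (s0 <= n)%N -> 0 <= kap -> 0 <= 1 - kap * q2 ->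
  (forall k, pr (X k @^-1` C) = kap) ->
  pr (not_joined Q n) <= (1 - kap * q2) ^+ (\sum_(s0 <= k < n) Q k) * pr F.
Proof.
move=> sn kap0 q1 Ckap; rewrite -(subnKC sn); elim: (n - s0)%N => [|i IH].
  rewrite addn0 big_geq// expr0 mul1r; apply: le_pr; last by move=> w [].
    exact: past_measurable (past_not_joined Q (leqnn _)).
  exact: past_measurable pF.
rewrite addnS; set m := (s0 + i)%N in IH *.
have sm : (s0 <= m)%N by exact: leq_addr.
have pD := past_not_joined Q sm; have mD := past_measurable pD.
have pD1 := past_not_joined Q (leqW sm); have mD1 := past_measurable pD1.
set D := not_joined Q m in IH pD mD *.
have mW : measurable (`]-oo, t]%classic : set R) by exact: measurable_itv.
have sub w : not_joined Q m.+1 w -> D w /\ age m w <= t /\ (Q m -> ~ joins j j' m w).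
  have Hm : (s0 <= m < m.+1)%N by rewrite sm ltnSn.
  move=> [Fw H]; split; [|split].
  - by split => // k /andP[sk km]; apply: H; rewrite /= sk ltnS ltnW.
  - by have [] := H m Hm.
  - by have [_ +] := H m Hm => + Qm; rewrite Qm.
rewrite big_nat_recr//=; case Qm: (Q m); last first.
  rewrite addn0; apply: le_trans IH; apply: le_pr => // w /sub[]//.
rewrite addn1 exprS -mulrA.
have D0 : 0 <= pr D by exact: pr_ge0.
apply: (@le_trans _ _ ((1 - kap * q2) * pr D)); last by rewrite ler_wpM2l.
pose A := D `&` W m @^-1` `]-oo, t]%classic.
have pA : past_and_birth W X E m A.
  by apply: past_birthI; [exact: past_birth_past|exact: past_birth_W].
have mA := past_birth_measurable pA.
have jm : (j < m)%N by exact: leq_trans sm.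
have jm' : (j' < m)%N by exact: leq_trans sm.
pose J : {set 'I_m} := [set Ordinal jm; Ordinal jm']%SET.
have JE : edges (E := E) J = joins j j' m.
  apply/seteqP; split => w.
    by move=> H; split; [exact: (H (Ordinal jm) (set21 _ _))|exact: (H (Ordinal jm') (set22 _ _))].
  by move=> [h1 h2] l; rewrite !inE => /orP[/eqP ->|/eqP ->].
have mJ : measurable (joins j j' m).
  by rewrite -JE; exact: (past_measurable (past_edges (W := W) (X := X) J)).
pose B := A `&` X m @^-1` C.
have mX : measurable (X m @^-1` C) by rewrite -[X in measurable X]setTI; exact: measurable_funP.
have mB : measurable B by exact: measurableI.
have E1 : pr A = pr D * pr (W m @^-1` `]-oo, t]%classic) by rewrite (past_indep_W net).
have E2 : pr B = pr A * kap by rewrite /B /A (past_independent net pD mW mC) E1 Ckap.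
have ge : q2 * pr B <= pr (A `&` joins j j' m).
  rewrite -JE; apply: (edges_ge net rhoP beta0 pA mB) => // [w []//|w [[Dw Wt] Cw]].
  rewrite big_setU1 ?inE /=; last by rewrite -val_eqE.
  rewrite big_set1 /=; apply: joinsP => //; first by case: Dw.
  move: Wt; rewrite /= in_itv/= => Wt.
  have [Fw H] := Dw.
  have am : age m w = age m.-1 w + W m w.
    have m0 : (0 < m)%N by exact: (leq_ltn_trans (leq0n _) jm).
    by have := ageS (W := W) m.-1 w; rewrite (prednK m0).
  rewrite am mulrDl mul1r lerD//.
  have [sm'|ms] := ltnP s0 m; last first.
    have -> : m = s0 by apply/eqP; rewrite eqn_leq ms sm.
    exact: Fage.
  have mm : m.-1.+1 = m by rewrite prednK// (leq_ltn_trans (leq0n _) jm).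
  have Hm : (s0 <= m.-1 < m)%N by apply/andP; split; [rewrite -ltnS mm|rewrite -[X in (_ < X)%N]mm].
  by have [] := H m.-1 Hm.
have lt : pr (not_joined Q m.+1) <= pr (A `&` ~` joins j j' m).
  apply: le_pr => //; first by apply: measurableI => //; exact: measurableC.
  move=> w /sub[Dw [aw nj]]; split; last exact: nj.
  split => //; rewrite /= in_itv/=; apply: le_trans aw.
  by rewrite /birth_time big_ord_recr /= lerDr sumr_ge0// => l _; rewrite ltW// (waiting_time_gt0 net).
have split_A := pr_split P mA mJ.
have A1 : pr A <= pr D by apply: le_pr => // w [].
have A2 : (1 - kap * q2) * pr A <= (1 - kap * q2) * pr D by rewrite ler_wpM2l.
apply: le_trans lt _; apply: le_trans A2; rewrite E2 in ge; lra.
Qed.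

End no_connector.

Section thinning.
Context {R : realType} {disp : measure_display} {T : measurableType disp} {d : nat}.
Context {W : nat -> {mfun T >-> R}} {X : nat -> {mfun T >-> d.-tuple R}}.
Context {E : nat -> nat -> {mfun T >-> bool}} {P : probability T R}.
Context {p : R} {K : nat -> nat -> {mfun T >-> bool}}.
Hypothesis marks : percolation_marks W X E P p K.
Hypothesis p01 : 0 <= p <= 1.
Local Notation pr := (prob P).
Local Notation net_event := (<<s \bigcup_n past W X E n >>).
Variables j j' : nat.
Hypothesis jj' : j != j'.
Local Notation joins := (joins (E := E) j j').

Lemma net_eventI A B : net_event A -> net_event B -> net_event (A `&` B).
Proof. exact: (@measurableI _ (g_sigma_algebraType _)). Qed.

Lemma net_eventC A : net_event A -> net_event (~` A).
Proof. exact: (@measurableC _ (g_sigma_algebraType _)). Qed.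

Lemma net_event_past n A : past W X E n A -> net_event A.
Proof. by move=> pA; apply: sub_sigma_algebra; exists n. Qed.

Lemma net_event_measurable A : net_event A -> measurable A.
Proof.
move: A; apply: smallest_sub; first exact: sigma_algebra_measurable.
by move=> B [n _]; exact: past_measurable.
Qed.

Definition unlinked (ks : seq nat) : set T :=
  [set w | all (fun k => ~~ [&& E j k w, E j' k w, K j k w & K j' k w]) ks].

Definition unjoined (ks : seq nat) : set T :=
  [set w | all (fun k => ~~ (E j k w && E j' k w)) ks].

Let e k : seq (nat * nat) := [:: (j, k); (j', k)].

Lemma measurable_joins k : measurable (joins k).
Proof. by apply: measurableI; exact: measurable_edge. Qed.

Lemma unlinked_cons k ks :
  unlinked (k :: ks) = unlinked ks `&` ~` (joins k `&` marked (K := K) (e k)).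
Proof.
rewrite /unlinked; apply/seteqP; split => w.
  move=> /andP[h u]; split => // -[[h1 h2] /and3P[h3 h4 _]].
  by move/negP: h; apply; apply/and4P; split.
move=> [u h]; apply/andP; split => //; apply/negP => /and4P[h1 h2 h3 h4].
by apply: h; split; [split|apply/and3P; split].
Qed.

Lemma measurable_unlinked ks : measurable (unlinked ks).
Proof.
elim: ks => [|k ks IH].
  by rewrite (_ : unlinked _ = setT); [exact: measurableT|apply/seteqP; split].
rewrite unlinked_cons; apply: measurableI => //; apply: measurableC.
by apply: measurableI; [exact: measurable_joins|exact: measurable_marked].
Qed.

Lemma marked_cat S S' : marked (K := K) (S ++ S') = marked (K := K) S `&` marked (K := K) S'.
Proof. by apply/seteqP; split => w; rewrite /marked /= all_cat => /andP. Qed.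

(** The marks of edges towards vertices outside [ks] are independent of the network and
of the other marks. *)
Lemma pr_unlinked_marked ks A S : net_event A -> uniq S ->
  all (fun u => u.1 < u.2)%N S -> all (fun u => u.2 \notin ks) S -> uniq ks ->
  all (fun k => (j < k) && (j' < k))%N ks ->
  pr (A `&` marked (K := K) S `&` unlinked ks) = p ^+ size S * pr (A `&` unlinked ks).
Proof.
elim: ks A S => [|k ks IH] A S nA uS aS dS uks lks.
  have -> : unlinked [::] = setT by apply/seteqP; split.
  by rewrite !setIT (pr_marked marks).
move: uks lks => /= /andP[kks uks] /andP[/andP[jk j'k] lks].
have nB : net_event (A `&` joins k).
  apply: net_eventI => //; apply: (net_event_past (n := k.+1)).
  by apply: past_joins; rewrite ltnSn andbT.
have dS' : all (fun u => u.2 \notin ks) S.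
  by apply: sub_all dS => u; rewrite inE negb_or => /andP[].
have step S' : uniq S' -> all (fun u => u.1 < u.2)%N S' -> all (fun u => u.2 \notin k :: ks) S' ->
    pr (A `&` marked (K := K) S' `&` unlinked (k :: ks)) =
    p ^+ size S' * (pr (A `&` unlinked ks) - p ^+ 2 * pr (A `&` joins k `&` unlinked ks)).
  move=> uS' aS' dSk.
  have dS'' : all (fun u => u.2 \notin ks) S'.
    by apply: sub_all dSk => u; rewrite inE negb_or => /andP[].
  have mA := net_event_measurable nA; have mJ := measurable_joins k.
  have mU := measurable_unlinked ks; have mM := measurable_marked (K := K).
  have mJM : measurable (joins k `&` marked (K := K) (e k)) by exact: measurableI.
  have mAM : measurable (A `&` marked (K := K) S' `&` unlinked ks).
    by apply: measurableI => //; exact: measurableI.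
  have := pr_split P mAM mJM; rewrite -(setIA _ (unlinked ks) (~` _)) -unlinked_cons IH// => H.
  have E1 : A `&` marked (K := K) S' `&` unlinked ks `&` (joins k `&` marked (K := K) (e k)) =
     A `&` joins k `&` marked (K := K) (S' ++ e k) `&` unlinked ks.
    rewrite marked_cat; apply/seteqP; split => w; by [move=> [[[? ?] ?] [? ?]]|move=> [[[? ?] [? ?]] ?]].
  rewrite E1 IH//= in H.
  - move: H; rewrite size_cat exprD /=; lra.
  - rewrite cat_uniq uS' /= !inE xpair_eqE eqxx !andbT orbF negb_or jj' andbT.
    by apply/andP; split; apply/negP => h; have := allP dSk _ h; rewrite /= inE eqxx.
  - by rewrite all_cat aS' /= jk j'k.
  - by rewrite all_cat dS'' /= kks.
rewrite step//; have := step [::] isT isT isT.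
have -> : marked (K := K) [::] = setT by apply/seteqP; split.
by rewrite setIT expr0 mul1r => ->.
Qed.

(** A vertex [k] that joins fails to link when one of its two marks is missing. Hence
the probability of failing at [k :: ks] is the mixture, with weights [1 - p ^ 2] and
[p ^ 2], of the probability of failing at [ks] and of its restriction to the event
that [k] does not join. Iterating produces all sets [I] of vertices required not to
join, and for these the marks have disappeared. *)
Lemma pr_unlinked_le ks A (x q : R) : net_event A -> uniq ks ->
  all (fun k => (j < k) && (j' < k))%N ks ->
  (forall I, subseq I ks -> pr (A `&` unjoined I) <= x * (1 - q) ^+ size I) ->
  0 <= q <= 1 -> 0 <= x ->
  pr (A `&` unlinked ks) <= x * (1 - p ^+ 2 * q) ^+ size ks.
Proof.
move=> nA uks lks H q01 x0; have [q0 q1] := andP q01; have [p0 p1] := andP p01.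
elim: ks A x nA uks lks H x0 => [|k ks IH] A x nA uks lks H x0.
  have -> : unlinked [::] = unjoined [::] by apply/seteqP; split.
  exact: H.
have := pr_unlinked_marked (ks := k :: ks) (S := [::]) nA isT isT isT uks lks.
move: uks lks => /= /andP[kks uks] /andP[/andP[jk j'k] lks].
have nJ : net_event (joins k).
  by apply: (net_event_past (n := k.+1)); apply: past_joins; rewrite ltnSn andbT.
have nB := net_eventI nA nJ; have nC := net_eventI nA (net_eventC nJ).
have mA := net_event_measurable nA; have mJ := measurable_joins k.
have mU := measurable_unlinked ks.
have mAU : measurable (A `&` unlinked ks) by exact: measurableI.
have mJM : measurable (joins k `&` marked (K := K) (e k)).
  by apply: measurableI => //; exact: measurable_marked.
move=> _.
have S1 := pr_split P mAU mJM; rewrite -(setIA _ (unlinked ks) (~` _)) -unlinked_cons in S1.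
have E1 : A `&` unlinked ks `&` (joins k `&` marked (K := K) (e k)) =
   A `&` joins k `&` marked (K := K) (e k) `&` unlinked ks.
  by apply/seteqP; split => w; [move=> [[? ?] [? ?]]|move=> [[[? ?] ?] ?]].
have S2 := pr_split P mAU mJ.
have E2 : A `&` unlinked ks `&` joins k = A `&` joins k `&` unlinked ks by rewrite setIAC.
have E3 : A `&` unlinked ks `&` ~` joins k = A `&` ~` joins k `&` unlinked ks by rewrite setIAC.
rewrite E2 E3 in S2.
have M1 : pr (A `&` joins k `&` marked (K := K) (e k) `&` unlinked ks) =
    p ^+ 2 * pr (A `&` joins k `&` unlinked ks).
  apply: pr_unlinked_marked => //=.
  - by rewrite !inE xpair_eqE eqxx !andbT jj'.
  - by rewrite jk j'k.
  - by rewrite kks.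
have H1 : pr (A `&` unlinked ks) <= x * (1 - p ^+ 2 * q) ^+ size ks.
  apply: IH => // I sI; apply: H; apply: subseq_trans sI (subseq_cons _ _).
have H2 : pr (A `&` ~` joins k `&` unlinked ks) <= x * (1 - q) * (1 - p ^+ 2 * q) ^+ size ks.
  apply: IH => //; last by rewrite mulr_ge0// subr_ge0.
  move=> I sI; have := H (k :: I); rewrite /= eqxx sI => /(_ isT).
  rewrite exprS mulrA; apply: le_trans; apply: le_of_eq; congr (pr _).
  apply/seteqP; split => w.
    by move=> [[Aw nj] uI]; split => //; rewrite /unjoined /= uI andbT; apply/negP => /andP[? ?]; apply: nj.
  move=> [Aw]; rewrite /unjoined /= => /andP[nj uI]; split => //; split => //.
  by move=> [h1 h2]; move: nj; rewrite /= h1 h2.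
rewrite E1 M1 in S1.
rewrite exprS; set y := (1 - p ^+ 2 * q) ^+ size ks in H1 H2 *.
have p2 : 0 <= p ^+ 2 <= 1 by rewrite exprn_ge0// exprn_ile1.
have [p20 p21] := andP p2.
have : (1 - p ^+ 2) * pr (A `&` unlinked ks) <= (1 - p ^+ 2) * (x * y) by rewrite ler_wpM2l// subr_ge0.
have : p ^+ 2 * pr (A `&` ~` joins k `&` unlinked ks) <= p ^+ 2 * (x * (1 - q) * y) by rewrite ler_wpM2l.
nra.
Qed.

End thinning.

(** * Dyadic boxes and their first vertices *)

Section dyadic_boxes.
Context {R : realType} {d : nat}.
Implicit Types x y : d.-tuple R.

(** The predecessor compensates for [cell_box L], which cuts the torus in [L + 1] slices. *)
Definition dyadic a (v : 'I_d -> nat) : set (d.-tuple R) := cell_box (2 ^ a).-1 v.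

Lemma dyadicP a v x : torus x ->
  dyadic a v x <-> forall i, Num.truncn ((2 ^ a)%:R * (2^-1 - tnth x i)) = v i.
Proof. by move=> tx; rewrite /dyadic cell_box_indexP// /cell_index prednK// expn_gt0. Qed.

(** The coordinates of the boxes are the leading binary digits of the position. *)
Lemma dyadic_parent e a v x : torus x ->
  dyadic (a + e) v x -> dyadic a (fun i => v i %/ 2 ^ e)%N x.
Proof.
move=> tx; rewrite !dyadicP// => H i; rewrite -H; set y := 2^-1 - _.
have y0 : 0 <= y by rewrite subr_ge0; have /andP[] := tx i.
have e0 : (0 < 2 ^ e)%N by rewrite expn_gt0.
apply/eqP; rewrite truncn_eq ?mulr_ge0//; apply/andP; split.
  rewrite -(ler_pM2r (x := (2 ^ e)%:R)) ?ltr0n// -natrM mulrAC -natrM -expnD.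
  have /andP[h _] : _ <= _ < _ := truncn_itv (mulr_ge0 (ler0n R (2 ^ (a + e))) y0).
  by apply: le_trans h; rewrite ler_nat leq_divM.
rewrite -(ltr_pM2r (x := (2 ^ e)%:R)) ?ltr0n// -natrM mulrAC -natrM -expnD.
have h := truncnS_gt ((2 ^ (a + e))%:R * y); apply: lt_le_trans h _.
by rewrite ler_nat; exact: ltn_ceil.
Qed.

Lemma dyadic0 x : torus x -> dyadic 0 (fun=> 0%N) x.
Proof.
move=> tx; rewrite dyadicP// => i; have /andP[x1 x2] := tx i.
by apply/eqP; rewrite expn0 truncn_eq ?mul1r; [apply/andP; split; lra|lra].
Qed.

Lemma dyadic_unique a v v' x : torus x -> dyadic a v x -> dyadic a v' x -> v =1 v'.
Proof. by move=> tx; rewrite !dyadicP// => H H' i; rewrite -H -H'. Qed.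

Lemma dyadic_dist a v x y : torus x -> torus y -> dyadic a v x -> dyadic a v y ->
  torus_dist x y <= Num.sqrt d%:R / 2 ^+ a.
Proof.
move=> tx ty; rewrite /dyadic !cell_box_indexP// => xv yv.
have : cell_of (2 ^ a).-1 x = cell_of (2 ^ a).-1 y.
  by apply/ffunP => i; apply: val_inj; rewrite /= !cell_ofE// xv yv.
by move/(torus_dist_le_cell tx ty); rewrite prednK ?expn_gt0// natrX.
Qed.

Lemma measurable_dyadic a v : measurable (dyadic a v).
Proof. exact: measurable_cell_box. Qed.

End dyadic_boxes.

Section first_vertex.
Context {R : realType} {disp : measure_display} {T : measurableType disp} {d : nat}.
Context {W : nat -> {mfun T >-> R}} {X : nat -> {mfun T >-> d.-tuple R}}.
Context {E : nat -> nat -> {mfun T >-> bool}} {P : probability T R}.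
Context {rho : R -> R} {beta gamma : R}.
Hypothesis net : age_based_network W X E P rho beta gamma.
Local Notation pst := (past W X E).
Local Notation pr := (prob P).
Implicit Type B : set (d.-tuple R).

Lemma pr_dyadic n a (v : 'I_d -> nat) : (forall i, (v i < 2 ^ a)%N) ->
  pr (X n @^-1` dyadic a v) = (2 ^+ a)^-1 ^+ d.
Proof.
move=> va; have va' i : (v i < (2 ^ a).-1.+1)%N by rewrite prednK ?expn_gt0.
have E2 : (2 ^ a).-1.+1%:R = 2 ^+ a :> R by rewrite prednK ?expn_gt0// natrX.
rewrite -E2 -(pr_cell net n [ffun i => Ordinal (va' i)]).
by congr (pr (_ @^-1` cell_box _ _)); apply/funext => i; rewrite ffunE.
Qed.

Definition vacant B n : set T := \bigcap_(i in [set i | (i < n)%N]) ~` (X i @^-1` B).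

Lemma past_vacant B n : measurable B -> pst n (vacant B n).
Proof. by move=> mB; apply: past_bigI => k kn; apply: pastC; exact: past_X. Qed.

Lemma pr_vacant_le B n (v : R) : measurable B -> 0 <= v <= 1 ->
  (forall k, pr (X k @^-1` B) = v) -> pr (vacant B n) <= (1 - v) ^+ n.
Proof.
move=> mB /andP[v0 v1] Bv; elim: n => [|n IH].
  by rewrite expr0 pr_le1//; apply: (past_measurable (past_vacant (n := 0%N) mB)).
have pV := past_vacant (n := n) mB; have mV := past_measurable pV.
have mX : measurable (X n @^-1` B) by rewrite -[X in measurable X]setTI; exact: measurable_funP.
have -> : vacant B n.+1 = vacant B n `&` X n @^-1` (~` B).
  apply/seteqP; split => w; first by move=> H; split=> [k kn|]; apply: H => //=; exact: leqW.
  by move=> [H Hn] k /=; rewrite ltnS leq_eqVlt => /orP[/eqP ->//|]; exact: H.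
rewrite (past_indep_X net pV); last exact: measurableC.
by rewrite preimage_setC pr_setC// Bv exprSr ler_wpM2r// subr_ge0.
Qed.

Definition first B j : set T := X j @^-1` B `&` vacant B j.

Lemma past_first B j n : measurable B -> (j < n)%N -> pst n (first B j).
Proof.
move=> mB jn; apply: pastI; first exact: past_X.
exact: (past_mono (ltnW jn) (past_vacant (n := j) mB)).
Qed.

Lemma first_unique B j k w : first B j w -> first B k w -> j = k.
Proof.
move=> [Bj nj] [Bk nk]; apply/eqP; rewrite eqn_leq.
apply/andP; split; rewrite leqNgt; apply/negP => h; [exact: (nj k)|exact: (nk j)].
Qed.

Lemma exists_first B n w : ~ vacant B n w -> exists2 j, (j < n)%N & first B j w.
Proof.
elim: n => [|n IH] nv; first by exfalso; apply: nv.
have [h|h] := pselect (vacant B n w); last by have [j jn fj] := IH h; exists j => //; exact: leqW.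
exists n => //; split => //; apply: contrapT => nB; apply: nv => k /=.
by rewrite ltnS leq_eqVlt => /orP[/eqP ->//|kn]; exact: h.
Qed.

End first_vertex.

(** * Links between a box and its parent *)

Section finite_families.
Context {R : realType} {disp : measure_display} {T : measurableType disp}.
Variable P : probability T R.
Local Notation pr := (prob P).

Lemma pr_bigsetU_le (I : Type) (r : seq I) (G : I -> set T) : (forall i, measurable (G i)) ->
  pr (\big[setU/set0]_(i <- r) G i) <= \sum_(i <- r) pr (G i).
Proof.
move=> mG; rewrite -[leLHS]mul1r; apply: pr_le_sum => //.
  by apply: bigsetU_measurable.
move=> w; elim: r => [|i r IH]; rewrite ?big_nil// !big_cons => -[h|/IH h].
  by rewrite indic1// lerDl sumr_ge0.
by rewrite (le_trans h)// lerDr.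
Qed.

Lemma pr_disjoint_le1 (I : eqType) (r : seq I) (G : I -> set T) : uniq r ->
  (forall i, measurable (G i)) ->
  (forall i k w, G i w -> G k w -> i = k) -> \sum_(i <- r) pr (G i) <= 1.
Proof.
move=> ur mG dG; rewrite -(pr_setT P).
have := @pr_sum_le _ _ _ P _ _ r [:: tt] (fun=> 1) (fun=> 1) G (fun=> setT)
  (fun=> ler01) (fun=> ler01) mG (fun=> measurableT).
rewrite big_seq1 mul1r; under eq_bigr do rewrite mul1r; apply=> w.
under eq_bigr do rewrite mul1r; rewrite big_seq1 indic1// mul1r.
elim: r ur => [|i r IH] /=; rewrite ?big_nil// big_cons => /andP[ir ur].
have [h|h] := pselect (G i w); last first.
  have -> : \1_(G i) w = 0 :> R by rewrite indicE memNset.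
  by rewrite add0r IH.
have -> : \1_(G i) w = 1 :> R by exact: indic1.
rewrite big_seq big1 ?addr0// => k kr; rewrite indicE memNset // => hk.
by move: ir; rewrite (dG _ _ _ h hk) kr.
Qed.

End finite_families.

Section links.
Context {R : realType} {disp : measure_display} {T : measurableType disp} {d : nat}.
Context {W : nat -> {mfun T >-> R}} {X : nat -> {mfun T >-> d.-tuple R}}.
Context {E : nat -> nat -> {mfun T >-> bool}} {P : probability T R}.
Context {delta : R} {rho : R -> R} {beta gamma : R}.
Hypothesis net : age_based_network W X E P rho beta gamma.
Hypothesis rhoP : profile_function d delta rho.
Hypotheses (beta0 : 0 < beta) (gamma01 : 0 < gamma < 1).
Context {p : R} {K : nat -> nat -> {mfun T >-> bool}}.
Hypothesis marks : percolation_marks W X E P p K.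
Hypothesis p01 : 0 <= p <= 1.
Local Notation pst := (past W X E).
Local Notation age := (birth_time W).
Local Notation conn := (connection_prob W X rho beta gamma).
Local Notation pr := (prob P).

Lemma pr_no_connector_le (j j' s0 n : nat) (F : set T) (t q2 kap : R) (C : set (d.-tuple R)) :
  (j < s0)%N -> (j' < s0)%N -> j != j' -> pst s0 F -> F `<=` [set w | age s0.-1 w <= t] ->
  measurable C -> 0 <= q2 <= 1 ->
  (forall n w, (s0 <= n)%N -> F w -> age n w <= 2 * t -> C (X n w) ->
    q2 <= conn j n w * conn j' n w) ->
  (s0 <= n)%N -> 0 <= kap <= 1 -> (forall k, pr (X k @^-1` C) = kap) ->
  pr (not_joined (W := W) (E := E) j j' s0 F t pred0 n `&`
      unlinked (E := E) (K := K) j j' (index_iota s0 n)) <=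
  pr F * (1 - p ^+ 2 * (kap * q2)) ^+ (n - s0).
Proof.
move=> js js' jj' pF Fage mC /andP[q0 q1] H sn /andP[k0 k1] Ck.
have kq1 : kap * q2 <= 1 by rewrite mulr_ile1.
have kq0 : 0 <= kap * q2 by rewrite mulr_ge0.
have pA (Q : pred nat) := past_not_joined t js js' pF Q sn.
rewrite -[X in _ ^+ X](size_iota s0); apply: (pr_unlinked_le marks p01 jj') => //.
- exact: (net_event_past (pA pred0)).
- exact: iota_uniq.
- by apply/allP => k; rewrite mem_index_iota => /andP[sk _]; rewrite !(leq_trans _ sk).
- move=> I sI; have -> : size I = (\sum_(s0 <= k < n) (fun k => k \in I) k)%N.
    have /esym EI := subseq_uniqP (iota_uniq _ _) sI.
    rewrite -{1}EI size_filter -sum1_count big_mkcond /=.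
    by apply: eq_bigr => k _; case: (k \in I).
  rewrite mulrC; apply: le_trans (pr_not_joined_le net rhoP beta0 js js' jj' pF Fage mC q0 H (fun k => k \in I) sn k0 _ Ck); last by rewrite subr_ge0.
  apply: le_pr.
  + apply: measurableI; first exact: (past_measurable (pA pred0)).
    have -> : unjoined (E := E) j j' I = \bigcap_(k in [set` I]) ~` joins (E := E) j j' k.
      apply/seteqP; split => w; first by move=> /allP U k kI [h1 h2]; have := U k kI; rewrite h1 h2.
      move=> U; apply/allP => k kI; apply/negP => /andP[h1 h2]; exact: (U k kI).
    apply: fin_bigcap_measurable => [|k _]; first exact: finite_seq.
    by apply: measurableC; exact: measurable_joins.
  + exact: (past_measurable (pA (fun k => k \in I))).
  + move=> w [[Fw Hw] /allP Uw]; split => // k kn; have [Ak _] := Hw k kn; split => //.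
    by case: ifP => //= kI [h1 h2]; have := Uw k kI; rewrite h1 h2.
- by rewrite kq0.
- exact: pr_ge0.
Qed.

End links.

Section nested_boxes.
Context {R : realType} {disp : measure_display} {T : measurableType disp} {d : nat}.
Context {W : nat -> {mfun T >-> R}} {X : nat -> {mfun T >-> d.-tuple R}}.
Context {E : nat -> nat -> {mfun T >-> bool}} {P : probability T R}.
Context {delta : R} {rho : R -> R} {beta gamma : R}.
Hypothesis net : age_based_network W X E P rho beta gamma.
Hypothesis rhoP : profile_function d delta rho.
Hypotheses (beta0 : 0 < beta) (gamma01 : 0 < gamma < 1).
Context {p : R} {K : nat -> nat -> {mfun T >-> bool}}.
Hypothesis marks : percolation_marks W X E P p K.
Hypothesis p01 : 0 <= p <= 1.
Local Notation pst := (past W X E).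
Local Notation age := (birth_time W).
Local Notation conn := (connection_prob W X rho beta gamma).
Local Notation pr := (prob P).

(** Connectors are sought among the vertices [s0, ..., N - 1], all younger than both
ends. *)
Definition linked s0 N j j' w :=
  j = j' \/ exists2 k, (s0 <= k < N)%N & [&& E j k w, E j' k w, K j k w & K j' k w].

Variables (B B' : set (d.-tuple R)) (J s0 N L : nat) (t tau v q2 : R).
Hypotheses (mB : measurable B) (mB' : measurable B') (BB' : forall i w, B (X i w) -> B' (X i w)).
Hypotheses (J0 : (0 < J)%N) (Js : (J <= s0)%N) (sN : (s0 <= N)%N).
Hypotheses (v01 : 0 <= v <= 1) (Bv : forall k, pr (X k @^-1` B) = v) (q01 : 0 <= q2 <= 1).
Hypothesis connP : forall w n j j', (s0 <= n)%N -> (j < J)%N -> (j' < J)%N ->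
  age J.-1 w <= tau -> age n w <= 2 * t -> B (X j w) -> B' (X j' w) ->
  cell_of L (X n w) = cell_of L (X j w) -> q2 <= conn j n w * conn j' n w.

Local Notation cell := {ffun 'I_d -> 'I_L.+1}.
Local Notation scene := ('I_J * 'I_J * cell)%type.

Let C (c : cell) : set (d.-tuple R) := cell_box L (fun i => c i).
Let F (u : scene) : set T := (first (X := X) B u.1.1 `&` first (X := X) B' u.1.2) `&`
  (X u.1.1 @^-1` C u.2 `&` ([set w | age J.-1 w <= tau] `&` [set w | age s0.-1 w <= t])).
Let G (u : scene) : set T := not_joined (W := W) (E := E) u.1.1 u.1.2 s0 (F u) t pred0 N `&`
  unlinked (E := E) (K := K) u.1.1 u.1.2 (index_iota s0 N).
Let scenes := [seq u : scene <- enum {: scene} | val u.1.1 != val u.1.2].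

Let s00 : (0 < s0)%N. Proof. exact: leq_trans J0 Js. Qed.

Let pF u : pst s0 (F u).
Proof.
have lts (i : 'I_J) : (i < s0)%N by exact: leq_trans (ltn_ord i) Js.
apply: pastI; first by apply: pastI; exact: past_first.
apply: pastI; first by apply: past_X => //; exact: measurable_cell_box.
have pa k y : (k < s0)%N -> pst s0 [set w | age k w <= y].
  move=> ks; rewrite (_ : [set w | _] = age k @^-1` `]-oo, y]%classic); first exact: past_age.
  by apply/seteqP; split => w /=; rewrite in_itv.
by apply: pastI; apply: pa; [rewrite (leq_trans _ Js)// prednK|rewrite prednK].
Qed.

Let mF u : measurable (F u). Proof. exact: past_measurable (pF u). Qed.

Let mG u : measurable (G u).
Proof.
have lts (i : 'I_J) : (i < s0)%N by exact: leq_trans (ltn_ord i) Js.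
apply: measurableI; last exact: measurable_unlinked.
exact: (past_measurable (past_not_joined t (lts _) (lts _) (pF u) pred0 sN)).
Qed.

Let kap : R := L.+1%:R^-1 ^+ d.

Let kap01 : 0 <= kap <= 1.
Proof. by rewrite exprn_ge0 ?invr_ge0//= exprn_ile1 ?invr_ge0// invf_le1// ler1n. Qed.

Let G_le u : u \in scenes -> pr (G u) <= pr (F u) * (1 - p ^+ 2 * (kap * q2)) ^+ (N - s0).
Proof.
rewrite mem_filter => /andP[jj' _].
have lts (i : 'I_J) : (i < s0)%N by exact: leq_trans (ltn_ord i) Js.
apply: (pr_no_connector_le net rhoP beta0 marks p01 (C := C u.2)) => //.
- by move=> w [_ [_ []]].
- exact: measurable_cell_box.
- move=> n w sn [[[Bj _] [Bj' _]] [Cj [aJ _]]] an Cn; apply: connP => //.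
  have tn := position_torus net n w; have tj := position_torus net u.1.1 w.
  by move: Cj Cn; rewrite /C /= !cell_boxP// => -> ->.
- by move=> k; rewrite /C (pr_cell net).
Qed.

Let sum_F : \sum_(u <- scenes) pr (F u) <= 1.
Proof.
apply: pr_disjoint_le1 => //; first by rewrite filter_uniq// enum_uniq.
move=> [[j1 j2] c] [[k1 k2] e] w [[f1 f2] [Xc _]] [[g1 g2] [Xe _]].
have tj := position_torus net j1 w.
have jk1 : j1 = k1 by apply: val_inj; exact: first_unique f1 g1.
have jk2 : j2 = k2 by apply: val_inj; exact: first_unique f2 g2.
by move: Xc Xe; rewrite /C /= -jk1 -jk2 !cell_boxP// => <- <-.
Qed.

(** The first vertices of the two boxes are very likely to be early, hence old and well
connected. The bound for a given pair of vertices extends to the random pair without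
loss: the scenes, which record the identities of both first vertices and the cell of
the first one, are disjoint events. *)
Lemma link_failure : exists Z : set T, [/\ measurable Z,
  pr Z <= (1 - v) ^+ J + pr [set w | tau < age J.-1 w] + (1 - p ^+ 2 * (kap * q2)) ^+ (N - s0) &
  forall w, ~ Z w -> age N.-1 w <= t -> exists j j',
    [/\ (j < J)%N, (j' < J)%N, first (X := X) B j w, first (X := X) B' j' w &
        linked s0 N j j' w]].
Proof.
pose Z1 := \big[setU/set0]_(u <- scenes) G u.
have mZ1 : measurable Z1 by apply: bigsetU_measurable => u _; exact: mG.
have mV : measurable (vacant (X := X) B J) := past_measurable (past_vacant (W := W) (E := E) (n := J) mB).
have mA := measurable_age_gt (W := W) (X := X) (E := E) J.-1 tau.
exists (vacant (X := X) B J `|` [set w | tau < age J.-1 w] `|` Z1); split.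
- by apply: measurableU => //; exact: measurableU.
- apply: le_trans (pr_setU_le P (measurableU _ _ mV mA) mZ1) _; apply: lerD.
    apply: le_trans (pr_setU_le P mV mA) _; rewrite lerD2r.
    exact: (pr_vacant_le net).
  apply: le_trans (pr_bigsetU_le P scenes mG) _.
  apply: (@le_trans _ _ ((\sum_(u <- scenes) pr (F u)) * (1 - p ^+ 2 * (kap * q2)) ^+ (N - s0))).
    by rewrite mulr_suml big_seq [leRHS]big_seq; apply: ler_sum => u uS; exact: G_le.
  have [k0 k1] := andP kap01; have [q0 q1] := andP q01; have [p0 p1] := andP p01.
  rewrite -[leRHS]mul1r ler_wpM2r// exprn_ge0// subr_ge0 mulr_ile1 ?mulr_ge0 ?exprn_ge0 ?exprn_ile1 ?mulr_ile1//.
move=> w nZ ageN.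
have nV : ~ vacant (X := X) B J w by move=> h; apply: nZ; left; left.
have aJ : age J.-1 w <= tau by rewrite leNgt; apply/negP => h; apply: nZ; left; right.
have [j jJ fj] := exists_first nV.
have [j' j'J fj'] : exists2 j', (j' < J)%N & first (X := X) B' j' w.
  by apply: exists_first => h; apply: (h j jJ); apply: BB'; case: fj.
exists j, j'; split => //; apply: contrapT => nl; apply: nZ; right.
pose c := cell_of L (X j w).
have tj := position_torus net j w.
have ages k : (k < N)%N -> age k w <= t.
  move=> kN; apply: le_trans ageN; apply: (age_mono net).
  by rewrite -ltnS prednK// (leq_ltn_trans _ kN).
rewrite /Z1 -bigcup_seq; exists (Ordinal jJ, Ordinal j'J, c).
  by rewrite /= mem_filter mem_enum andbT /=; apply/eqP => jj'; apply: nl; left.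
split.
  split.
    split; first by [].
    split; first by rewrite /C /= cell_boxP.
    by split => //; apply: ages; rewrite prednK.
  by move=> k /andP[_ kN]; split => //; exact: ages.
apply/allP => k; rewrite mem_index_iota => kI; apply/negP => H.
by apply: nl; right; exists k.
Qed.

End nested_boxes.

Lemma pow_le_inv (R : realType) (x : R) n : 0 < x <= 1 -> (0 < n)%N ->
  (1 - x) ^+ n <= (n%:R * x)^-1.
Proof.
move=> /andP[x0 x1] n0; have nx0 : 0 < n%:R * x by rewrite mulr_gt0// ltr0n.
apply: (@le_trans _ _ (expR (- x) ^+ n)).
  apply: lerXn2r; rewrite ?nnegrE ?subr_ge0 ?expR_ge0//.
  by have := expR_ge1Dx (- x).
rewrite -expRM_natl mulrN expRN lef_pV2 ?posrE ?expR_gt0//.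
by apply: le_trans (expR_ge1Dx _); rewrite lerDr.
Qed.

Section dyadic_links.
Context {R : realType} {disp : measure_display} {T : measurableType disp} {d : nat}.
Context {W : nat -> {mfun T >-> R}} {X : nat -> {mfun T >-> d.-tuple R}}.
Context {E : nat -> nat -> {mfun T >-> bool}} {P : probability T R}.
Context {delta : R} {rho : R -> R} {beta gamma : R}.
Hypothesis net : age_based_network W X E P rho beta gamma.
Hypothesis rhoP : profile_function d delta rho.
Hypotheses (beta0 : 0 < beta) (gamma01 : 0 < gamma < 1).
Context {p : R} {K : nat -> nat -> {mfun T >-> bool}}.
Hypothesis marks : percolation_marks W X E P p K.
Hypothesis p01 : 0 < p <= 1.
Hypothesis d0 : (0 < d)%N.
Hypothesis delta0 : 0 < delta.
Local Notation pst := (past W X E).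
Local Notation age := (birth_time W).
Local Notation conn := (connection_prob W X rho beta gamma).
Local Notation pr := (prob P).
Variable del : R.
Hypotheses (del1 : delta < del) (del2 : del * (1 - gamma) < gamma).

Let b : R := 2 ^+ d.
Local Notation "'B' x" := (b `^ x) (at level 10, x at level 9).

Let b1 : 1 < b. Proof. by rewrite exprn_egt1 ?ltr1n// -lt0n. Qed.
Let b0 : 0 < b. Proof. exact: lt_trans b1. Qed.
Let BD x y : B (x + y) = B x * B y.
Proof. by rewrite powRD// (gt_eqF b0) implybT. Qed.
Let Bn n : (((2 ^ d) ^ n)%N)%:R = B n%:R.
Proof. by rewrite powR_mulrn ?(ltW b0)// !natrX. Qed.
Let B0 x : 0 < B x. Proof. exact: powR_gt0. Qed.
Let B_le x y : x <= y -> B x <= B y.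
Proof. by move=> xy; rewrite ler_powR// ltW. Qed.
Let BV n : ((2 ^+ n)^-1 ^+ d : R) = B (- n%:R).
Proof. by rewrite powRN powR_mulrn ?(ltW b0)// exprVn exprAC. Qed.

Let g0 : R := gamma - del * (1 - gamma).
(** The index of the first vertex of a box may exceed its typical value by a factor
[b^uu], and its age by another one; the cell in which connectors are sought contains
about [b^rr] vertices at the end. With [kappa] proportional to the exponent [g0], these
corrections use up at most half of [g0]. *)
Let kappa : R := g0 / (4 * (1 + del)).

Let del0 : 0 < del. Proof. exact: lt_trans del1. Qed.
Let g00 : 0 < g0. Proof. by rewrite subr_gt0. Qed.
Let kappa0 : 0 < kappa. Proof. by apply: divr_gt0; [exact: g00|have := del0; lra]. Qed.
Let kappaE : kappa * (1 + del) = g0 / 4.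
Proof. by rewrite /kappa; field; have := del0; lra. Qed.
Let kappa4 : kappa <= 4^-1.
Proof. have := kappaE; have := del0; have := kappa0; have /andP[? ?] := gamma01; rewrite /g0; nra. Qed.

Let uu (m : nat) := Num.truncn (kappa * m%:R).
Let rr (m : nat) := Num.truncn (gamma * (m%:R - 2 * (uu m)%:R)).

Let uuP m : (uu m)%:R <= kappa * m%:R < (uu m)%:R + 1.
Proof. by rewrite natr1 truncn_itv//; apply: mulr_ge0 => //; exact: ltW. Qed.

Let uu4 m : (4 * uu m <= m)%N.
Proof.
rewrite -(ler_nat R) natrM; have /andP[h _] := uuP m.
have : kappa * m%:R <= 4^-1 * m%:R by rewrite ler_wpM2r.
lra.
Qed.

Let mu0 m : 0 <= m%:R - 2 * (uu m)%:R :> R.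
Proof. by have := uu4 m; rewrite -(ler_nat R) natrM => h; have := ler0n R (uu m); lra. Qed.

Let rrP m : (rr m)%:R <= gamma * (m%:R - 2 * (uu m)%:R) < (rr m)%:R + 1.
Proof.
have /andP[/ltW gm0 _] := gamma01.
by rewrite natr1 truncn_itv//; apply: mulr_ge0 => //; exact: mu0.
Qed.

Let rr_le m : (rr m <= m)%N.
Proof.
rewrite -(ler_nat R); have /andP[h _] := rrP m; apply: (le_trans h).
have /andP[g1 g2] := gamma01; have := mu0 m; have := ler0n R (uu m); nra.
Qed.

(** A connector [n] in the small cell of [j] is close enough to [j]; it also lies in the
box of [j], hence in the parent box with [j'], which bounds its distance to [j']. *)
Lemma conn_dyadic_ge (A t : R) m a v : 1 <= A -> (2 <= m)%N ->
  t <= A * B (m + a.+1)%:R ->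
  let M := Num.max 1 (beta^-1 * ((2 * A) `^ (1 - gamma) * Num.sqrt d%:R ^+ d)) in
  let y := B (m%:R + 1 - gamma * (m%:R - 2 * (uu m)%:R)) in
  forall w n j j', age j w <= B (a.+1 + 2 * uu m)%:R -> age j' w <= B (a.+1 + 2 * uu m)%:R ->
  age n w <= 2 * t -> dyadic a.+1 v (X j w) -> dyadic a (fun i => v i %/ 2)%N (X j' w) ->
  cell_of (2 ^ (m + a.+1 - rr m)).-1 (X n w) = cell_of (2 ^ (m + a.+1 - rr m)).-1 (X j w) ->
  rho M * rho (M * y) <= conn j n w * conn j' n w.
Proof.
move=> A1 m2 tA M y w n j j' aj aj' an Xj Xj' Xn.
have [g1 g2] := andP gamma01.
have A0 : 0 < A by lra.
have tn := position_torus net n w; have tj := position_torus net j w.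
have tj' := position_torus net j' w.
have an' : age n w <= 2 * A * B (m + a.+1)%:R by apply: (le_trans an); lra.
have M1 : 1 <= M by rewrite le_max lexx.
have main k (e : R) D : age k w <= B (a.+1 + 2 * uu m)%:R ->
    torus_dist (X n w) (X k w) ^+ d <= Num.sqrt d%:R ^+ d * B (- D) ->
    m%:R + a.+1%:R - gamma * (m%:R - 2 * (uu m)%:R) <= D + e -> rho (M * B e) <= conn k n w.
  move=> ak Dk De; apply: le_trans (conn_ge net rhoP beta0 gamma01 an' ak Dk).
  apply: (profile_nonincreasing rhoP).
    by rewrite !mulr_ge0 ?invr_ge0 ?powR_ge0 ?exprn_ge0 ?sqrtr_ge0 ?(ltW beta0).
  rewrite powRM ?mulr_ge0 ?(ltW A0) ?(ltW (B0 _))// -!powRrM.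
  set S := Num.sqrt _ ^+ _ in M M1 Dk *; set A' := (2 * A) `^ _ in M M1 *.
  have -> : beta^-1 * (A' * B ((m + a.+1)%:R * (1 - gamma)) * B ((a.+1 + 2 * uu m)%:R * gamma) * (S * B (- D))) =
     beta^-1 * (A' * S) * B ((m + a.+1)%:R * (1 - gamma) + (a.+1 + 2 * uu m)%:R * gamma - D).
    by rewrite !BD; ring.
  apply: ler_pM; rewrite ?(ltW (B0 _))//.
  - by rewrite !mulr_ge0 ?invr_ge0 ?powR_ge0 ?exprn_ge0 ?sqrtr_ge0 ?(ltW beta0).
  - by rewrite le_max lexx orbT.
  - by apply: B_le; rewrite !natrD; lra.
have [r1 r2] := andP (rrP m).
have rmF : (rr m <= m + a.+1)%N by rewrite (leq_trans (rr_le m))// leq_addr.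
apply: ler_pM; rewrite ?(profile_ge0 rhoP)//.
- lra.
- by rewrite mulr_ge0 ?(ltW (B0 _))//; lra.
- rewrite -[M in rho M]mulr1 -(powRr0 b).
  apply: (main _ _ ((m + a.+1)%:R - (rr m)%:R)) => //; last by rewrite natrD; lra.
  rewrite -natrB// -BV -exprMn; apply: lerXn2r; rewrite ?nnegrE ?torus_dist_ge0//.
  have := torus_dist_le_cell tn tj Xn.
  by rewrite prednK ?expn_gt0// natrX.
apply: (main _ _ a%:R) => //; last by rewrite -[a.+1%:R]natr1; lra.
rewrite -BV -exprMn; apply: lerXn2r; rewrite ?nnegrE ?torus_dist_ge0//.
apply: (dyadic_dist tn tj' _ Xj').
have := @dyadic_parent R d 1%N a v (X n w) tn; rewrite addn1 expn1; apply.
have mF : (m + a.+1 - rr m = a.+1 + (m - rr m))%N by rewrite addnBA ?rr_le// [(a.+1 + m)%N]addnC.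
pose c i := cell_index (2 ^ (m + a.+1 - rr m)).-1 (X j w) i.
have cj : dyadic (m + a.+1 - rr m) c (X j w) by rewrite /dyadic cell_box_indexP.
have cn : dyadic (m + a.+1 - rr m) c (X n w).
  rewrite /dyadic cell_box_indexP// => i.
  by rewrite /c -!cell_ofE// Xn.
rewrite mF in cj cn.
have := dyadic_parent tn cn; have := dyadic_parent tj cj.
by move=> /(dyadic_unique tj Xj) /funext <-.
Qed.

(** Up to constants, the cell contains [b^(gamma m)] vertices, each of which links with
probability at least [b^(- del (1 - gamma) m)]; this makes [b^(g0 m)] connectors on
average, up to the corrections controlled by [kappa]. All error terms are of order
[b^(- kappa m)]. *)
Lemma dyadic_link_failure : exists2 q : R, 0 < q < 1 & forall A, 1 <= A ->
  exists2 C : R, 0 < C & forall m a t v, (2 <= m)%N -> t <= A * (((2 ^ d) ^ (m + a.+1))%N)%:R ->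
  (forall i, v i < 2 ^ a.+1)%N -> exists Z : set T, [/\ measurable Z, pr Z <= C * q ^+ m &
    forall w, ~ Z w -> age ((2 ^ d) ^ (m + a.+1)).-1 w <= t -> exists j j',
    [/\ (j < (2 ^ d) ^ (m + a))%N, (j' < (2 ^ d) ^ (m + a))%N,
      first (X := X) (dyadic a.+1 v) j w,
      first (X := X) (dyadic a (fun i => v i %/ 2)%N) j' w &
      linked (E := E) (K := K) ((2 ^ d) ^ (m + a)) ((2 ^ d) ^ (m + a.+1)) j j' w]].
Proof.
have [p0 p1] := andP p01; have [g1 g2] := andP gamma01.
have dd : 0 < delta < del by rewrite delta0.
have [c c0 rho_ge] := profile_lower_bound rhoP dd.
exists (B (- kappa)).
  rewrite B0 /= -(powRr0 b) /powR (gt_eqF b0) ltr_expR ltr_pM2r ?ln_gt0//.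
  by have := kappa0; lra.
move=> A A1.
set M := Num.max 1 (beta^-1 * ((2 * A) `^ (1 - gamma) * Num.sqrt d%:R ^+ d)).
have M1 : 1 <= M by rewrite le_max lexx.
have M0 : 0 < M by lra.
pose c2 := c ^+ 2 * M `^ (- del) ^+ 2.
have c20 : 0 < c2 by rewrite mulr_gt0 ?exprn_gt0 ?powR_gt0.
pose C := 3 * B 1 + 2 * B (1 + del) / (p ^+ 2 * c2).
have C0 : 0 < C.
  apply: addr_gt0; first by rewrite mulr_gt0.
  by apply: divr_gt0; apply: mulr_gt0 => //; exact: exprn_gt0.
exists C => // m a t v m2 tA va.
rewrite Bn in tA.
have [u1 u2] := andP (uuP m); have [r1 r2] := andP (rrP m).
pose y := B (m%:R + 1 - gamma * (m%:R - 2 * (uu m)%:R)).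
have y1 : 1 <= y.
  rewrite -(powRr0 b); apply: B_le; have := mu0 m; have := ler0n R (uu m); nra.
pose q2 := rho M * rho (M * y).
have My : 1 <= M * y by rewrite -[1]mulr1 ler_pM.
have q2_ge : c2 * B (- del * (m%:R + 1 - gamma * (m%:R - 2 * (uu m)%:R))) <= q2.
  have -> : c2 * B (- del * (m%:R + 1 - gamma * (m%:R - 2 * (uu m)%:R))) =
     (c * M `^ (- del)) * (c * (M * y) `^ (- del)).
    rewrite powRM ?(ltW M0)//; last by lra.
    rewrite /y -powRrM [_ * - del]mulrC /c2; ring.
  apply: ler_pM; rewrite ?mulr_ge0 ?powR_ge0 ?(ltW c0)//; exact: rho_ge.
have q21 : 0 <= q2 <= 1.
  have h1 := profile_ge0 rhoP (ltW M0); have h2 := profile_le1 rhoP (ltW M0).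
  have My0 : 0 <= M * y by lra.
  have h3 := profile_ge0 rhoP My0; have h4 := profile_le1 rhoP My0.
  by rewrite mulr_ge0//= mulr_ile1.
have bb n : (0 < (2 ^ d) ^ n)%N by rewrite !expn_gt0.
pose J := ((2 ^ d) ^ (a.+1 + uu m))%N.
pose vol := (2 ^+ a.+1)^-1 ^+ d : R.
have volE : vol = B (- a.+1%:R) by rewrite /vol BV.
have vol01 : 0 <= vol <= 1.
  by rewrite volE (ltW (B0 _))/= -[leRHS](powRr0 b); apply: B_le; rewrite oppr_le0.
have Js : (J <= (2 ^ d) ^ (m + a))%N.
  rewrite /J leq_exp2l; last by rewrite -[1%N](expn0 2) ltn_exp2l.
  by have := uu4 m; move: (uu m) m2 => u; clear; lia.
have sN : ((2 ^ d) ^ (m + a) <= (2 ^ d) ^ (m + a.+1))%N.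
  by rewrite leq_exp2l ?leq_add2l//; rewrite -[1%N](expn0 2) ltn_exp2l.
have BB' i w : dyadic a.+1 v (X i w) -> dyadic a (fun i => v i %/ 2)%N (X i w).
  by have := @dyadic_parent R d 1%N a v (X i w) (position_torus net i w); rewrite addn1 expn1.
have connP w n j j' : ((2 ^ d) ^ (m + a) <= n)%N -> (j < J)%N -> (j' < J)%N ->
   age J.-1 w <= B (a.+1 + 2 * uu m)%:R -> age n w <= 2 * t -> dyadic a.+1 v (X j w) ->
   dyadic a (fun i => v i %/ 2)%N (X j' w) ->
   cell_of (2 ^ (m + a.+1 - rr m)).-1 (X n w) = cell_of (2 ^ (m + a.+1 - rr m)).-1 (X j w) ->
   q2 <= conn j n w * conn j' n w.
  move=> _ jJ j'J aJ; apply: conn_dyadic_ge => //.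
    by apply: le_trans aJ; apply: (age_mono net); rewrite -ltnS prednK ?bb.
  by apply: le_trans aJ; apply: (age_mono net); rewrite -ltnS prednK ?bb.
have p01' : 0 <= p <= 1 by rewrite (ltW p0).
have [Z [mZ Zle HZ]] := link_failure net rhoP beta0 marks p01' (measurable_dyadic a.+1 v)
  (measurable_dyadic a (fun i => v i %/ 2)%N) BB' (bb _ : 0 < J)%N Js sN vol01
  (fun k => pr_dyadic net k va) q21 connP.
exists Z; split => //; last first.
  move=> w nZ aN; have [j [j' [jJ j'J f1 f2 l]]] := HZ w nZ aN.
  by exists j, j'; split => //; exact: leq_trans Js.
apply: (le_trans Zle).
have Bm : B (- kappa) ^+ m = B (- (kappa * m%:R)).
  by rewrite -powR_mulrn ?(ltW (B0 _))// -powRrM mulNr.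
have uB : B (- (uu m)%:R) <= B 1 * B (- kappa) ^+ m by rewrite Bm -BD; apply: B_le; lra.
have T1 : (1 - vol) ^+ J <= B (- (uu m)%:R).
  have v0 : 0 < vol by rewrite volE.
  apply: le_trans (pow_le_inv _ (bb _ : 0 < J)%N) _; first by rewrite v0; case/andP: vol01.
  rewrite /J Bn volE -BD -powRN; apply: B_le; rewrite natrD; lra.
have T2 : pr [set w | B (a.+1 + 2 * uu m)%:R < age J.-1 w] <= 2 * B (- (uu m)%:R).
  apply: le_trans (pr_age_gt net _ (B0 _)) _; rewrite prednK ?bb// /J Bn -mulrA ler_pM2l//.
  by rewrite -powRN -BD; apply: B_le; rewrite !natrD; lra.
have T3 : (1 - p ^+ 2 * ((2 ^ (m + a.+1 - rr m)).-1.+1%:R^-1 ^+ d * q2)) ^+ ((2 ^ d) ^ (m + a.+1) - (2 ^ d) ^ (m + a))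
    <= 2 * B (1 + del) / (p ^+ 2 * c2) * B (- kappa) ^+ m.
  set n := (X in _ ^+ X); set kap := _^-1 ^+ d.
  have rmF : (rr m <= m + a.+1)%N by rewrite (leq_trans (rr_le m))// leq_addr.
  have kapE : kap = B ((rr m)%:R - (m + a.+1)%:R).
    by rewrite /kap prednK ?expn_gt0// natrX BV natrB// opprB.
  have nge : B (m + a.+1)%:R / 2 <= n%:R.
    rewrite /n natrB// !Bn addnS -natr1 BD powRr1 ?(ltW b0)//.
    have : 2 <= b by rewrite -[2]expr1 ler_eXn2l// ltr1n.
    have := B0 (m + a)%:R; nra.
  have n0 : (0 < n)%N by rewrite -(ltr_nat R); apply: lt_le_trans nge; rewrite divr_gt0.
  have q20 : 0 < q2 by apply: lt_le_trans q2_ge; exact: mulr_gt0.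
  have kap0 : 0 < kap by rewrite kapE.
  have kap1 : kap <= 1 by rewrite kapE -[leRHS](powRr0 b); apply: B_le; rewrite subr_le0 ler_nat.
  have p20 : 0 < p ^+ 2 by exact: exprn_gt0.
  have p21 : p ^+ 2 <= 1 by rewrite exprn_ile1// ltW.
  have x01 : 0 < p ^+ 2 * (kap * q2) <= 1.
    have kq0 : 0 < kap * q2 by exact: mulr_gt0.
    have [_ q2le] := andP q21.
    have kq1 : kap * q2 <= 1 by apply: mulr_ile1 => //; exact: ltW.
    by apply/andP; split; [exact: mulr_gt0|apply: mulr_ile1 => //; exact: ltW].
  apply: (le_trans (pow_le_inv x01 n0)).
  have -> : 2 * B (1 + del) / (p ^+ 2 * c2) * B (- kappa) ^+ m =
      (B (m + a.+1)%:R / 2 * (p ^+ 2 * (kap * (c2 * B (kappa * m%:R - (1 + del) - (rr m)%:R)))))^-1.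
    have e1 : B (m + a.+1)%:R * (kap * B (kappa * m%:R - (1 + del) - (rr m)%:R)) =
        B (kappa * m%:R - (1 + del)).
      by rewrite kapE -!BD; congr powR; ring.
    have e2 : B (1 + del) * B (- (kappa * m%:R)) = (B (kappa * m%:R - (1 + del)))^-1.
      by rewrite -powRN -BD; congr powR; ring.
    transitivity (2 / (p ^+ 2 * c2) * (B (1 + del) * B (- (kappa * m%:R)))).
      by rewrite Bm; ring.
    rewrite e2 -e1; set z1 := B _; set z2 := B _.
    have z10 : z1 != 0 by rewrite gt_eqF // /z1 B0.
    have z20 : z2 != 0 by rewrite gt_eqF // /z2 B0.
    have k0 : kap != 0 by rewrite gt_eqF.
    have c2n : c2 != 0 by rewrite gt_eqF.
    have pn : p != 0 by rewrite gt_eqF.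
    clearbody kap z1 z2 c2; field.
    by rewrite z10 z20 k0 c2n pn.
  rewrite lef_pV2 ?posrE; last 2 first.
  - by apply: mulr_gt0; [rewrite ltr0n|case/andP: x01].
  - by apply: mulr_gt0; [rewrite divr_gt0|apply: mulr_gt0 => //; apply: mulr_gt0 => //; exact: mulr_gt0].
  apply: ler_pM => //.
  - by rewrite divr_ge0// ltW.
  - apply: mulr_ge0; first exact: ltW.
    by apply: mulr_ge0; [exact: ltW|apply: ltW; exact: mulr_gt0].
  rewrite ler_pM2l// ler_pM2l//; apply: le_trans q2_ge; rewrite ler_pM2l//; apply: B_le.
  have := kappaE; have := g00; have := kappa0; have := del0; have := mu0 m; have := ler0n R m; have := ler0n R (uu m).
  have -> : g0 = gamma - del * (1 - gamma) by [].
  move: kappa u1 u2 r1 r2 => k u1 u2 r1 r2 h1 h2 h3 h4 h5 h6 h7.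
  have km : 0 <= k * m%:R by apply: mulr_ge0 => //; exact: ltW.
  have : (uu m)%:R * (gamma * (1 + del)) <= k * m%:R * (gamma * (1 + del)).
    by rewrite ler_wpM2r// mulr_ge0; lra.
  have : k * m%:R * (gamma * (1 + del)) <= k * m%:R * (1 + del).
    by rewrite ler_wpM2l// ler_piMl; lra.
  have : k * m%:R * (1 + del) = (gamma - del * (1 - gamma)) / 4 * m%:R by rewrite -h7; ring.
  have : k * m%:R <= k * m%:R * (1 + del) by rewrite ler_peMr//; lra.
  lra.
rewrite /C mulrDl; apply: lerD T3; have := B0 1; lra.
Qed.

End dyadic_links.

(** * The giant component in the supercritical regime *)

Lemma size_le_counting (R : realType) (A : set nat) (l : seq nat) : uniq l ->
  (forall i, i \in l -> A i) -> ((size l)%:R%:E <= counting A :> \bar R)%E.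
Proof.
move=> ul lA; rewrite /counting; case: asboolP => [fA|_]; last exact: leey.
rewrite lee_fin ler_nat; apply: uniq_leq_size => // i /lA Ai.
by rewrite in_fset_set// inE.
Qed.

Section giant.
Context {R : realType} {disp : measure_display} {T : measurableType disp} {d : nat}.
Context {W : nat -> {mfun T >-> R}} {X : nat -> {mfun T >-> d.-tuple R}}.
Context {E : nat -> nat -> {mfun T >-> bool}} {P : probability T R}.
Context {rho : R -> R} {beta gamma : R}.
Hypothesis net : age_based_network W X E P rho beta gamma.
Context {K : nat -> nat -> {mfun T >-> bool}}.
Local Notation age := (birth_time W).
Local Notation pr := (prob P).
Local Notation G := (percolate (network W E) K).
Local Notation first := (first (X := X)).
Local Notation linked := (linked (E := E) (K := K)).

Lemma linked_component s0 N (t : R) w j j' : (j < s0)%N -> (j' < s0)%N -> (s0 <= N)%N ->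
  age N.-1 w <= t -> linked s0 N j j' w -> component (G t w) 0 j' -> component (G t w) 0 j.
Proof.
move=> js js' sN aN; case=> [->//|[k /andP[sk kN] /and4P[E1 E2 K1 K2]]] [v0 vj' [s [ps ls]]].
have born i : (i < N)%N -> age i w <= t.
  move=> iN; apply: le_trans aN; apply: (age_mono net).
  by rewrite -ltnS prednK// (leq_ltn_trans _ iN).
have bj : age j w <= t by apply: born; exact: leq_trans sN.
have bj' : age j' w <= t by apply: born; exact: leq_trans sN.
have bk : age k w <= t by exact: born.
have adjP i : (i < s0)%N -> age i w <= t -> E i k w -> K i k w -> adj (G t w) i k.
  move=> ilt bi Ei Ki; have ik : (i < k)%N by exact: leq_trans sk.
  by rewrite /= (minn_idPl (ltnW ik)) (maxn_idPr (ltnW ik)) bi bk Ei Ki (ltn_eqF ik).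
split => //; exists (rcons (rcons s k) j); split; last by rewrite last_rcons.
have a1 : adj (G t w) j' k by exact: adjP.
have a2 : adj (G t w) k j by rewrite adj_sym; exact: adjP.
by rewrite !rcons_path ps ls last_rcons; apply/andP; split.
Qed.

(** Links from a box to its parent compose along the ancestors, because the first vertex of
a box is unique; the last ancestor is the torus, whose first vertex is [0]. *)
Lemma first_in_component s0 N (t : R) w a0 (Z : nat -> ('I_d -> nat) -> set T) : (0 < s0)%N -> (s0 <= N)%N ->
  age N.-1 w <= t ->
  (forall a v, (a < a0)%N -> (forall i, v i < 2 ^ a.+1)%N -> ~ Z a v w -> exists j j',
    [/\ (j < s0)%N, (j' < s0)%N, first (dyadic a.+1 v) j w,
        first (dyadic a (fun i => v i %/ 2)%N) j' w & linked s0 N j j' w]) ->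
  forall a v, (a <= a0)%N -> (forall i, v i < 2 ^ a)%N ->
  (forall a', (a' < a)%N -> ~ Z a' (fun i => v i %/ 2 ^ (a - a'.+1))%N w) ->
  exists2 j, first (dyadic a v) j w & component (G t w) 0 j.
Proof.
move=> s00 sN aN HZ; elim=> [|a IH] v aa0 va nZ.
  exists 0%N.
    split => //; have -> : v = (fun=> 0%N) by apply/funext => i; have := va i; case: (v i).
    exact: (dyadic0 (position_torus net 0%N w)).
  have b0 : age 0 w <= t by apply: le_trans aN; apply: (age_mono net).
  by split => //; exists [::].
have [j [j' [js js' f1 f2 l]]] : exists j j', [/\ (j < s0)%N, (j' < s0)%N, first (dyadic a.+1 v) j w,
    first (dyadic a (fun i => v i %/ 2)%N) j' w & linked s0 N j j' w].
  apply: HZ => //; have := nZ a (ltnSn a); rewrite subnn expn0.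
  by have -> : (fun i => v i %/ 1)%N = v by apply/funext => i; rewrite divn1.
have [|i|a' a'a|k fk ck] := IH (fun i => v i %/ 2)%N.
- exact: ltnW.
- by rewrite ltn_divLR// -expnSr; exact: va.
- have := nZ a' (leqW a'a); rewrite subSn// expnS.
  by have -> : (fun i => v i %/ (2 * 2 ^ (a - a'.+1)))%N = (fun i => v i %/ 2 %/ 2 ^ (a - a'.+1))%N
    by apply/funext => i; rewrite divnMA.
exists j => //; rewrite -(first_unique f2 fk) in ck.
exact: (linked_component js js' sN aN l ck).
Qed.

End giant.

Section many_good_boxes.
Context {R : realType} {disp : measure_display} {T : measurableType disp} {d : nat}.
Context {W : nat -> {mfun T >-> R}} {X : nat -> {mfun T >-> d.-tuple R}}.
Context {E : nat -> nat -> {mfun T >-> bool}} {P : probability T R}.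
Context {rho : R -> R} {beta gamma : R}.
Hypothesis net : age_based_network W X E P rho beta gamma.
Context {K : nat -> nat -> {mfun T >-> bool}}.
Local Notation age := (birth_time W).
Local Notation pr := (prob P).
Local Notation G := (percolate (network W E) K).
Local Notation first := (first (X := X)).
Local Notation linked := (linked (E := E) (K := K)).

Variables (A C q t : R).
Hypotheses (C0 : 0 < C) (q01 : 0 < q < 1) (t0 : 0 < t).
Hypothesis links : forall m a v, (2 <= m)%N -> t <= A * (((2 ^ d) ^ (m + a.+1))%N)%:R ->
  (forall i, v i < 2 ^ a.+1)%N -> exists Z : set T, [/\ measurable Z, pr Z <= C * q ^+ m &
    forall w, ~ Z w -> age ((2 ^ d) ^ (m + a.+1)).-1 w <= t -> exists j j',
    [/\ (j < (2 ^ d) ^ (m + a))%N, (j' < (2 ^ d) ^ (m + a))%N, first (dyadic a.+1 v) j w,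
      first (dyadic a (fun i => v i %/ 2)%N) j' w &
      linked ((2 ^ d) ^ (m + a)) ((2 ^ d) ^ (m + a.+1)) j j' w]].

(** A box is bad when some link among its ancestors fails. The expected proportion of bad
boxes is at most a geometric series, so by Markov's inequality at least half of the
boxes are good, apart from an event whose probability is bounded by twice the series.
First vertices of distinct good boxes are distinct members of the component of [0]. *)
Lemma pr_small_component_le m0 a0 (eps : R) : (2 <= m0)%N ->
  t <= A * (((2 ^ d) ^ (m0 + a0))%N)%:R -> eps * t <= (((2 ^ d) ^ a0)%N)%:R / 2 ->
  pr [set w | (largest_component (G t w) * (t^-1)%:E < eps%:E)%E] <=
  2 * C * q ^+ m0 / (1 - q) + pr [set w | t < age ((2 ^ d) ^ (m0 + a0)).-1 w].
Proof.
move=> m2 tA et; have [q0 q1] := andP q01.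
set N := ((2 ^ d) ^ (m0 + a0))%N in tA *.
pose s0 := ((2 ^ d) ^ (m0 + a0).-1)%N.
pose Q (u : nat * ('I_d -> nat)) (Y : set T) := measurable Y /\
    ((u.1 < a0)%N -> (forall i, u.2 i < 2 ^ u.1.+1)%N ->
      pr Y <= C * q ^+ (m0 + (a0 - u.1.+1)) /\
      forall w, ~ Y w -> age N.-1 w <= t -> exists j j',
        [/\ (j < s0)%N, (j' < s0)%N, first (dyadic u.1.+1 u.2) j w,
            first (dyadic u.1 (fun i => u.2 i %/ 2)%N) j' w & linked s0 N j j' w]).
have exQ u : exists Y, Q u Y.
  case: u => a v; rewrite /Q /=.
  have [[aa0 va]|no] := pselect ((a < a0)%N /\ forall i, (v i < 2 ^ a.+1)%N); last first.
    by exists set0; split => // aa0 va; exfalso; apply: no.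
  pose m := (m0 + (a0 - a.+1))%N.
  have mN : (m + a.+1 = m0 + a0)%N by rewrite /m -addnA subnK.
  have ms : (m + a = (m0 + a0).-1)%N by rewrite -mN addnS.
  have [] := links (m := m) (a := a) (v := v) _ _ va.
  - by rewrite (leq_trans m2)// leq_addr.
  - by rewrite mN.
  by move=> Z []; rewrite mN ms -/s0 -/N => mZ Zle H; exists Z; split.
have [Z HZ] := boolp.choice exQ.
pose anc (v : {ffun 'I_d -> 'I_(2 ^ a0)}) a i := (v i %/ 2 ^ (a0 - a.+1))%N.
have anc_lt v a : (a < a0)%N -> forall i, (anc v a i < 2 ^ a.+1)%N.
  by move=> aa0 i; rewrite /anc ltn_divLR ?expn_gt0// -expnD subnKC.
pose r := [seq (v, a) | v <- enum {ffun 'I_d -> 'I_(2 ^ a0)}, a <- index_iota 0 a0].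
pose D (u : {ffun 'I_d -> 'I_(2 ^ a0)} * nat) := Z (u.2, anc u.1 u.2).
have mD u : measurable (D u) by have [] := HZ (u.2, anc u.1 u.2).
pose V : R := (((2 ^ d) ^ a0)%N)%:R.
have V0 : 0 < V by rewrite ltr0n !expn_gt0.
have cardV : #|{ffun 'I_d -> 'I_(2 ^ a0)}|%:R = V.
  by rewrite card_ffun !card_ord /V -!expnM mulnC.
have sumD : \sum_(u <- r) pr (D u) <= V * (C * q ^+ m0 / (1 - q)).
  rewrite /r big_allpairs_dep /=.
  apply: (@le_trans _ _ (\sum_(v <- enum {ffun 'I_d -> 'I_(2 ^ a0)}) C * q ^+ m0 / (1 - q))); last first.
    by rewrite big_const_seq count_predT -cardT iter_addr_0 -mulr_natl cardV.
  apply: ler_sum => v _; rewrite big_mkord.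
  apply: (@le_trans _ _ (\sum_(a < a0) C * q ^+ (m0 + (a0 - a.+1)))).
    apply: ler_sum => a _; have [_ H] := HZ (val a, anc v a).
    by have [] := H (ltn_ord a) (anc_lt v a (ltn_ord a)).
  rewrite (reindex_inj rev_ord_inj) /=.
  under eq_bigr => a _ do rewrite subnSK// subKn ?(ltnW (ltn_ord a))// exprD mulrA.
  rewrite -mulr_sumr; apply: ler_wpM2l; first by apply: mulr_ge0; [exact: ltW|apply: exprn_ge0; exact: ltW].
  by apply: sum_expr_le; rewrite (ltW q0).
set S := [set w | (largest_component _ * _ < _)%E].
have mS : measurable S by exact: (measurable_large_component (X := X)).
set Old := [set w | t < age N.-1 w].
have mOld : measurable Old by exact: (measurable_age_gt (X := X) (E := E)).
rewrite (pr_split P mS mOld) addrC; apply: lerD; last first.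
  by apply: le_pr; [exact: measurableI|exact: mOld|move=> w []].
have mB : measurable (S `&` ~` Old) by apply: measurableI => //; exact: measurableC.
suff : V / 2 * pr (S `&` ~` Old) <= \sum_(u <- r) pr (D u).
  move=> /le_trans/(_ sumD); set x := pr _; set y := C * _ / _; rewrite -mulrA ler_pM2l//.
  rewrite (_ : 2 * C * q ^+ m0 / (1 - q) = 2 * y); last by rewrite /y; ring.
  by move=> h; lra.
apply: pr_le_sum => //; first by rewrite divr_ge0// ltW.
move=> w [Sw /negP]; rewrite -leNgt => aN.
have s0N : (s0 <= N)%N.
  rewrite /s0 /N; case: (m0 + a0)%N => [|n] //=.
  by rewrite expnS leq_pmull// expn_gt0.
have chainw v : (forall a, (a < a0)%N -> ~ D (v, a) w) ->
    exists2 j, first (dyadic a0 (fun i => v i : nat)) j w & component (G t w) 0 j.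
  move=> nD; have s00 : (0 < s0)%N by rewrite !expn_gt0.
  apply: (first_in_component (K := K) (Z := fun a u => Z (a, u)) (a0 := a0) net s00 s0N aN) => //.
  - by move=> a u aa0 ua nZ; have [_ H] := HZ (a, u); have [_ /(_ w nZ aN)] := H aa0 ua.
pose good := [seq v <- enum {ffun 'I_d -> 'I_(2 ^ a0)} | [forall a : 'I_a0, w \notin D (v, val a)]].
have goodP v : v \in good -> exists2 j, first (dyadic a0 (fun i => v i : nat)) j w & component (G t w) 0 j.
  rewrite mem_filter => /andP[/forallP H _]; apply: chainw => a aa0.
  by have := H (Ordinal aa0); rewrite notin_setE.
have [f Hf] : exists f : {ffun 'I_d -> 'I_(2 ^ a0)} -> nat, forall v, v \in good ->
    first (dyadic a0 (fun i => v i : nat)) (f v) w /\ component (G t w) 0 (f v).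
  suff /boolp.choice[f Hf] : forall v, exists j, v \in good ->
    first (dyadic a0 (fun i => v i : nat)) j w /\ component (G t w) 0 j by exists f.
  move=> v; have [/goodP[j h1 h2]|] := boolP (v \in good); first by exists j.
  by exists 0%N.
have size_good : (size good)%:R < V / 2.
  have ug : uniq good by rewrite filter_uniq// enum_uniq.
  have uf : uniq [seq f v | v <- good].
    rewrite map_inj_in_uniq// => v v' vg vg' fv.
    have [[h1 _] _] := Hf v vg; have [[h2 _] _] := Hf v' vg'; rewrite -fv in h2.
    have vv := dyadic_unique (position_torus net _ w) h1 h2.
    by apply/ffunP => i; apply: val_inj; exact: vv.
  have le1 : ((size good)%:R%:E <= largest_component (G t w) :> \bar R)%E.
    have lC i : i \in [seq f v | v <- good] -> component (G t w) 0 i.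
      by move=> /mapP[v vg ->]; have [_] := Hf v vg.
    have := size_le_counting R uf lC; rewrite size_map => h; apply: (le_trans h).
    by apply: ereal_sup_ubound; exists 0%N.
  have tV : (0 <= (t^-1)%:E :> \bar R)%E by rewrite lee_fin invr_ge0 ltW.
  have := le_lt_trans (lee_wpmul2r tV le1) Sw; rewrite lte_fin ltr_pdivrMr// => h.
  exact: lt_le_trans et.
have -> : \sum_(u <- r) (\1_(D u) w : R) =
    \sum_(v <- enum {ffun 'I_d -> 'I_(2 ^ a0)}) \sum_(0 <= a < a0) \1_(D (v, a)) w.
  by rewrite /r big_allpairs_dep.
apply: (@le_trans _ _ (\sum_(v <- enum {ffun 'I_d -> 'I_(2 ^ a0)}) (v \notin good)%:R)).
  have : \sum_(v <- enum {ffun 'I_d -> 'I_(2 ^ a0)}) ((v \in good)%:R + (v \notin good)%:R) = V :> R.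
    rewrite (eq_bigr (fun=> 1)); last by move=> v _; case: (v \in good); rewrite ?addr0 ?add0r.
    by rewrite big_const_seq count_predT -cardT iter_addr_0 cardV.
  rewrite big_split /=.
  have -> : \sum_(v <- enum {ffun 'I_d -> 'I_(2 ^ a0)}) (v \in good)%:R = (size good)%:R :> R.
    rewrite -natr_sum; congr (_%:R); rewrite -sum1_size /good big_filter [RHS]big_mkcond /=.
    by apply: eq_big_seq => v ve; rewrite mem_filter ve andbT; case: ifP.
  by move=> h; lra.
rewrite big_seq [leRHS]big_seq; apply: ler_sum => v ve.
have nn : 0 <= \sum_(0 <= a < a0) (\1_(D (v, a)) w : R) by apply: sumr_ge0.
have [//|] := boolP (v \in good); rewrite mem_filter ve andbT negb_forall => /existsP[a].
rewrite negbK inE => Da; rewrite big_mkord (bigD1 a)//= indic1//.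
by rewrite lerDl sumr_ge0.
Qed.

End many_good_boxes.

Lemma giant_component_of_bound (R : realType) (disp : measure_display) (T : measurableType disp)
    (P : probability T R) (G : R -> T -> graph) :
  (forall eta : R, 0 < eta -> exists2 e0 : R, 0 < e0 & exists t1, forall e t, e < e0 -> t1 <= t ->
    (P [set w | (largest_component (G t w) * (t^-1)%:E < e%:E)%E] <= eta%:E)%E) ->
  giant_component P G.
Proof.
move=> H N /= /nbhs_EFin [r /= r0 rN].
have [e0 e00 [t1 Ht]] := H (r / 2) (divr_gt0 r0 (ltr0n _ 2)).
exists e0 => //= e; rewrite /ball /= sub0r normrN => e_lt e_gt0.
rewrite gtr0_norm// in e_lt.
set L := limf_esup _ _.
have L0 : (0 <= L)%E.
  apply: limf_esup_ge0; last by move=> t; exact: measure_ge0.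
  by move=> [M [_ /(_ (M + 1))]] /=; rewrite ltrDl; exact.
have Lr : (L <= (r / 2)%:E)%E.
  apply: (@le_trans _ _ (ereal_sup ((fun t => P [set w | (largest_component (G t w) * (t^-1)%:E < e%:E)%E]) @` [set t | t1 < t]))).
    apply: ereal_inf_lbound; exists [set t | t1 < t] => //.
    by exists t1; split => //; exact: num_real.
  by apply: ub_ereal_sup => _ [t /ltW tt <-]; exact: Ht.
have Lf : L \is a fin_num.
  by rewrite ge0_fin_numE// (le_lt_trans Lr)// ltry.
rewrite -(fineK Lf); apply: rN; rewrite /ball /= sub0r normrN ger0_norm ?fine_ge0//.
have : fine L <= r / 2 by rewrite -lee_fin fineK.
by lra.
Qed.

Section supercritical.
Context {R : realType} {disp : measure_display} {T : measurableType disp} {d : nat}.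
Context {W : nat -> {mfun T >-> R}} {X : nat -> {mfun T >-> d.-tuple R}}.
Context {E : nat -> nat -> {mfun T >-> bool}} {P : probability T R}.
Context {delta : R} {rho : R -> R} {beta gamma : R}.
Hypothesis net : age_based_network W X E P rho beta gamma.
Hypothesis rhoP : profile_function d delta rho.
Hypotheses (beta0 : 0 < beta) (gamma01 : 0 < gamma < 1) (d0 : (0 < d)%N).
Hypotheses (delta0 : 0 < delta) (supercritical : delta * (1 - gamma) < gamma).
Context {p : R} {K : nat -> nat -> {mfun T >-> bool}}.
Hypothesis marks : percolation_marks W X E P p K.
Hypothesis p01 : 0 < p <= 1.
Local Notation age := (birth_time W).
Local Notation pr := (prob P).

(** The number [b^F] of vertices is chosen as a small fraction of [t], so that they are all
born by time [t] with high probability; then the level [m0] of the finest boxes is taken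
large but fixed, and the number [b^(F - m0)] of these boxes is a positive fraction of
[t]. *)
Lemma supercritical_giant_component : giant_component P (percolate (network W E) K).
Proof.
have [g0 g1] := andP gamma01.
have [del del1 del2] : exists2 del, delta < del & del * (1 - gamma) < gamma.
  exists ((delta + gamma / (1 - gamma)) / 2).
    have : delta < gamma / (1 - gamma) by rewrite ltr_pdivlMr// subr_gt0.
    by lra.
  rewrite -ltr_pdivlMr ?subr_gt0//.
  have : delta < gamma / (1 - gamma) by rewrite ltr_pdivlMr// subr_gt0.
  by lra.
have [q q01 HC] := dyadic_link_failure net rhoP beta0 gamma01 marks p01 d0 delta0 del1 del2.
have [q0 q1] := andP q01.
apply: giant_component_of_bound => eta eta0.
pose b : R := 2 ^+ d.
have b1 : 1 < b by rewrite exprn_egt1 ?ltr1n// -lt0n.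
have bn n : (((2 ^ d) ^ n)%N)%:R = b ^+ n :> R by rewrite !natrX.
(* [A0] makes it unlikely that the first [b^F <= t / A0] vertices are not born by [t] *)
pose A0 := 1 + 4 / eta.
have A0e : 1 <= A0 by rewrite lerDl divr_ge0// ltW.
have A00 : 0 < A0 by lra.
have A01 : 2 / A0 <= eta / 2.
  rewrite ler_pdivrMr//; have : eta * (4 / eta) = 4 by field; rewrite gt_eqF.
  by rewrite /A0; set z := 4 / eta => ez; nra.
have A1 : 1 <= A0 * b by rewrite -[1]mulr1 ler_pM// ltW.
have [C C0 links] := HC _ A1.
pose m0 := (Num.truncn (4 * C / (eta * (1 - q) ^+ 2))).+2.
have q10 : 0 < 1 - q by rewrite subr_gt0.
have m0P : 2 * C * q ^+ m0 / (1 - q) <= eta / 2.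
  have : q ^+ m0 <= (m0%:R * (1 - q))^-1.
    have := @pow_le_inv R (1 - q) m0; rewrite subKr; apply => //.
    by rewrite q10; lra.
  have mm : 4 * C / (eta * (1 - q) ^+ 2) < m0%:R.
    by apply: lt_trans (truncnS_gt _) _; rewrite ltr_nat.
  rewrite ltr_pdivrMr in mm; last by rewrite mulr_gt0// exprn_gt0.
  move=> h; have m00 : 0 < m0%:R :> R by rewrite ltr0n.
  rewrite ler_pdivrMr//; apply: (@le_trans _ _ (2 * C * (m0%:R * (1 - q))^-1)).
    by rewrite ler_wpM2l// mulr_ge0// ltW.
  rewrite ler_pdivrMr ?mulr_gt0//.
  set x := m0%:R in mm *; set y := 1 - q in mm *; move: mm; rewrite expr2 => mm.
  by rewrite (_ : eta / 2 * y * (x * y) = x * (eta * (y * y)) / 2); [lra|ring].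
exists (2 * A0 * b ^+ m0.+1)^-1.
  by rewrite invr_gt0 mulr_gt0 ?exprn_gt0//; lra.
exists (A0 * b ^+ m0) => e t e_lt t1.
have t0 : 0 < t by apply: lt_le_trans t1; rewrite mulr_gt0 ?exprn_gt0//; lra.
pose n := Num.truncn (t / A0).
have tA : b ^+ m0 <= t / A0 by rewrite ler_pdivlMr// mulrC.
have nge : ((2 ^ d) ^ m0 <= n)%N.
  by rewrite truncn_ge_nat ?divr_ge0 ?(ltW t0) ?(ltW A00)// bn.
have b2 : (1 < 2 ^ d)%N by rewrite -[1%N](expn0 2) ltn_exp2l.
have n0 : (0 < n)%N by apply: leq_trans nge; rewrite !expn_gt0.
(* the largest [F] with [b^F <= t / A0] *)
pose F := trunc_log (2 ^ d) n.
have mF : (m0 <= F)%N by exact: trunc_log_max.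
have F1 : b ^+ F <= t / A0.
  rewrite -bn; apply: (@le_trans _ _ n%:R); first by rewrite ler_nat trunc_logP.
  by rewrite truncn_le divr_ge0 ?(ltW t0) ?(ltW A00).
have F2 : t / A0 < b ^+ F.+1.
  by rewrite -bn; apply: lt_le_trans (truncnS_gt _) _; rewrite ler_nat trunc_log_ltn.
have FE : (m0 + (F - m0) = F)%N by rewrite subnKC.
rewrite prE; last exact: (measurable_large_component (X := X)).
rewrite lee_fin; rewrite ltr_pdivrMr// in F2; rewrite ler_pdivlMr// in F1.
have m2 : (2 <= m0)%N by [].
apply: (le_trans (pr_small_component_le net C0 q01 t0 (fun m a v => links m a t v) (a0 := (F - m0)%N) (eps := e) m2 _ _)).
- by rewrite FE bn exprS in F2 *; lra.
- rewrite bn; have b0 : 0 < b ^+ m0.+1 by rewrite exprn_gt0//; lra.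
  have A0b : 0 < 2 * A0 * b ^+ m0.+1 by apply: mulr_gt0 => //; exact: mulr_gt0.
  apply: (@le_trans _ _ ((2 * A0 * b ^+ m0.+1)^-1 * t)); first by rewrite ler_wpM2r// ltW.
  rewrite ler_pdivrMl// (_ : 2 * A0 * b ^+ m0.+1 * (b ^+ (F - m0) / 2) = b ^+ (m0.+1 + (F - m0)) * A0).
    by rewrite addSn FE ltW.
  by rewrite exprD; field.
rewrite FE; apply: le_trans (_ : eta / 2 + eta / 2 <= _); last by lra.
apply: lerD => //; apply: le_trans A01; apply: le_trans (pr_age_gt net _ t0) _.
rewrite prednK ?expn_gt0 ?expn_gt0// bn ler_pdivrMr// mulrAC ler_pdivlMr//; lra.
Qed.

End supercritical.

(** * Robustness and non-robustness *)

Theorem theorem1p2 (R : realType) (d : nat) (delta beta gamma : R)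
    (rho : R -> R)
    (disp : measure_display) (T : measurableType disp) (P : probability T R)
    (W : nat -> {mfun T >-> R}) (X : nat -> {mfun T >-> d.-tuple R})
    (E : nat -> nat -> {mfun T >-> bool})
    (K : R -> nat -> nat -> {mfun T >-> bool}) :
  (1 <= d)%N -> 1 < delta -> 0 < beta -> 0 < gamma < 1 ->
  profile_function d delta rho ->
  age_based_network W X E P rho beta gamma ->
  (forall p, 0 < p <= 1 -> percolation_marks W X E P p (K p)) ->
  (delta / (delta + 1) < gamma -> robust P (network W E) K) /\
  (gamma < delta / (delta + 1) -> ~ robust P (network W E) K).
Proof.
move=> d1 delta1 beta0 gamma01 rhoP net marks.
have delta0 : 0 < delta by exact: lt_trans delta1.
have d10 : 0 < delta + 1 by rewrite addr_gt0.
have [g0 g1] := andP gamma01.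
split=> [super p p01|sub rob].
  have super' : delta * (1 - gamma) < gamma.
    by move: super; rewrite ltr_pdivrMr//; lra.
  exact: (supercritical_giant_component net rhoP beta0 gamma01 d1 delta0 super' (marks p p01) p01).
have [del [tau [p [[h1 h2 h3 h4 h5] [p0 p1 h6]]]]] := subcritical_constants rhoP beta0 gamma01 delta1 sub.
have p01 : 0 < p <= 1 by rewrite p0.
exact: (not_giant_component net rhoP beta0 gamma01 d1 (marks p p01) (ltW p0) h3 h1 h2 h4 h5 h6) (rob p p01).
Qed.
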